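(* Let $\Omega\subset\mathbb R^N$ be an open domain, $T>0$, $Q_T^\Omega=\Omega\times(0,T)$, and let $g\in C(\Omega\times\mathbb R_+\times\mathbb R)$ be such that $r\mapsto g(x,t,r)$ is nondecreasing for all $(x,t)\in\Omega\times\mathbb R_+$ and $r\,g(x,t,r)\ge 0$ for all $(x,t,r)\in\Omega\times\mathbb R_+\times\mathbb R$. Assume that the equation $$\partial_t u-\Delta u+g(x,t,u)=0\quad\text{in }Q_T^\Omega$$ possesses a strong barrier at every $z\in\Omega$. If $u\in C^1(Q_T^\Omega)$ is a positive solution of this equation, then $u$ admits an initial trace, which belongs to the class of outer regular positive Borel measures in $\Omega$. That is, there exist a relatively closed set $\mathcal S\subset\Omega$ and a positive Radon measure $\mu$ on $\mathcal R:=\Omega\setminus\mathcal S$ such that (i) for every $x_0\in\mathcal S$ and every $\epsilon>0$, $\displaystyle\lim_{t\to0}\int_{B_\epsilon(x_0)\cap\Omega}u(x,t)\,dx=\infty$; (ii) for every $\zeta\in C_c(\mathcal R)$, $\displaystyle\lim_{t\to0}\int_{\mathcal R}u(x,t)\zeta(x)\,dx=\int_{\mathcal R}\zeta\,d\mu$; and the couple $(\mathcal S,\mu)$ is identified with the outer regular positive Borel measure $\nu$ on $\Omega$ given by $\nu(E)=\infty$ if $E\subset\Omega$ is Borel with $E\cap\mathcal S\ne\emptyset$, and $\nu(E)=\mu(E)$ if $E\subset\mathcal R$ is Borel.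
   Context: $\mathbb R_+=(0,\infty)$ for the time variable (so nonlinearities such as $t^\alpha|r|^{q-1}r$ with $\alpha>-1$ are allowed). Solutions and supersolutions are understood in the sense of distributions. Strong barrier at $z\in\Omega$: there exists $r_0\in(0,\mathrm{dist}(z,\partial\Omega))$ such that for every $r\in(0,r_0)$ there is a positive supersolution $w=w_{r,z}$ of the equation in $B_r(z)\times(0,T)$ with $w\in C(B_r(z)\times[0,T))$ and $\lim_{|x-z|\to r}w(x,t)=\infty$ locally uniformly for $t\in(0,T)$. A Borel measure $\nu$ on $\Omega$ with values in $[0,\infty]$ is outer regular if $\nu(E)=\inf\{\nu(O):O\supset E,\ O\text{ open}\}$ for every Borel $E\subset\Omega$. *)

(* Defs.v *)
From HB Require Import structures.
From mathcomp Require Import all_boot all_order all_algebra.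
From mathcomp Require Import all_classical all_reals all_analysis.
From mathcomp Require Import measurable_realfun lra.
Set Implicit Arguments.
Unset Strict Implicit.
Unset Printing Implicit Defensive.
Import Order.TTheory GRing.Theory Num.Theory numFieldNormedType.Exports.
Local Open Scope classical_set_scope.
Local Open Scope ring_scope.

(* 'rV[R]_n is equipped with its Borel sigma-algebra. *)
Section borel_rV.
Context (R : realType) (n : nat).

Let G : set (set 'rV[R]_n) := open.

Lemma borel_rV0 : <<s G >> set0.
Proof. exact: sigma_algebra0. Qed.

Lemma borel_rVC (A : set 'rV[R]_n) : <<s G >> A -> <<s G >> (~` A).
Proof. by move=> GA; rewrite -setTD; exact: sigma_algebraCD. Qed.

Lemma borel_rV_bigcup (F : (set 'rV[R]_n)^nat) :
  (forall i, <<s G >> (F i)) -> <<s G >> (\bigcup_i F i).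
Proof. exact: sigma_algebra_bigcup. Qed.

HB.instance Definition _ := @isMeasurable.Build (sigma_display G)
  'rV[R]_n <<s G >> borel_rV0 borel_rVC borel_rV_bigcup.

Lemma open_measurable_rV (U : set 'rV[R]_n) : open U -> measurable U.
Proof. exact: sub_gen_smallest. Qed.

(* Second countability: every open set is a countable union of rational open
   cubes, so measurability into 'rV[R]_n can be checked coordinatewise. *)
Let cube (q : 'rV[rat]_n) (k : nat) : set 'rV[R]_n :=
  [set v | forall i, `|ratr (q 0 i) - v 0 i| < k.+1%:R^-1].

Lemma open_cubes (U : set 'rV[R]_n) : open U ->
  U = \bigcup_qk (if `[< cube qk.1 qk.2 `<=` U >] then cube qk.1 qk.2 else set0).
Proof.
move=> oU; apply/seteqP; split => [v Uv|v [[q k] _ /=]]; last first.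
  by case: asboolP => // qU /qU.
have /nbhs_ballP[e/= e0 veU] : nbhs v U by exact: open_nbhs_nbhs.
pose k := Num.truncn (2 / e).
have ke : k.+1%:R^-1 < e / 2.
  rewrite -[e / 2]invrK invf_div ltf_pV2 ?posrE ?divr_gt0//.
  exact: truncnS_gt.
have k0 : 0 < k.+1%:R^-1 :> R by rewrite invr_gt0.
have qP i : {q : rat | ratr q \in `](v 0 i - k.+1%:R^-1), (v 0 i)[}.
  by apply/cid/rat_in_itvoo; rewrite ltrBlDr ltrDl.
pose q : 'rV[rat]_n := \row_i sval (qP i).
have vq : cube q k v.
  move=> i; rewrite mxE; case: (qP i) => /= r.
  rewrite in_itv/= => /andP[r1 r2].
  move: r1 r2 k0; move: (_^-1) (ratr _) => a b r1 r2 k0.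
  by rewrite ltr_norml; apply/andP; split; lra.
exists (q, k) => //=; case: asboolP => // -[] w wq; apply: veU.
split => // i j; rewrite (ord1 i) /ball/= /ball_/=.
have := vq j; have := wq j; move: ke; rewrite !ltr_norml.
move: (_^-1) (ratr _) => a b ? /andP[? ?] /andP[? ?].
by apply/andP; split; lra.
Qed.

Lemma measurable_fun_rV d (T : measurableType d) (f : T -> 'rV[R]_n) :
  (forall i, measurable_fun [set: T] (fun x => f x 0 i)) ->
  measurable_fun [set: T] f.
Proof.
move=> mf; apply: (measurability G erefl) => _ [U oU <-].
rewrite setTI (open_cubes oU) preimage_bigcup.
apply: countable_bigcupT_measurable; first exact: countableP.
move=> [q k]/=; case: ifPn => _; last by rewrite preimage_set0.
have -> : f @^-1` cube q k = \bigcap_(i in [set: 'I_n])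
    (fun x => f x 0 i) @^-1` [set y | `|ratr (q 0 i) - y| < k.+1%:R^-1].
  by apply/seteqP; split => x /= fx i; [move=> _|]; apply: fx.
apply: fin_bigcap_measurable; first exact: finite_finset.
move=> i _; rewrite -[X in measurable X]setTI; apply: mf => //.
have -> : [set y : R | `|ratr (q 0 i) - y| < k.+1%:R^-1] =
   ball (ratr (q 0 i) : R) k.+1%:R^-1 by [].
by apply: open_measurable; exact: ball_open.
Qed.

Lemma continuous_measurable_rV (f : 'rV[R]_n -> R) :
  continuous f -> measurable_fun setT f.
Proof.
move=> /continuousP cf.
apply: (measurability _ (RGenOpens.measurableE R)) => _ [_ [a [b ->]] <-].
rewrite setTI; apply: open_measurable_rV; apply: cf; exact: interval_open.
Qed.

End borel_rV.

Section lebesgue_rV.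
Context (R : realType).

Definition cons_rV n (p : R * 'rV[R]_n) : 'rV[R]_n.+1 :=
  \row_i (if unlift ord0 i is Some j then p.2 0 j else p.1).

Definition uncons_rV n (v : 'rV[R]_n.+1) : R * 'rV[R]_n :=
  (v 0 ord0, \row_j v 0 (lift ord0 j)).

Lemma cons_rVK n : cancel (@cons_rV n) (@uncons_rV n).
Proof.
move=> [x v]; rewrite /uncons_rV mxE unlift_none; congr pair.
by apply/rowP => j; rewrite !mxE liftK.
Qed.

Lemma measurable_coord_rV n (i : 'I_n) :
  measurable_fun setT (fun v : 'rV[R]_n => v 0 i).
Proof. by apply: continuous_measurable_rV => v; exact: coord_continuous. Qed.

Lemma measurable_cons_rV n : measurable_fun setT (@cons_rV n).
Proof.
apply: measurable_fun_rV => i; rewrite /cons_rV.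
under eq_fun do rewrite mxE.
case: unliftP => [j _|_]; last exact: measurable_fst.
exact: (measurableT_comp (measurable_coord_rV j) measurable_snd).
Qed.

Lemma measurable_uncons_rV n : measurable_fun setT (@uncons_rV n).
Proof.
apply: measurable_fun_pair; first exact: measurable_coord_rV.
apply: measurable_fun_rV => i; under eq_fun do rewrite mxE.
exact: measurable_coord_rV.
Qed.

Section step.
Context (n : nat) (m : {sigma_finite_measure set 'rV[R]_n -> \bar R}).

Definition lebesgue_rV_step : set 'rV[R]_n.+1 -> \bar R :=
  pushforward (@lebesgue_measure R \x m)%E (@cons_rV n).

Let pf : {measure set 'rV[R]_n.+1 -> \bar R} :=
  measure_function_pushforward__canonical__measure_function_Measure
    (@lebesgue_measure R \x m)%E (@measurable_cons_rV n).

HB.instance Definition _ := isMeasure.Build _ _ _ lebesgue_rV_step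
  (measure0 pf) (measure_ge0 pf) (@measure_semi_sigma_additive _ _ _ pf).

Let lebesgue_rV_step_sigma_finite : sigma_finite setT lebesgue_rV_step.
Proof.
have /sigma_finiteP[F [FT ndF mF]] := @sigma_finiteT _ _ _ (@lebesgue_measure R).
have /sigma_finiteP[G [GT ndG mG]] := @sigma_finiteT _ _ _ m.
exists (fun k => @uncons_rV n @^-1` (F k `*` G k)).
  rewrite -preimage_bigcup; apply/seteqP; split => // v _.
  have [k _ Fk] : (\bigcup_i F i) (v 0 ord0) by rewrite -FT.
  have [l _ Gl] : (\bigcup_i G i) (uncons_rV v).2 by rewrite -GT.
  exists (maxn k l) => //; split => /=.
    exact/(subsetPset _ _ (ndF _ _ (leq_maxl k l))).
  exact/(subsetPset _ _ (ndG _ _ (leq_maxr k l))).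
move=> k; have [mFk Fkoo] := mF k; have [mGk Gkoo] := mG k; split.
  rewrite -[X in measurable X]setTI; apply: measurable_uncons_rV => //.
  exact: measurableX.
rewrite /lebesgue_rV_step /pushforward -comp_preimage.
rewrite (_ : _ \o _ = id); last by apply/funext => p; exact: cons_rVK.
by rewrite preimage_id product_measure1E// lte_mul_pinfty// ge0_fin_numE.
Qed.

HB.instance Definition _ := Measure_isSigmaFinite.Build _ _ _ lebesgue_rV_step
  lebesgue_rV_step_sigma_finite.

End step.

(* Lebesgue measure on R^n as the n-fold product of lebesgue_measure. *)
Fixpoint lebesgue_rV n : {sigma_finite_measure set 'rV[R]_n -> \bar R} :=
  match n with
  | 0 => \d_(0 : 'rV[R]_0)
  | k.+1 => lebesgue_rV_step (lebesgue_rV k)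
  end.

Lemma measurable_box_rV n (A : 'I_n -> set R) : (forall i, measurable (A i)) ->
  measurable [set v : 'rV[R]_n | forall i, A i (v 0 i)].
Proof.
move=> mA.
have -> : [set v : 'rV[R]_n | forall i, A i (v 0 i)] =
    \bigcap_(i in [set: 'I_n]) (fun v : 'rV[R]_n => v 0 i) @^-1` A i.
  by apply/seteqP; split => v /= Av i; [move=> _|]; apply: Av.
apply: fin_bigcap_measurable; first exact: finite_finset.
by move=> i _; rewrite -[X in measurable X]setTI; exact: measurable_coord_rV.
Qed.

Lemma lebesgue_rV_box n (A : 'I_n -> set R) : (forall i, measurable (A i)) ->
  lebesgue_rV n [set v | forall i, A i (v 0 i)] =
  (\prod_(i < n) @lebesgue_measure R (A i))%E.
Proof.
elim: n A => [|n ih] A mA /=.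
  by rewrite big_ord0 diracE mem_set//= => -[].
rewrite big_ord_recl -ih// -product_measure1E//; last 2 first.
- exact: (mA ord0).
- exact: (@measurable_box_rV n (fun i => A (lift ord0 i))).
rewrite /lebesgue_rV_step /pushforward; congr ((_ \x _)%E _).
apply/seteqP; split => [[x v] /= Av|[x v] /= [Ax Av] i].
  split=> [|i]; first by have := Av ord0; rewrite mxE unlift_none.
  by have := Av (lift ord0 i); rewrite mxE liftK.
by rewrite mxE; case: unliftP => [j ->|->].
Qed.

End lebesgue_rV.

Definition open_domain (T : topologicalType) (Omega : set T) :=
  [/\ open Omega, connected Omega & Omega !=set0].

Section calculus.
Context (R : realType) (V : normedModType R).
Implicit Types (A D : set V) (f : V -> R) (vs : seq V).

(* C^1 on an open set A, through all directional derivatives. *)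
Definition C1_on A f :=
  {within A, continuous f} /\
  forall v, (forall p, A p -> derivable f p v) /\ {within A, continuous 'D_v f}.

Definition iterD f vs : V -> R := foldr (fun v h => 'D_v h) f vs.

Definition smooth f :=
  forall vs, continuous (iterD f vs) /\
             forall p v, derivable (iterD f vs) p v.

Definition compactly_supported_in D f :=
  exists K, [/\ compact K, K `<=` D & forall p, ~ K p -> f p = 0].

(* C_c^infty(D); functions are extended by 0 to the whole space. *)
Definition test_function D f := smooth f /\ compactly_supported_in D f.

(* C_c(D); functions are extended by 0 to the whole space. *)
Definition continuous_cpt D f := continuous f /\ compactly_supported_in D f.

End calculus.

Section parabolic.
Context (R : realType) (N : nat).
Local Notation space := 'rV[R]_N.
Local Notation spacetime := ('rV[R]_N * R)%type.
Implicit Types (Omega : set space) (D : set spacetime) (T : R)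
  (g : space -> R -> R -> R) (u w phi : spacetime -> R).

(* The norm of the library on 'rV[R]_N is the sup norm. *)
Definition enorm (x : space) : R := Num.sqrt (\sum_i x 0 i ^+ 2).

Definition eball (z : space) (r : R) : set space := [set x | enorm (x - z) < r].

(* dist(z, boundary of Omega); +oo when the boundary is empty. *)
Definition dist_boundary Omega (z : space) : \bar R :=
  ereal_inf [set (enorm (z - y))%:E | y in closure Omega `\` Omega°].

Definition dt phi : spacetime -> R := 'D_((0 : space), (1 : R)) phi.

Definition laplacian phi : spacetime -> R := fun p =>
  \sum_(i < N) 'D_((delta_mx 0 i : space), (0 : R))
                 ('D_((delta_mx 0 i : space), (0 : R)) phi) p.

Definition dxdt : {measure set (space * measurableTypeR R) -> \bar R} :=
  (lebesgue_rV R N \x @lebesgue_measure R)%E.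

Definition locally_integrable_on D (f : spacetime -> R) :=
  forall K, compact K -> K `<=` D -> dxdt.-integrable K (EFin \o f).

(* The pairing < w_t - Delta w + g(x,t,w), phi > of distributions in D. *)
Definition weak_form g D w phi : \bar R :=
  (\int[dxdt]_(p in D)
     (- w p * dt phi p - w p * laplacian phi p + g p.1 p.2 (w p) * phi p)%:E)%E.

(* w and g(x,t,w) define distributions in D. *)
Definition weakly_admissible g D w :=
  locally_integrable_on D w /\
  locally_integrable_on D (fun p => g p.1 p.2 (w p)).

Definition solution g D u :=
  weakly_admissible g D u /\
  forall phi, test_function D phi -> weak_form g D u phi = 0%E.

Definition supersolution g D w :=
  weakly_admissible g D w /\
  forall phi, test_function D phi -> (forall p, 0 <= phi p) ->
    (0 <= weak_form g D w phi)%E.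

Definition strong_barrier g Omega T (z : space) :=
  exists r0 : R, [/\ 0 < r0, (r0%:E < dist_boundary Omega z)%E &
    forall r, 0 < r -> r < r0 ->
    exists w,
      [/\ forall p, (eball z r `*` `]0, T[%classic) p -> 0 < w p,
          supersolution g (eball z r `*` `]0, T[%classic) w,
          {within eball z r `*` `[0, T[%classic, continuous w} &
          (* w -> oo as |x - z| -> r, uniformly on compact sets of times *)
          forall K : set R, compact K -> K `<=` `]0, T[%classic ->
          forall M : R, exists2 delta, 0 < delta &
          forall x t, K t -> r - delta < enorm (x - z) < r -> M < w (x, t)]].

(* Measures on a Borel subset U of R^N are represented by their extension by
   zero to the Borel sets of R^N. *)
Definition carried_by (U : set space) (nu : set space -> \bar R) :=
  nu (~` U) = 0%E.

Definition outer_regular_on (U : set space) (nu : set space -> \bar R) :=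
  forall E, measurable E -> E `<=` U ->
    nu E = ereal_inf [set nu O | O in [set O | [/\ open O, E `<=` O & O `<=` U]]].

Definition radon_on (U : set space) (mu : {measure set space -> \bar R}) :=
  [/\ carried_by U mu,
      (forall K, compact K -> K `<=` U -> (mu K < +oo)%E) &
      (forall E, measurable E -> E `<=` U ->
         mu E = ereal_sup [set mu K | K in [set K | compact K /\ K `<=` E]])].

Definition relatively_closed Omega (S : set space) :=
  exists2 F, closed F & S = Omega `&` F.

Definition initial_trace Omega u (S : set space)
    (mu : {measure set space -> \bar R}) :=
  [/\ relatively_closed Omega S,
      radon_on (Omega `\` S) mu,
      (forall x0, S x0 -> forall eps, 0 < eps ->
         (\int[lebesgue_rV R N]_(x in eball x0 eps `&` Omega) (u (x, t))%:E)%E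
           @[t --> 0^'+] --> +oo%E) &
      (forall zeta : space -> R, continuous_cpt (Omega `\` S) zeta ->
         (\int[lebesgue_rV R N]_(x in Omega `\` S) (u (x, t) * zeta x)%:E)%E
           @[t --> 0^'+] -->
         (\int[mu]_(x in Omega `\` S) (zeta x)%:E)%E)].

Definition trace_measure Omega (S : set space)
    (mu nu : {measure set space -> \bar R}) :=
  [/\ carried_by Omega nu,
      (forall E, measurable E -> E `<=` Omega -> E `&` S !=set0 ->
         nu E = +oo%E) &
      (forall E, measurable E -> E `<=` Omega `\` S -> nu E = mu E)].

End parabolic.

(* Main.v *)
(* S is the set of the points x such that the mass of u(t) on every ball centred
   at x tends to infinity as t -> 0.

   Comparison: let v = u - w be a difference of a solution and a supersolution,
   nonpositive near the lateral boundary. The mollification V of v in space-time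
   satisfies V_t <= Delta V up to a small error where V > 0, and the integral over
   {V > 0} of a second difference of V is nonpositive, by translation invariance
   of the integral of V_+. Hence the integral of v_+ is nonincreasing in time.
   If z is not in S, the mass of u on some ball at z is bounded along a sequence
   of times tending to 0; with w a strong barrier at z, it follows that the mass
   of u near z is bounded up to t = 0. So S is relatively closed, and u has bounded
   mass on the compact subsets of its complement.

   In the same way, for a semiconcave weight zeta >= 0 supported off S, the second
   differences can be moved to zeta, so that the integral of u zeta is
   nonincreasing in time up to a linear function, hence has a limit as t -> 0.
   Any nonnegative continuous function with compact support off S is uniformly
   approximated from below by its inf-convolutions, which are semiconcave. The
   limit is a positive linear functional, and mu represents it by Riesz' theorem;
   nu adds to mu the measure equal to infinity on the sets that meet S. *)
Require Import Defs.
From HB Require Import structures.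
From mathcomp Require Import all_boot all_order all_algebra.
From mathcomp Require Import all_classical all_reals all_analysis.
From mathcomp Require Import measurable_realfun ring lra.
Import Order.TTheory GRing.Theory Num.Theory numFieldNormedType.Exports.
Local Open Scope classical_set_scope.
Local Open Scope ring_scope.
Set Implicit Arguments.
Unset Strict Implicit.
Unset Printing Implicit Defensive.

(** The obstacle is that the natural test functions are not smooth: comparison calls for the
    indicator of {V > 0}, whose boundary may be irregular, and the trace calls for weights that are
    merely semiconcave. Finite differences avoid both Green's formula and a regularised sign
    function. For a mollified function, Taylor's formula makes a second difference equal to h^2
    times the second derivative up to C h^3, uniformly in the point, and its integral against such a
    weight is bounded using only convexity or a change of variables. Time is treated likewise: a
    step of length h costs an error C h^2, so the total error vanishes with h. Here C depends on the
    mollifier, so h tends to 0 before the mollification radius does. The barrier yields a bound that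
    is uniform in the starting time because it is continuous, hence bounded, down to t = 0 on a
    smaller ball. The sign condition and u > 0 give g(x,t,u) >= 0, so that upper bounds on second
    differences of the weight suffice; semiconcavity is exactly such a bound. *)

Section compact_uniform.
Context {R : realType} {V : normedModType R}.
Implicit Types (K U : set V) (f : V -> R).

(** The local hypothesis holds for all nearby points and all small radii at once; the near-covering
    form of compactness, along the filter of small positive radii, then yields a common radius
    without any monotonicity of [P]. *)
Lemma compact_near_radius K (P : R -> V -> Prop) : compact K ->
  (forall x, K x -> exists2 e : R, 0 < e &
     forall y r, `|x - y| < e -> 0 < r < e -> P r y) ->
  exists2 e : R, 0 < e & forall x, K x -> P e x.
Proof.
move=> /compact_near_coveringP cK KP.
have H : \forall e \near (0:R)^'+, K `<=` P e.
  apply: cK => x /KP[e e0 eP].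
  exists (ball x e, [set r | 0 < r < e]) => /=.
    split; first exact: nbhsx_ballx.
    near=> r; apply/andP; split; near: r; first exact: nbhs_right_gt.
    exact: nbhs_right_lt.
  by move=> [x' r] /= [xx' re]; apply: eP => //; rewrite -ball_normE in xx'.
near (0:R)^'+ => e; exists e; last by near: e.
by near: e; exact: nbhs_right_gt.
Unshelve. all: by end_near. Qed.

Lemma compact_open_margin K U : compact K -> open U -> K `<=` U ->
  exists2 e : R, 0 < e & forall x y, K x -> `|x - y| < e -> U y.
Proof.
move=> cK oU KU.
have [] := @compact_near_radius K (fun e x => forall y, `|x - y| < e -> U y) cK.
  move=> x /KU Ux; have /nbhs_ballP[e/= e0 eU] : nbhs x U by exact: open_nbhs_nbhs.
  exists (e / 2) => [|x' r xx' /andP[_ re] y x'y]; first by rewrite divr_gt0.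
  apply: eU; rewrite -ball_normE /ball_/=.
  rewrite (splitr e) -(subrKA x'); apply: (le_lt_trans (ler_normD _ _)).
  by rewrite ltrD// (lt_trans x'y).
by move=> e e0 eU; exists e => // x y Kx; exact: eU.
Qed.

Lemma within_continuous_distP K f : {within K, continuous f} ->
  forall x, K x -> forall w : R, 0 < w -> exists2 e : R, 0 < e &
    forall y, K y -> `|x - y| < e -> `|f x - f y| < w.
Proof.
move=> /subspace_continuousP cf x Kx w w0.
have /cvgrPdist_lt /(_ _ w0) := cf x Kx.
rewrite near_withinE => /nbhs_ballP[e/= e0 H]; exists e => // y Ky xy.
by apply: H => //; rewrite -ball_normE.
Qed.

Lemma compact_unif_continuous K f : compact K -> {within K, continuous f} ->
  forall w : R, 0 < w -> exists2 e : R, 0 < e &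
    forall x y, K x -> K y -> `|x - y| < e -> `|f x - f y| < w.
Proof.
move=> cK /within_continuous_distP cf w w0.
have [] := @compact_near_radius K
    (fun e x => K x -> forall y, K y -> `|x - y| < e -> `|f x - f y| < w) cK.
  move=> x Kx; have w20 : 0 < w / 2 by rewrite divr_gt0.
  have [e e0 H] := cf _ Kx _ w20.
  exists (e / 2) => [|x' r xx' /andP[_ re] Kx' y Ky x'y]; first by rewrite divr_gt0.
  have xx'e : `|x - x'| < e by rewrite (lt_trans xx')// ltr_pdivrMr// ltr_pMr// ltr1n.
  have xye : `|x - y| < e.
    rewrite (splitr e) -(subrKA x'); apply: (le_lt_trans (ler_normD _ _)).
    by rewrite ltrD// (lt_trans x'y).
  have h1 := H _ Kx' xx'e; have h2 := H _ Ky xye.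
  rewrite (splitr w) -(subrKA (f x)); apply: (le_lt_trans (ler_normD _ _)).
  by rewrite ltrD// distrC.
by move=> e e0 eU; exists e => // x y Kx; exact: eU.
Qed.

Lemma compact_bounded_fun K f : compact K -> {within K, continuous f} ->
  exists2 M : R, 0 < M & forall x, K x -> `|f x| <= M.
Proof.
move=> cK cf; have := compact_bounded (continuous_compact cf cK).
move=> [M [_ MP]]; exists (`|M| + 1) => [|x Kx]; first by rewrite ltr_wpDl.
apply: (MP (`|M| + 1)); first by rewrite ltr_pwDr// ler_norm.
by exists x.
Qed.

End compact_uniform.

(** * Translation invariance of Lebesgue measure *)

Section invariant_integral.
Context d (X : measurableType d) (R : realType) (mu : {measure set X -> \bar R}).
Variable phi : X -> X.
Hypothesis mphi : measurable_fun setT phi.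
Hypothesis inv_phi : forall A, measurable A -> mu (phi @^-1` A) = mu A.

Let ge0_integral_invariant (f : X -> \bar R) : measurable_fun setT f ->
  (forall x, 0 <= f x)%E -> (\int[mu]_x f (phi x) = \int[mu]_x f x)%E.
Proof.
move=> mf f0.
have := @ge0_integral_pushforward _ _ _ _ R _ mphi mu setT f measurableT mf.
rewrite preimage_setT => <- //.
by apply: eq_measure_integral => A mA _; rewrite -inv_phi.
Qed.

Lemma integral_invariant (f : X -> \bar R) : measurable_fun setT f ->
  (\int[mu]_x f (phi x) = \int[mu]_x f x)%E.
Proof.
move=> mf; rewrite integralE [RHS]integralE.
rewrite -(ge0_integral_invariant (measurable_funepos mf)); last first.
  by move=> x; exact: funepos_ge0.
rewrite -(ge0_integral_invariant (measurable_funeneg mf)); last first.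
  by move=> x; exact: funeneg_ge0.
by congr (_ - _)%E; apply: eq_integral => x _; rewrite ?funeposE ?funenegE.
Qed.

Lemma Rintegral_invariant (f : X -> R) : measurable_fun setT f ->
  \int[mu]_x f (phi x) = \int[mu]_x f x.
Proof.
move=> mf; rewrite /Rintegral -(@integral_invariant (EFin \o f))//.
exact/measurable_EFinP.
Qed.

End invariant_integral.

Section lebesgue_rV_translation.
Context (R : realType).

(** The pushforward of the product measure by the product map agrees with it on rectangles, and the
    product measure is determined by its values there. *)
Lemma product_measure_invariant d1 d2 (T1 : measurableType d1)
    (T2 : measurableType d2) (m1 : {sigma_finite_measure set T1 -> \bar R})
    (m2 : {sigma_finite_measure set T2 -> \bar R}) (f1 : T1 -> T1) (f2 : T2 -> T2) :
  measurable_fun setT f1 -> measurable_fun setT f2 ->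
  (forall A, measurable A -> m1 (f1 @^-1` A) = m1 A) ->
  (forall A, measurable A -> m2 (f2 @^-1` A) = m2 A) ->
  forall X : set (T1 * T2), measurable X ->
  (m1 \x m2)%E ((fun p => (f1 p.1, f2 p.2)) @^-1` X) = (m1 \x m2)%E X.
Proof.
move=> mf1 mf2 if1 if2 X mX.
have mf : measurable_fun setT (fun p : T1 * T2 => (f1 p.1, f2 p.2)).
  by apply: measurable_fun_pair; [exact: measurableT_comp mf1 _|exact: measurableT_comp mf2 _].
pose m' : {measure set (T1 * T2) -> \bar R} :=
  measure_function_pushforward__canonical__measure_function_Measure (m1 \x m2)%E mf.
rewrite [RHS](@product_measure_unique _ _ _ _ _ m1 m2 m')// => A B mA mB.
rewrite /m'/= /pushforward -[X in (_ \x _)%E X]/((f1 @^-1` A) `*` (f2 @^-1` B)).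
have mA' : measurable (f1 @^-1` A) by rewrite -[_ @^-1` _]setTI; exact: mf1.
have mB' : measurable (f2 @^-1` B) by rewrite -[_ @^-1` _]setTI; exact: mf2.
by rewrite product_measure1E//; congr (_ * _)%E; [exact: if1|exact: if2].
Qed.

Lemma lebesgue_measure_translation (y : R) (A : set (measurableTypeR R)) : measurable A ->
  @lebesgue_measure R ((fun x => x + y) @^-1` A) = @lebesgue_measure R A.
Proof.
move=> mA.
have mf : measurable_fun setT ((fun x => x + y) : measurableTypeR R -> measurableTypeR R).
  exact: measurable_funD.
pose m' := measure_function_pushforward__canonical__measure_function_Measure
  (@lebesgue_measure R) mf.
rewrite [RHS](@lebesgue_measure_unique R m')//= => _ [[a b]] _ <-.
rewrite /pushforward.
rewrite (_ : _ @^-1` _ = `](a - y), (b - y)]%classic); last first.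
  by apply/seteqP; split => x /=; rewrite !in_itv/= ltrBlDr lerBrDr.
by rewrite !lebesgue_measure_itv/= !lte_fin ltrD2r -!EFinD opprB addrA subrK.
Qed.

Lemma continuous_rV_measurable n (f : 'rV[R]_n -> 'rV[R]_n) : continuous f ->
  measurable_fun setT f.
Proof.
move=> /continuousP cf; apply: (measurability (open : set (set 'rV[R]_n)) erefl) => _ [U oU <-].
by rewrite setTI; apply: open_measurable_rV; exact: cf.
Qed.

(** Induction on the dimension: under [cons_rV] a translation splits into a translation of the first
    coordinate and one of the remaining row. *)
Lemma lebesgue_rV_translation n (y : 'rV[R]_n) A : measurable A ->
  lebesgue_rV R n ((fun x => x + y) @^-1` A) = lebesgue_rV R n A.
Proof.
elim: n y A => [|n ih] y A mA /=.
  by rewrite !diracE (_ : _ \in _ = (0 \in A))//; congr (_ \in _);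
    apply/seteqP; split => x /=; rewrite !(thinmx0 x) !(thinmx0 y) ?thinmx0.
rewrite /lebesgue_rV_step /pushforward.
rewrite -[RHS](@product_measure_invariant _ _ _ _ (@lebesgue_measure R)
  (lebesgue_rV R n) (fun x => x + y 0 ord0) (fun v => v + \row_j y 0 (lift ord0 j))).
- congr ((_ \x _)%E _); apply/seteqP; split => -[x v] /=; congr A;
    apply/rowP => i; rewrite !mxE; case: unliftP => [j ->|->]; rewrite ?liftK ?unlift_none//= ?mxE//.
- exact: measurable_funD.
- by apply: continuous_rV_measurable => x; apply: continuousD => //; exact: cst_continuous.
- by move=> B mB; exact: lebesgue_measure_translation.
- by move=> B mB; exact: ih.
- rewrite -[X in measurable X]setTI; exact: measurable_cons_rV.
Qed.

Lemma dxdt_translation n (q : 'rV[R]_n * R) A : measurable A ->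
  dxdt R n ((fun p : 'rV[R]_n * R => p + q) @^-1` A) = dxdt R n A.
Proof.
move=> mA; rewrite /dxdt.
apply: (@product_measure_invariant _ _ _ _ (lebesgue_rV R n) (@lebesgue_measure R)
  (fun v => v + q.1) (fun x => x + q.2)) => //.
- by apply: continuous_rV_measurable => x; apply: (@cvgD _ _ _ (nbhs x)) => //; exact: cvg_cst.
- exact: measurable_funD.
- by move=> B mB; exact: lebesgue_rV_translation.
- by move=> B mB; exact: lebesgue_measure_translation.
Qed.

End lebesgue_rV_translation.

(** * Borel sets and integrability on compact sets *)

Section borel_compact.
Context (R : realType).

(** The product space carries the product sigma-algebra, which is not generated by open sets by
    definition. Gluing time and space into a row of length n + 1 transfers the claim to a space
    whose sigma-algebra is. *)
Lemma open_measurable_prod n (U : set ('rV[R]_n * R)) : open U ->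
  measurable (U : set ('rV[R]_n * measurableTypeR R)).
Proof.
move=> oU; pose U' := [set v : 'rV[R]_n.+1 | U ((uncons_rV v).2, (uncons_rV v).1)].
have oU' : open U'.
  rewrite openE => v /= Uv; have /nbhs_ballP[e/= e0 eU] := open_nbhs_nbhs (conj oU Uv).
  apply/nbhs_ballP; exists e => //= w [_ vw]; apply: eU; split => /=.
    by split => // i j; rewrite !mxE; exact: vw.
  exact: vw.
have mc : measurable_fun setT (fun p : 'rV[R]_n * measurableTypeR R => cons_rV (p.2, p.1)).
  apply: (measurableT_comp (@measurable_cons_rV R n)).
  exact: (measurable_fun_pair measurable_snd measurable_fst).
have -> : U = (fun p : 'rV[R]_n * measurableTypeR R => cons_rV (p.2, p.1)) @^-1` U'.
  by apply/seteqP; split => -[x t]; rewrite /U' /preimage /mkset cons_rVK.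
rewrite -[X in measurable X]setTI; apply: mc => //.
exact: open_measurable_rV.
Qed.

Lemma compact_closed_normed (V : normedModType R) (K : set V) : compact K -> closed K.
Proof. by apply: compact_closed; exact: norm_hausdorff. Qed.

Lemma closed_measurable_rV n (F : set 'rV[R]_n) : closed F -> measurable F.
Proof. by rewrite -openC => /open_measurable_rV/measurableC; rewrite setCK. Qed.

Lemma closed_measurable_prod n (F : set ('rV[R]_n * R)) : closed F ->
  measurable (F : set ('rV[R]_n * measurableTypeR R)).
Proof. by rewrite -openC => /open_measurable_prod/measurableC; rewrite setCK. Qed.

Lemma compact_measurable_rV n (K : set 'rV[R]_n) : compact K -> measurable K.
Proof.
by move=> /compact_closed_normed/closed_measurable_rV.
Qed.

Lemma compact_measurable_prod n (K : set ('rV[R]_n * R)) : compact K ->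
  measurable (K : set ('rV[R]_n * measurableTypeR R)).
Proof.
by move=> /compact_closed_normed/closed_measurable_prod.
Qed.

Lemma continuous_measurable_prod n (f : 'rV[R]_n * R -> R) : continuous f ->
  measurable_fun setT (f : 'rV[R]_n * measurableTypeR R -> R).
Proof.
move=> /continuousP cf.
apply: (measurability _ (RGenOpens.measurableE R)) => _ [_ [a [b ->]] <-].
by rewrite setTI; apply: open_measurable_prod; apply: cf; exact: interval_open.
Qed.

Lemma within_continuous_measurable_rV n (D : set 'rV[R]_n) (f : 'rV[R]_n -> R) :
  measurable D -> {within D, continuous f} -> measurable_fun D f.
Proof.
move=> mD /continuousP cf.
apply: (measurability _ (RGenOpens.measurableE R)) => _ [_ [a [b ->]] <-].
have /open_subspaceP[V oV VD] := cf _ (@interval_open R (BRight a) (BLeft b) erefl erefl).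
rewrite setIC -VD; apply: measurableI => //; exact: open_measurable_rV.
Qed.

Lemma compact_le_norm {V : normedModType R} (K : set V) : compact K ->
  exists2 M : R, 0 < M & forall x, K x -> `|x| <= M.
Proof.
move=> cK; have [|M M0 KM] := @compact_bounded_fun _ _ K (fun x => `|x|) cK.
  by apply: continuous_subspaceT => x; exact: norm_continuous.
by exists M => // x /KM; rewrite normr_id.
Qed.

Lemma lebesgue_rV_ball_fin n (M : R) :
  (lebesgue_rV R n [set x | (`|x| <= M)%R] < +oo)%E.
Proof.
have [M0|M0] := leP 0 M; last first.
  rewrite (_ : [set x | _] = set0) ?measure0//.
  by apply/seteqP; split => // x /= xM; have := le_lt_trans xM M0; rewrite normr_lt0.
apply: (@le_lt_trans _ _ (lebesgue_rV R n [set v | forall i, `[(- M), M]%classic (v 0 i)])).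
  rewrite le_measure ?inE//.
  - apply: closed_measurable_rV; rewrite (_ : [set x | _] = (fun x : 'rV[R]_n => `|x|) @^-1` `]-oo, M]%classic).
      by apply: closed_comp => [x _|]; [exact: norm_continuous|exact: interval_closed].
    by apply/seteqP; split => x /=; rewrite in_itv.
  - by apply: (@measurable_box_rV R n (fun=> `[(- M), M]%classic)).
  - move=> x /= xM i; rewrite in_itv/= -ler_norml (le_trans _ xM)//.
    by rewrite [leRHS]mx_normrE; exact: (le_bigmax_cond _ (fun i => `|x i.1 i.2|) (_ : xpredT (0, i))).
rewrite (@lebesgue_rV_box R n (fun=> `[(- M), M]%classic))//.
rewrite (eq_bigr (fun=> (M - - M)%:E)) ?prodEFin ?ltry// => i _.
rewrite lebesgue_measure_itv/= lte_fin; case: ltP => // MM.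
by congr (_%:E); lra.
Qed.

Lemma integrableM_bounded d (X : measurableType d) (mu : {measure set X -> \bar R})
    (D : set X) (f h : X -> R) (M : R) : measurable D ->
  mu.-integrable D (EFin \o f) -> measurable_fun D h ->
  (forall x, D x -> `|h x| <= M) -> mu.-integrable D (EFin \o (fun x => f x * h x)).
Proof.
move=> mD fi mh hM.
rewrite (_ : _ \o _ = (EFin \o f) \* (EFin \o h))%E; last by apply/funext => x /=; rewrite EFinM.
apply: integrableMl => //; exists M; split; first exact: num_real.
by move=> x Mx y Dy; rewrite /= (le_trans (hM _ Dy))// ltW.
Qed.

Lemma integrable_bounded d (X : measurableType d) (mu : {measure set X -> \bar R})
    (D P : set X) (f : X -> R) (M : R) :
  measurable D -> measurable P -> (mu P < +oo)%E -> measurable_fun D f ->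
  (forall x, `|f x| <= M) -> (forall x, ~ P x -> f x = 0) ->
  mu.-integrable D (EFin \o f).
Proof.
move=> mD mP Poo mf fM fP.
have M0 : 0 <= M by rewrite (le_trans _ (fM point)).
apply/integrableP; split; first exact/measurable_EFinP.
apply: (@le_lt_trans _ _ (\int[mu]_(x in D) (M * \1_P x)%:E)%E).
  apply: ge0_le_integral => //.
  - by apply: measurableT_comp => //; exact/measurable_EFinP.
  - by apply/measurable_EFinP; apply: measurable_funM => //; exact: measurable_indic.
  - move=> x _ /=; rewrite lee_fin indicE; case: (boolP (x \in P)) => [_|].
      by rewrite mulr1.
    by rewrite notin_setE => /fP ->; rewrite normr0 mulr0.
under eq_integral do rewrite EFinM.
rewrite ge0_integralZl//; last by exact/measurable_EFinP/measurable_indic.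
rewrite integral_indic// lte_mul_pinfty//.
by rewrite (le_lt_trans _ Poo)// le_measure ?inE//; exact: measurableI.
Qed.

End borel_compact.

(** * Smooth mollifiers *)

Section flat_exponential.
Context (R : realType).

(* The family is closed under differentiation, up to linear combinations. *)
Definition flatexp k (x : R) : R := if 0 < x then x^-1 ^+ k * expR (- x^-1) else 0.

Lemma flatexp_ge0 k x : 0 <= flatexp k x.
Proof.
by rewrite /flatexp; case: ifPn => // x0; rewrite mulr_ge0 ?expR_ge0// exprn_ge0// invr_ge0 ltW.
Qed.

Lemma flatexp_le0 k x : x <= 0 -> flatexp k x = 0.
Proof. by rewrite /flatexp; case: ltP. Qed.

(** One term of the exponential series at y = 1/x suffices: [expR y] is at least y^(k+2) / (k+2)!.
    The quadratic bound is what makes the derivative at 0 exist and vanish. *)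
Lemma flatexp_le_sqr k x : flatexp k x <= (k.+2)`!%:R * x ^+ 2.
Proof.
rewrite /flatexp; case: ifPn => [x0|_]; last by rewrite mulr_ge0 ?sqr_ge0.
have y0 : 0 < x^-1 by rewrite invr_gt0.
have := expR_ge1Dxn k.+1 (ltW y0); rewrite expRN => e1.
have f0 : 0 < k.+2`!%:R :> R by rewrite ltr0n fact_gt0.
have e2 : x^-1 ^+ k.+2 <= k.+2`!%:R * expR x^-1.
  by rewrite mulrC -ler_pdivrMr// (le_trans _ e1)// lerDr.
rewrite ler_pdivrMr ?expR_gt0// mulrAC.
rewrite -ler_pdivrMr ?exprn_gt0// -exprVn -exprD addn2; exact: e2.
Qed.

Lemma is_derive_flatexp k (x : R) :
  is_derive x 1 (flatexp k) (flatexp k.+2 x - k%:R * flatexp k.+1 x).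
Proof.
have [x0|x0|->] := ltgtP x 0.
- rewrite !flatexp_le0 ?ltW// mulr0 subrr.
  apply: (@near_eq_is_derive _ _ _ (cst 0)).
  by near=> y; rewrite flatexp_le0// ltW//; near: y; exact: lt_nbhsl.
- rewrite /flatexp x0.
  have xV : is_derive x 1 (fun y : R => y^-1) (- x ^- 2).
    have := @is_deriveV R id x 1 1 (lt0r_neq0 x0) (is_derive_id _ _).
    by rewrite /= scaler1.
  have xk := is_deriveX k xV.
  have xe : is_derive x 1 (fun y : R => expR (- y^-1)) (expR (- x^-1) * x ^- 2).
    have := @is_derive1_comp R expR (fun y : R => - y^-1) x _ _ _ (is_deriveN xV).
    by rewrite opprK => H; apply: H; exact: is_derive_expR.
  apply: (@near_eq_is_derive _ _ _ ((fun y : R => y^-1) ^+ k * (fun y => expR (- y^-1)))).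
    near=> y; have y0 : 0 < y by near: y; exact: (open_nbhs_nbhs (conj (@open_gt _ (0:R)) x0)).
    by rewrite y0 exprfctE.
  apply: (is_derive_eq (is_deriveM xk xe)).
  rewrite /GRing.scale/= exprfctE/= !exprS expr0 invfM mulr1.
  move: (x^-1) => y; move: (expR (- y)) => E.
  by case: k {xk} => [|k]; rewrite ?exprS/=; ring.
- rewrite !flatexp_le0// mulr0 subrr.
  have H : h^-1 *: ((flatexp k \o shift (0:R)) (h *: (1:R)) - flatexp k 0) @[h --> (0:R)^'] --> (0:R).
    rewrite flatexp_le0//; apply/cvgrPdist_le => /= e e0.
    have f0 : 0 < k.+2`!%:R :> R by rewrite ltr0n fact_gt0.
    near=> h; have h0 : h != 0 by near: h; exact: nbhs_dnbhs_neq.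
    rewrite sub0r normrN /= addr0 subr0 /GRing.scale/= mulr1 normrM normfV.
    rewrite ler_pdivrMl ?normr_gt0// ger0_norm ?flatexp_ge0//.
    apply: (le_trans (flatexp_le_sqr _ _)); rewrite -real_normK ?num_real//.
    rewrite mulrC expr2 -mulrA ler_wpM2l// -ler_pdivlMr//.
    near: h; apply: dnbhs0_le; exact: divr_gt0.
  apply: DeriveDef; first by apply/cvg_ex; exists 0.
  exact: cvg_lim H.
Unshelve. all: by end_near. Qed.

Lemma continuous_flatexp k : continuous (flatexp k).
Proof.
move=> x; have [d _] := is_derive_flatexp k x.
exact/differentiable_continuous/derivable1_diffP.
Qed.

Lemma is_derive_flatexp_dir k (x c : R) :
  is_derive x c (flatexp k) (c * (flatexp k.+2 x - k%:R * flatexp k.+1 x)).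
Proof.
have [/derivable1_diffP d] := is_derive_flatexp k x.
rewrite deriveE// => d1; apply: DeriveDef; first exact: diff_derivable.
by rewrite deriveE// -{1}(mulr1 c) linearZ/= d1.
Qed.

End flat_exponential.
Section smooth_algebra.
Context (R : realType) (V : normedModType R).
Implicit Types f g l : V -> R.

(** An order-by-order form of [smooth]: the product rule involves the factors together with their
    first derivatives, so closure under products follows by induction on the order rather than on
    lists of directions. *)
Fixpoint class_C n f : Prop :=
  [/\ continuous f, (forall p v, derivable f p v) &
      if n is m.+1 then forall v, class_C m ('D_v f) else True].

Lemma class_C_smooth f : (forall n, class_C n f) -> smooth f.
Proof.
move=> Cf vs; have: forall n, class_C n (Defs.iterD f vs).
  by elim: vs => //= v vs ih n; have [_ _] := ih n.+1; apply.
by move=> /(_ 0%N)[].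
Qed.

Lemma class_CS n f : class_C n.+1 f -> class_C n f.
Proof.
elim: n f => [f [? ? _]//|n ih f [cf df Df]]; split => // v; exact/ih/Df.
Qed.

Lemma class_C_cst n (c : R) : class_C n (cst c).
Proof.
elim: n c => [|n ih] c; split => //; try by move=> x; exact: cst_continuous.
move=> v; rewrite (_ : 'D_v (cst c) = cst 0); first exact: ih.
by apply/funext => x; rewrite derive_cst.
Qed.

Lemma class_CD n f g : class_C n f -> class_C n g -> class_C n (fun x => f x + g x).
Proof.
elim: n f g => [f g [cf df _] [cg dg _]|n ih f g [cf df Df] [cg dg Dg]]; split.
- by move=> x; exact: (continuousD (cf x) (cg x)).
- by move=> x v; exact: (derivableD (df x v) (dg x v)).
- exact: I.
- by move=> x; exact: (continuousD (cf x) (cg x)).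
- by move=> x v; exact: (derivableD (df x v) (dg x v)).
move=> v; rewrite (_ : 'D_v _ = fun x => 'D_v f x + 'D_v g x).
  exact: (ih _ _ (Df v) (Dg v)).
by apply/funext => x; exact: (deriveD (df x v) (dg x v)).
Qed.

Lemma class_CM n f g : class_C n f -> class_C n g -> class_C n (fun x => f x * g x).
Proof.
elim: n f g => [f g [cf df _] [cg dg _]|n ih f g Cf Cg].
  split; [by move=> x; exact: (continuousM (cf x) (cg x))| |exact: I].
  by move=> x v; exact: (derivableM (df x v) (dg x v)).
have := class_CS Cf; have := class_CS Cg; case: Cf => cf df Df; case: Cg => cg dg Dg Cg Cf.
split; first by move=> x; exact: (continuousM (cf x) (cg x)).
- by move=> x v; exact: (derivableM (df x v) (dg x v)).
move=> v; rewrite (_ : 'D_v _ = fun x => f x * 'D_v g x + g x * 'D_v f x).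
  exact: (class_CD (ih _ _ Cf (Dg v)) (ih _ _ Cg (Df v))).
by apply/funext => x; exact: (deriveM (df x v) (dg x v)).
Qed.

Lemma class_C_prod n (I : Type) (r : seq I) (f : I -> V -> R) :
  (forall i, class_C n (f i)) -> class_C n (fun x => \prod_(i <- r) f i x).
Proof.
move=> Cf; elim: r => [|i r ih].
  by under [X in class_C _ X]funext do rewrite big_nil; exact: (class_C_cst n 1).
under [X in class_C _ X]funext do rewrite big_cons.
exact: class_CM.
Qed.

(** Treating all [k] at once closes the induction on the order, since differentiation raises [k] by
    1 and 2. The map [l] is affine with linear part [l0], which turns directional derivatives into
    one-dimensional ones. *)
Lemma class_C_flatexp n k l (l0 : V -> R) : continuous l ->
  (forall p v h, l (h *: v + p) = h * l0 v + l p) -> class_C n (fun p => flatexp k (l p)).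
Proof.
move=> cl ll.
have Dl j p v : is_derive p v (fun p => flatexp j (l p))
    (l0 v * (flatexp j.+2 (l p) - j%:R * flatexp j.+1 (l p))).
  have [d1 d2] := is_derive_flatexp_dir j (l p) (l0 v).
  have e : (fun h => h^-1 *: (((fun p => flatexp j (l p)) \o shift p) (h *: v) - flatexp j (l p))) =
      (fun h => h^-1 *: ((flatexp j \o shift (l p)) (h *: l0 v) - flatexp j (l p))).
    by apply/funext => h /=; rewrite ll.
  apply: DeriveDef; first by rewrite /derivable e.
  by rewrite -d2 /derive e.
have cf j : continuous (fun p => flatexp j (l p)).
  by move=> x; apply: continuous_comp; [exact: cl|exact: continuous_flatexp].
elim: n k => [|n ih] k; split => //; try by move=> p v; have [] := Dl k p v.
move=> v.
rewrite (_ : 'D_v _ = fun p => cst (l0 v) p * (flatexp k.+2 (l p) + cst (- k%:R) p * flatexp k.+1 (l p))).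
  apply: class_CM; first exact: class_C_cst.
  by apply: class_CD => //; apply: class_CM => //; exact: class_C_cst.
by apply/funext => p; have [_ ->] := Dl k p v; rewrite mulNr.
Qed.

End smooth_algebra.
Section mollifier.
Context (R : realType) (n : nat).
Local Notation spacetime := ('rV[R]_n * R)%type.

Lemma rV_norm_lt (x : 'rV[R]_n) (e : R) : 0 < e -> (forall i, `|x 0 i| < e) -> `|x| < e.
Proof.
move=> e0 xe; rewrite [ltLHS]mx_normrE; apply: bigmax_lt => // -[i j] _ /=.
by rewrite (ord1 i).
Qed.

Lemma compact_rV_ball (M : R) : compact [set x : 'rV[R]_n | `|x| <= M].
Proof.
apply: bounded_closed_compact.
  by exists M; split; [exact: num_real|move=> x Mx y /= /le_trans; apply; exact: ltW].
rewrite (_ : [set x | _] = (fun x : 'rV[R]_n => `|x|) @^-1` `]-oo, M]%classic).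
  by apply: closed_comp => [x _|]; [exact: norm_continuous|exact: interval_closed].
by apply/seteqP; split => x /=; rewrite in_itv.
Qed.

Lemma compact_prod_ball (M : R) : compact [set p : spacetime | `|p| <= M].
Proof.
have := compact_setX (compact_rV_ball (M := M)) (segment_compact (a := - M) (b := M)).
congr compact; apply/seteqP; split => -[x t] /=; rewrite in_itv/= prod_normE/= ge_max -ler_norml.
  by move=> [-> ->].
by move=> /andP[].
Qed.

Let bump (s : R) := flatexp 0 (1 + s) * flatexp 0 (1 - s).

Let bump_ge0 s : 0 <= bump s.
Proof. by rewrite mulr_ge0 ?flatexp_ge0. Qed.

Let bump_out s : 1 <= `|s| -> bump s = 0.
Proof.
rewrite ler_normr => /orP[s1|s1]; rewrite /bump; [rewrite mulrC|];
  by rewrite flatexp_le0 ?mul0r//; lra.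
Qed.

Let bump_class (l : spacetime -> R) k : continuous l ->
  (forall p v h, l (h *: v + p) = h * l v + l p) -> class_C k (fun p => bump (l p)).
Proof.
move=> cl ll; apply: class_CM.
  apply: (@class_C_flatexp _ _ k 0 _ l); last by move=> p v h; rewrite ll; ring.
  by move=> x; apply: (@cvgD _ _ _ (nbhs x)); [exact: cvg_cst|exact: cl].
apply: (@class_C_flatexp _ _ k 0 _ (fun v => - l v)); last by move=> p v h; rewrite ll; ring.
by move=> x; apply: (@cvgB _ _ _ (nbhs x)); [exact: cvg_cst|exact: cl].
Qed.

Let bump_in : exists2 c, 0 < c & forall s, `|s| <= 2^-1 -> c <= bump s.
Proof.
have E s : 2^-1 <= s -> expR (- 2) <= flatexp 0 s.
  move=> s2; have s0 : 0 < s by lra.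
  rewrite /flatexp s0 expr0 mul1r ler_expR lerN2 -(invrK 2) lef_pV2 ?posrE//.
exists (expR (- 2) * expR (- 2)) => [|s]; first by rewrite mulr_gt0 ?expR_gt0.
by rewrite ler_norml => s2; apply: ler_pM; rewrite ?expR_ge0//; apply: E; lra.
Qed.

(** A product over the coordinates instead of a radial profile: each factor is built from flat
    exponentials of affine forms, and the function vanishes outside a ball of the sup norm. *)
Definition test_bump (e : R) (p : spacetime) :=
  (\prod_(i < n) bump (p.1 0 i / e)) * bump (p.2 / e).

Lemma test_bump_smooth e : smooth (test_bump e).
Proof.
apply: class_C_smooth => k; apply: class_CM.
  apply: class_C_prod => i; apply: (bump_class (l := fun p : spacetime => p.1 0 i / e)) => [p|p v h]/=.
    apply: (cvgMr_tmp (f := fun q : spacetime => q.1 0 i)); apply: (@continuous_comp _ _ _ fst (fun x : 'rV[R]_n => x 0 i)).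
      exact: cvg_fst.
    exact: coord_continuous.
  by rewrite !mxE mulrDl mulrA.
apply: (bump_class (l := fun p : spacetime => p.2 / e)) => [p|p v h]/=.
  by apply: (cvgMr_tmp (f := fun q : spacetime => q.2)); exact: cvg_snd.
by rewrite /GRing.scale/= mulrDl mulrA.
Qed.

Lemma test_bump_ge0 e p : 0 <= test_bump e p.
Proof. by rewrite mulr_ge0 ?prodr_ge0// => i _; exact: bump_ge0. Qed.

Lemma test_bump_out e p : 0 < e -> e <= `|p| -> test_bump e p = 0.
Proof.
move=> e0 ep; have out s : e <= `|s| -> bump (s / e) = 0.
  by move=> es; apply: bump_out; rewrite normrM normfV (gtr0_norm e0) ler_pdivlMr// mul1r.
rewrite /test_bump; have [p2|p2] := leP e `|p.2|; first by rewrite out ?mulr0.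
have [[i pi]|H] := pselect (exists i, e <= `|p.1 0 i|).
  by rewrite (bigD1 i)//= out// !mul0r.
move: ep; rewrite prod_normE leNgt gt_max p2 andbT rV_norm_lt// => i.
by rewrite ltNge; apply/negP => pi; apply: H; exists i.
Qed.

Lemma test_bump_continuous e : continuous (test_bump e).
Proof. by have [] := @test_bump_smooth e [::]. Qed.

Lemma continuous_cpt_integrable (f : spacetime -> R) (M : R) : continuous f ->
  (forall p, M <= `|p| -> f p = 0) -> (dxdt R n).-integrable setT (EFin \o f).
Proof.
move=> cf fM; pose P := [set p : spacetime | `|p| <= M].
have cP : compact P by exact: compact_prod_ball.
have [B B0 fB] : exists2 B : R, 0 < B & forall p, P p -> `|f p| <= B.
  by apply: compact_bounded_fun => //; exact: continuous_subspaceT.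
apply: (@integrable_bounded R _ _ (dxdt R n) setT P f B) => //.
- exact: compact_measurable_prod.
- rewrite /P; apply: (@le_lt_trans _ _ (dxdt R n ([set x | `|x| <= M] `*` `[(- M), M]%classic))).
    rewrite le_measure ?inE//.
    + exact: compact_measurable_prod.
    + by apply: measurableX => //; apply: compact_measurable_rV; exact: compact_rV_ball.
    + by move=> [x t] /=; rewrite prod_normE/= ge_max in_itv/= -ler_norml => /andP[].
  rewrite /dxdt/= product_measure1E//; last first.
    by apply: compact_measurable_rV; exact: compact_rV_ball.
  apply: lte_mul_pinfty => //.
    by rewrite ge0_fin_numE//; exact: lebesgue_rV_ball_fin.
  have mu0 : (@lebesgue_measure R `[(- M)%R, M%R]%classic < +oo)%E.
    by rewrite lebesgue_measure_itv/=; case: ifPn => // _; rewrite -EFinB ltry.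
  exact: mu0.
- exact: continuous_measurable_prod.
- move=> p; have [pM|/ltW pM] := leP `|p| M; first exact: fB.
  by rewrite fM// normr0 ltW.
- by move=> p /negP; rewrite -ltNge => /ltW/fM.
Qed.

(** Each factor is at least [c] on the box of half-width e/2, so the integral is at least c^(n+1)
    times the volume e^(n+1) of that box. *)
Lemma test_bump_integral e : 0 < e -> 0 < \int[dxdt R n]_p test_bump e p.
Proof.
move=> e0; have [c c0 cb] := bump_in.
pose A := [set x : 'rV[R]_n | forall i, `[(- (e / 2)), (e / 2)]%classic (x 0 i)].
pose B := A `*` `[(- (e / 2)), (e / 2)]%classic.
have mA : measurable A by apply: (@measurable_box_rV R n (fun=> `[(- (e / 2)), (e / 2)]%classic)).
have mB : measurable (B : set ('rV[R]_n * measurableTypeR R)) by exact: measurableX.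
have mu1 : @lebesgue_measure R `[(- (e / 2)), (e / 2)]%classic = e%:E.
  rewrite lebesgue_measure_itv/= lte_fin ifT; last by lra.
  by rewrite -EFinB; congr (_%:E); lra.
have muA : lebesgue_rV R n A = (e ^+ n)%:E.
  rewrite /A (@lebesgue_rV_box R n (fun=> `[(- (e / 2)), (e / 2)]%classic))//.
  by rewrite (eq_bigr (fun=> e%:E))// prodEFin prodr_const card_ord.
have muB : dxdt R n B = (e ^+ n.+1)%:E.
  have -> : dxdt R n B = (lebesgue_rV R n A *
      @lebesgue_measure R (`[(- (e / 2))%R, (e / 2)%R]%classic))%E.
    exact: product_measure1E.
  by rewrite muA mu1 -EFinM exprSr.
have ib := continuous_cpt_integrable (@test_bump_continuous e) (fun p => @test_bump_out e p e0).
rewrite -lte_fin /Rintegral fineK; last exact: integrable_fin_num.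
apply: (@lt_le_trans _ _ ((c ^+ n.+1)%:E * dxdt R n B)%E).
  by rewrite muB -EFinM lte_fin mulr_gt0// exprn_gt0.
rewrite -integral_cst//; apply: (@le_trans _ _ (\int[dxdt R n]_(p in B) (test_bump e p)%:E)%E).
  apply: ge0_le_integral => //.
  - by move=> p _; rewrite lee_fin exprn_ge0// ltW.
  - apply/measurable_EFinP/measurable_funTS; apply: continuous_measurable_prod.
    exact: test_bump_continuous.
  - move=> [x t] [/= Ax At]; rewrite lee_fin exprSr /test_bump/=.
    have half s : s \in `[(- (e / 2)), (e / 2)] -> c <= bump (s / e).
      rewrite in_itv/= -ler_norml => se; apply: cb.
      by rewrite normrM normfV (gtr0_norm e0) ler_pdivrMr// mulrC.
    apply: ler_pM; [by rewrite exprn_ge0// ltW|exact: ltW| |exact: half].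
    rewrite -[X in c ^+ X]card_ord -prodr_const; apply: ler_prod => i _.
    by rewrite ltW//= half//; exact: Ax.
apply: ge0_subset_integral => //; last by move=> p _; rewrite lee_fin test_bump_ge0.
by apply/measurable_EFinP; apply: continuous_measurable_prod; exact: test_bump_continuous.
Qed.

Lemma smoothZ (c : R) (f : spacetime -> R) : smooth f -> smooth (fun p => c * f p).
Proof.
move=> sf; have E vs : Defs.iterD (fun p => c * f p) vs = fun p => c * Defs.iterD f vs p.
  elim: vs => //= v vs ->; apply/funext => p.
  by have [_ d] := sf vs; exact: (deriveZ c (d p v)).
move=> vs; rewrite E; have [cf df] := sf vs; split.
  by move=> p; apply: (cvgMl_tmp (g := Defs.iterD f vs)); exact: cf.
by move=> p v; exact: (derivableZ (f := Defs.iterD f vs) (df p v)).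
Qed.

Lemma mollifier_exists (e : R) : 0 < e -> exists phi : spacetime -> R,
  [/\ smooth phi, (forall p, 0 <= phi p), (forall p, e <= `|p| -> phi p = 0) &
      \int[dxdt R n]_p phi p = 1].
Proof.
move=> e0; set I := \int[dxdt R n]_p test_bump e p.
have I0 : 0 < I by exact: test_bump_integral.
exists (fun p => I^-1 * test_bump e p); split.
- by apply: smoothZ; exact: test_bump_smooth.
- by move=> p; rewrite mulr_ge0 ?test_bump_ge0// invr_ge0 ltW.
- by move=> p ep; rewrite test_bump_out// mulr0.
rewrite RintegralZl//; first by rewrite mulVf// gt_eqF.
exact: (continuous_cpt_integrable (@test_bump_continuous e) (fun p => @test_bump_out e p e0)).
Qed.

End mollifier.

(** * Taylor estimates along lines *)

Section taylor_line.
Context (R : realType).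
Implicit Types g : R -> R.

Lemma le_MVT_bound g (g1 : R -> R) (B h : R) : (forall x : R, is_derive x 1 g (g1 x)) ->
  (forall x, `|x| <= `|h| -> `|g1 x| <= B) -> `|g h - g 0| <= B * `|h|.
Proof.
move=> dg g1B.
have cg (x y : R) : {within `[x, y], continuous g}.
  apply: continuous_subspaceT => z; have [d _] := dg z.
  exact/differentiable_continuous/derivable1_diffP.
have [h0|h0|->] := ltgtP h 0; last by rewrite subrr normr0 mulr0.
- have [c] := MVT h0 (fun x _ => dg x) (cg h 0).
  rewrite in_itv/= => /andP[hc c0]; rewrite sub0r distrC => ->.
  by rewrite normrM normrN ler_wpM2r// g1B// ltr0_norm// ltr0_norm//; lra.
- have [c] := MVT h0 (fun x _ => dg x) (cg 0 h).
  rewrite in_itv/= => /andP[hc c0]; rewrite subr0 => ->.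
  by rewrite normrM ler_wpM2r// g1B// gtr0_norm// gtr0_norm//; lra.
Qed.

(** The mean value bound is used twice, for [g1] and then for g(y) - y g1(0), which gives the
    constant B instead of the sharp B/2. *)
Lemma taylor1 g (g1 g2 : R -> R) (B : R) : (forall x : R, is_derive x 1 g (g1 x)) ->
  (forall x : R, is_derive x 1 g1 (g2 x)) -> (forall x, `|g2 x| <= B) ->
  forall h, `|g h - g 0 - h * g1 0| <= B * h ^+ 2.
Proof.
move=> dg dg1 g2B h.
have B0 : 0 <= B by rewrite (le_trans _ (g2B 0)).
have dF (x : R) : is_derive x 1 (fun y => g y - y * g1 0) (g1 x - g1 0).
  apply: (is_derive_eq (is_deriveB (dg x) (is_deriveM (is_derive_id x 1) (is_derive_cst (g1 0) x 1)))).
  by rewrite scaler0 add0r /GRing.scale/= mulr1.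
have /= := @le_MVT_bound _ _ (B * `|h|) h dF.
rewrite mul0r subr0 addrAC -mulrA -expr2 real_normK ?num_real//; apply=> x xh.
by rewrite (le_trans (@le_MVT_bound g1 g2 B x dg1 _))// ler_wpM2l.
Qed.

(** Symmetrising in h cancels the odd terms. The derivative of the left-hand side is a difference of
    two first-order remainders of [g1], at x and at -x, each at most B x^2. *)
Lemma taylor2 g (g1 g2 g3 : R -> R) (B : R) : (forall x : R, is_derive x 1 g (g1 x)) ->
  (forall x : R, is_derive x 1 g1 (g2 x)) -> (forall x : R, is_derive x 1 g2 (g3 x)) ->
  (forall x, `|g3 x| <= B) ->
  forall h, `|g h + g (- h) - 2 * g 0 - h ^+ 2 * g2 0| <= 2 * B * `|h| ^+ 3.
Proof.
move=> dg dg1 dg2 g3B h.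
have B0 : 0 <= B by rewrite (le_trans _ (g3B 0)).
have dgN (x : R) : is_derive x 1 (fun y => g (- y)) (- g1 (- x)).
  have := is_derive1_comp (dg (- x)) (is_deriveN (is_derive_id x 1)).
  by rewrite mulrN1.
have dF (x : R) : is_derive x 1 (fun y => g y + g (- y) - y ^+ 2 * g2 0) (g1 x - g1 (- x) - 2 * x * g2 0).
  apply: (is_derive_eq (is_deriveB (is_deriveD (dg x) (dgN x)) (is_deriveM (is_deriveX 2 (is_derive_id x 1)) (is_derive_cst (g2 0) x 1)))).
  by rewrite scaler0 add0r /GRing.scale/= expr1 mulr1; ring.
have := @le_MVT_bound _ _ (2 * B * `|h| ^+ 2) h dF.
rewrite -(mulrA (2 * B)) -exprSr /= oppr0 expr0n/= mul0r subr0.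
rewrite (_ : _ - (g 0 + g 0) = g h + g (- h) - 2 * g 0 - h ^+ 2 * g2 0); last by ring.
apply=> x xh.
rewrite (_ : g1 x - _ - _ = (g1 x - g1 0 - x * g2 0) - (g1 (- x) - g1 0 - (- x) * g2 0)); last by ring.
rewrite (le_trans (ler_normB _ _))//.
have t1 := taylor1 dg1 dg2 g3B x; have := taylor1 dg1 dg2 g3B (- x); rewrite sqrrN => t2.
rewrite (le_trans (lerD t1 t2))// -mulrA (mulrDl 1 1) !mul1r.
have : B * x ^+ 2 <= B * `|h| ^+ 2.
  by rewrite ler_wpM2l// -(@real_normK _ x) ?num_real// lerXn2r ?nnegrE.
by move=> ?; rewrite lerD.
Qed.

End taylor_line.

Section taylor_smooth.
Context (R : realType) (n : nat).
Local Notation spacetime := ('rV[R]_n * R)%type.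
Implicit Types (f phi : spacetime -> R) (d p q : spacetime).

Lemma bounded_of_support f (M : R) : continuous f -> (forall p, M <= `|p| -> f p = 0) ->
  exists2 B, 0 < B & forall p, `|f p| <= B.
Proof.
move=> cf fM.
have [B B0 fB] : exists2 B : R, 0 < B & forall p, [set p : spacetime | `|p| <= M] p -> `|f p| <= B.
  by apply: compact_bounded_fun; [exact: compact_prod_ball|exact: continuous_subspaceT].
exists B => // p; have [pM|/ltW pM] := leP `|p| M; first exact: fB.
by rewrite fM// normr0 ltW.
Qed.

Lemma derive_zero_open (U : set spacetime) f d p : open U -> U p ->
  (forall q, U q -> f q = 0) -> 'D_d f p = 0.
Proof.
move=> oU Up fU; rewrite (@near_eq_derive _ _ _ f (cst 0)) ?derive_cst//.
by near=> q; apply: fU; near: q; exact: open_nbhs_nbhs.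
Unshelve. all: by end_near. Qed.

(** Increasing the radius by 1 puts p inside the open set |p| > M, on which [phi] vanishes
    identically. *)
Lemma derive_support phi d (M : R) : (forall p, M <= `|p| -> phi p = 0) ->
  forall p, M + 1 <= `|p| -> 'D_d phi p = 0.
Proof.
move=> phiM p pM; apply: (@derive_zero_open [set p | M < `|p|]).
- rewrite (_ : [set p | _] = (fun p : spacetime => `|p|) @^-1` `]M, +oo[%classic).
    by apply: open_comp => [x _|]; [exact: norm_continuous|exact: interval_open].
  by apply/seteqP; split => x /=; rewrite in_itv/= andbT.
- by rewrite /= (lt_le_trans _ pM)// ltrDl.
- by move=> q /= /ltW/phiM.
Qed.

Lemma is_derive_line f d p (h : R) : (forall q, derivable f q d) ->
  is_derive h 1 (fun h => f (p + h *: d)) ('D_d f (p + h *: d)).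
Proof.
move=> df.
have e : (fun k => k^-1 *: (((fun h => f (p + h *: d)) \o shift h) (k *: (1:R)) - f (p + h *: d))) =
    (fun k => k^-1 *: ((f \o shift (p + h *: d)) (k *: d) - f (p + h *: d))).
  by apply/funext => k /=; rewrite (_ : k *: (1:R) = k) ?scalerDl 1?addrCA //; exact: mulr1.
by apply: DeriveDef; [rewrite /derivable e; exact: df|rewrite /derive e].
Qed.

(** The second and third derivatives vanish outside a ball and are therefore bounded, so the
    constant is uniform in the point [p]. *)
Lemma smooth_taylor phi (M : R) : smooth phi -> (forall p, M <= `|p| -> phi p = 0) ->
  forall d, exists2 C, 0 < C & forall p (h : R),
    `|phi (p + h *: d) - phi p - h * 'D_d phi p| <= C * h ^+ 2 /\
    `|phi (p + h *: d) + phi (p - h *: d) - 2 * phi p - h ^+ 2 * 'D_d ('D_d phi) p|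
      <= C * `|h| ^+ 3.
Proof.
move=> sphi phiM d.
have [_ d0] := sphi [::]; have [_ d1] := sphi [:: d].
have [c2 d2] := sphi [:: d; d]; have [c3 _] := sphi [:: d; d; d].
have z1 := derive_support d phiM; have z2 := derive_support d z1; have z3 := derive_support d z2.
have [B2 B20 b2] := bounded_of_support c2 z2; have [B3 B30 b3] := bounded_of_support c3 z3.
exists (B2 + 2 * B3) => [|p h]; first by rewrite addr_gt0// mulr_gt0.
have D0 x := is_derive_line p x (d0 ^~ d).
have D1 x := is_derive_line p x (d1 ^~ d).
have D2 x := is_derive_line p x (d2 ^~ d).
split.
  have := taylor1 D0 D1 (fun x => b2 _) h; rewrite scale0r addr0 => /le_trans; apply.
  by rewrite ler_wpM2r ?sqr_ge0// lerDl mulr_ge0// ltW.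
have := taylor2 D0 D1 D2 (fun x => b3 _) h; rewrite scale0r addr0 scaleNr => /le_trans; apply.
by rewrite ler_wpM2r ?exprn_ge0// lerDr ltW.
Qed.

End taylor_smooth.

(** * Mollification of integrable functions *)

Section pairing.
Context d (X : measurableType d) (R : realType) (mu : {measure set X -> \bar R}).
Variables (K : set X) (v : X -> R).
Hypothesis mK : measurable K.
Hypothesis iv : mu.-integrable K (EFin \o v).
Implicit Types F G : X -> R.

Definition mbounded F := measurable_fun K F /\ exists B : R, forall x, K x -> `|F x| <= B.

Definition pairing F : R := \int[mu]_(x in K) (v x * F x).

Lemma mboundedD F G : mbounded F -> mbounded G -> mbounded (fun x => F x + G x).
Proof.
move=> [mF [A FA]] [mG [B GB]]; split; first exact: measurable_funD.
by exists (A + B) => x Kx; rewrite (le_trans (ler_normD _ _))// lerD ?FA ?GB.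
Qed.

Lemma mboundedZ F (c : R) : mbounded F -> mbounded (fun x => c * F x).
Proof.
move=> [mF [A FA]]; split; first exact: measurable_funM.
by exists (`|c| * A) => x Kx; rewrite normrM ler_wpM2l// FA.
Qed.

Lemma mboundedB F G : mbounded F -> mbounded G -> mbounded (fun x => F x - G x).
Proof.
move=> mF mG; have := mboundedD mF (mboundedZ (-1) mG).
by under eq_fun do rewrite mulN1r.
Qed.

Lemma pairing_integrable F : mbounded F -> mu.-integrable K (EFin \o (fun x => v x * F x)).
Proof. by move=> [mF [B FB]]; exact: integrableM_bounded mK iv mF FB. Qed.

Lemma pairingD F G : mbounded F -> mbounded G ->
  pairing (fun x => F x + G x) = pairing F + pairing G.
Proof.
move=> mF mG; rewrite /pairing -(RintegralD mK (pairing_integrable mF) (pairing_integrable mG)).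
by apply: eq_Rintegral => x _; rewrite mulrDr.
Qed.

Lemma pairingZ F (c : R) : mbounded F -> pairing (fun x => c * F x) = c * pairing F.
Proof.
move=> mF; rewrite /pairing -RintegralZl//; last exact: pairing_integrable.
by apply: eq_Rintegral => x _; rewrite mulrCA.
Qed.

Lemma pairingB F G : mbounded F -> mbounded G ->
  pairing (fun x => F x - G x) = pairing F - pairing G.
Proof.
move=> mF mG; rewrite /pairing -(RintegralB mK (pairing_integrable mF) (pairing_integrable mG)).
by apply: eq_Rintegral => x _; rewrite mulrBr.
Qed.

Definition mass : R := \int[mu]_(x in K) `|v x|.

Lemma mass_ge0 : 0 <= mass.
Proof. by apply: Rintegral_ge0 => p _. Qed.

Lemma norm_pairing_le F B : mbounded F -> (forall x, K x -> `|F x| <= B) ->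
  `|pairing F| <= B * mass.
Proof.
move=> mF FB.
have iF := pairing_integrable mF.
have iav : mu.-integrable K (EFin \o (fun p => `|v p|)) by exact: (integrable_norm iv).
rewrite (le_trans (le_normr_Rintegral mK iF))// /mass -RintegralZl//.
apply: le_Rintegral => //.
- exact: (integrable_norm iF).
- by have := integrableZl mK B iav; apply: eq_integrable.
- by move=> p Kp; rewrite normrM mulrC ler_wpM2r// FB.
Qed.

End pairing.

Section convolution.
Context (R : realType) (n : nat).
Local Notation spacetime := ('rV[R]_n * R)%type.
Variables (K : set spacetime) (v : spacetime -> R).
Hypothesis mK : measurable (K : set ('rV[R]_n * measurableTypeR R)).
Hypothesis iv : (dxdt R n).-integrable K (EFin \o v).
Implicit Types (psi phi : spacetime -> R) (d p q : spacetime).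

(** The kernel psi(p - q) is a translate of [psi] centred at q, so it can itself serve as a test
    function. Pairing over [K] uses no value of [v] outside [K]. *)
Definition mollify psi q : R := pairing (dxdt R n) K v (fun p => psi (p - q)).

Definition test_kernel psi := continuous psi /\ exists M : R, forall p, M <= `|p| -> psi p = 0.

Lemma kernel_bounded psi : test_kernel psi -> exists2 B, 0 < B & forall p, `|psi p| <= B.
Proof. by move=> [c [M z]]; exact: bounded_of_support c z. Qed.

Lemma kernel_smooth phi : smooth phi -> (exists M : R, forall p, M <= `|p| -> phi p = 0) ->
  test_kernel phi.
Proof. by move=> sphi M; split=> //; have [] := sphi [::]. Qed.

Lemma kernel_derive phi d : smooth phi ->
  (exists M : R, forall p, M <= `|p| -> phi p = 0) ->
  test_kernel ('D_d phi) /\ test_kernel ('D_d ('D_d phi)).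
Proof.
move=> sphi [M z]; have z1 := derive_support d z; have z2 := derive_support d z1.
split; [have [c _] := sphi [:: d]|have [c _] := sphi [:: d; d]]; split=> //.
  by exists (M + 1).
by exists (M + 1 + 1).
Qed.

Lemma kernel_mbounded psi q : test_kernel psi ->
  mbounded (K : set ('rV[R]_n * measurableTypeR R)) (fun p => psi (p - q)).
Proof.
move=> k; have [B B0 psiB] := kernel_bounded k; split; last by exists B.
have c : continuous (fun p : spacetime => psi (p - q)).
  move=> p; apply: (@continuous_comp _ _ _ (fun p : spacetime => p - q) psi); last exact: k.1.
  by apply: (@cvgB _ _ _ (nbhs p)); [exact: cvg_id|exact: cvg_cst].
exact: measurable_funS (continuous_measurable_prod c).
Qed.

Lemma norm_nbhs (V : normedModType R) (q : V) (e : R) : 0 < e ->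
  nbhs q [set x | `|q - x| < e].
Proof. by move=> e0; apply/nbhs_normP; exists e. Qed.

(* Moving the centre of the mollifier by [- h d] moves its argument by [+ h d]. *)
Lemma mollify_taylor phi d : smooth phi -> (exists M : R, forall p, M <= `|p| -> phi p = 0) ->
  exists2 C, 0 <= C & forall q (h : R),
    `|mollify phi (q - h *: d) - mollify phi q - h * mollify ('D_d phi) q| <= C * h ^+ 2 /\
    `|mollify phi (q - h *: d) + mollify phi (q + h *: d) - 2 * mollify phi q -
       h ^+ 2 * mollify ('D_d ('D_d phi)) q| <= C * `|h| ^+ 3.
Proof.
move=> sphi zphi; have [k1 k2] := kernel_derive d sphi zphi.
have k0 := kernel_smooth sphi zphi.
have [M z] := zphi; have [C C0 tC] := smooth_taylor sphi z d.
have m0 q := kernel_mbounded q k0; have m1 q := kernel_mbounded q k1; have m2 q := kernel_mbounded q k2.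
exists (C * mass (dxdt R n) K v) => [|q h]; first by rewrite mulr_ge0 ?mass_ge0// ltW.
have sh p : p - (q - h *: d) = p - q + h *: d by rewrite opprB addrA addrAC.
have shN p : p - (q + h *: d) = p - q - h *: d by rewrite opprD addrA.
split.
- rewrite /mollify -(pairingZ mK iv h (m1 q)) -(pairingB mK iv (m0 _) (m0 _)).
  rewrite -(pairingB mK iv); [|exact: mboundedB|exact: mboundedZ].
  rewrite mulrAC; apply: norm_pairing_le => // [|p Kp].
    by apply: mboundedB; [exact: mboundedB|exact: mboundedZ].
  by rewrite sh; case: (tC (p - q) h).
- rewrite /mollify -(pairingZ mK iv _ (m2 q)) -(pairingZ mK iv _ (m0 q)) -(pairingD mK iv (m0 _) (m0 _)).
  rewrite -(pairingB mK iv); [|exact: mboundedD|exact: mboundedZ].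
  rewrite -(pairingB mK iv); [|apply: mboundedB; [exact: mboundedD|exact: mboundedZ]|exact: mboundedZ].
  rewrite mulrAC; apply: norm_pairing_le => // [|p Kp].
    by apply: mboundedB; [apply: mboundedB; [exact: mboundedD|exact: mboundedZ]|exact: mboundedZ].
  by rewrite sh shN; case: (tC (p - q) h).
Qed.

Lemma mollify_continuous psi : test_kernel psi -> continuous (mollify psi).
Proof.
move=> k; have [c [M z]] := k; move=> q.
have m0 := mass_ge0 (dxdt R n) K v.
apply/cvgrPdist_le => /= w w0.
have w'0 : 0 < w / (mass (dxdt R n) K v + 1) by rewrite divr_gt0// ltr_wpDl.
have [e e0 uc] := compact_unif_continuous (@compact_prod_ball R n (M + 1))
  (continuous_subspaceT c) w'0.
have e'0 : 0 < Num.min e 1 by rewrite lt_min e0 ltr01.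
near=> q'; have qq' : `|q - q'| < Num.min e 1.
  by near: q'; exact: (@norm_nbhs spacetime).
rewrite /mollify -(pairingB mK iv (kernel_mbounded _ k) (kernel_mbounded _ k)).
apply: (@le_trans _ _ (w / (mass (dxdt R n) K v + 1) * mass (dxdt R n) K v)); last first.
  by rewrite mulrAC ler_pdivrMr ?ltr_wpDl// ler_wpM2l ?(ltW w0)// lerDl.
apply: norm_pairing_le => // [|p Kp]; first by apply: mboundedB; exact: kernel_mbounded.
have e1 : p - q - (p - q') = - (q - q') by rewrite opprB addrC addrA subrK opprB.
move: qq'; rewrite lt_min => /andP[qe q1].
(* The two arguments differ by less than 1, so outside the ball of radius M + 1 both values of the
   kernel vanish; inside it, uniform continuity applies. *)
have near1 (a b : spacetime) : `|a - b| < e -> `|a - b| < 1 -> M + 1 < `|a| ->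
    psi a - psi b = 0.
  move=> abe ab1 aM; rewrite !z ?subrr// ?(le_trans _ (ltW aM)) ?lerDl//.
  by have := ler_normD b (a - b); rewrite addrC subrK; lra.
have eN : `|p - q - (p - q')| < e by rewrite e1 normrN.
have e1N : `|p - q - (p - q')| < 1 by rewrite e1 normrN.
have [a1|a1] := ltP (M + 1) `|p - q|; first by rewrite near1// normr0 ltW.
have [b1|b1] := ltP (M + 1) `|p - q'|; last by rewrite ltW// uc.
by rewrite -opprB near1// 1?distrC// oppr0 normr0 ltW.
Unshelve. all: by end_near. Qed.

Lemma mollify_support psi : bounded_set K -> test_kernel psi ->
  exists M : R, forall q, M <= `|q| -> mollify psi q = 0.
Proof.
move=> [A [_ KA]] [_ [M z]]; exists (A + 1 + M) => q qM.
rewrite /mollify /pairing (@eq_Rintegral _ _ _ _ _ (fun=> 0)); first by rewrite /Rintegral integral0.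
move=> p; rewrite inE => Kp; rewrite z ?mulr0//.
have := KA (A + 1); rewrite ltrDl ltr01 => /(_ isT _ Kp)/= pA.
by have := ler_normB p (p - q); rewrite subKr; lra.
Qed.

End convolution.

(** * Bounded functions of compact support and their integrals *)

Section space_integral.
Context (R : realType) (n : nat).
Local Notation space := 'rV[R]_n.
Implicit Types (f g : space -> R).

(** Measurability instead of continuity: the class has to contain the indicators of {V > 0} and to
    be stable under products, translations and positive parts. *)
Definition bsupp f := [/\ measurable_fun setT f, exists B : R, forall y, `|f y| <= B &
  exists M : R, forall y, M <= `|y| -> f y = 0].

Definition sint f : R := \int[lebesgue_rV R n]_y f y.

Lemma bsupp_integrable f : bsupp f -> (lebesgue_rV R n).-integrable setT (EFin \o f).
Proof.
move=> [mf [B fB] [M fM]].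
apply: (@integrable_bounded R _ _ (lebesgue_rV R n) setT [set x | `|x| <= M] f B) => //.
- by apply: compact_measurable_rV; exact: compact_rV_ball.
- exact: lebesgue_rV_ball_fin.
- by move=> p /negP; rewrite -ltNge => /ltW/fM.
Qed.

Lemma bsuppD f g : bsupp f -> bsupp g -> bsupp (fun y => f y + g y).
Proof.
move=> [mf [B fB] [M fM]] [mg [B' gB] [M' gM]]; split.
- exact: measurable_funD.
- by exists (B + B') => y; rewrite (le_trans (ler_normD _ _))// lerD.
- by exists (Num.max M M') => y; rewrite ge_max => /andP[yM yM']; rewrite fM// gM// addr0.
Qed.

Lemma bsuppMl f g : bsupp f -> measurable_fun setT g -> (exists B : R, forall y, `|g y| <= B) ->
  bsupp (fun y => g y * f y).
Proof.
move=> [mf [B fB] [M fM]] mg [B' gB]; split.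
- exact: measurable_funM.
- by exists (B' * B) => y; rewrite normrM ler_pM.
- by exists M => y yM; rewrite fM// mulr0.
Qed.

Lemma bsuppM f g : bsupp f -> bsupp g -> bsupp (fun y => g y * f y).
Proof. by move=> bf [mg Bg _]; exact: bsuppMl. Qed.

Lemma bsuppZ f (c : R) : bsupp f -> bsupp (fun y => c * f y).
Proof. by move=> bf; apply: bsuppMl => //; exists `|c|. Qed.

Lemma bsuppB f g : bsupp f -> bsupp g -> bsupp (fun y => f y - g y).
Proof. by move=> bf /(bsuppZ (-1)) /(bsuppD bf); under eq_fun do rewrite mulN1r. Qed.

Lemma bsupp_shift f (z : space) : bsupp f -> bsupp (fun y => f (y + z)).
Proof.
move=> [mf [B fB] [M fM]]; split; last 2 first.
- by exists B.
- exists (M + `|z|) => y yM; rewrite fM//.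
  by have := ler_normB (y + z) z; rewrite addrK; lra.
apply: (measurableT_comp mf); apply: continuous_rV_measurable => x.
by apply: (@cvgD _ _ _ (nbhs x)); [exact: cvg_id|exact: cvg_cst].
Qed.

Lemma bsupp_max0 f : bsupp f -> bsupp (fun y => Num.max (f y) 0).
Proof.
move=> [mf [B fB] [M fM]]; split; first exact: measurable_maxr.
- exists B => y; have := fB y; have B0 : 0 <= B by rewrite (le_trans _ (fB 0)).
  by rewrite maxEge; case: ifPn => // _ _; rewrite normr0.
- by exists M => y yM; rewrite fM// maxxx.
Qed.

Lemma bsupp_indic (A : set space) (M : R) : measurable A -> (forall y, A y -> `|y| <= M) ->
  bsupp (\1_A).
Proof.
move=> mA AM; split; first exact: measurable_indic.
- by exists 1 => y; rewrite indicE; case: (_ \in _); rewrite ?normr1 ?normr0.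
- exists (M + 1) => y My; rewrite indicE; case: (boolP (y \in A)) => //.
  by rewrite inE => /AM; lra.
Qed.

Lemma sintD f g : bsupp f -> bsupp g -> sint (fun y => f y + g y) = sint f + sint g.
Proof. by move=> bf bg; rewrite /sint RintegralD//; exact: bsupp_integrable. Qed.

Lemma sintB f g : bsupp f -> bsupp g -> sint (fun y => f y - g y) = sint f - sint g.
Proof. by move=> bf bg; rewrite /sint RintegralB//; exact: bsupp_integrable. Qed.

Lemma sintZ f (c : R) : bsupp f -> sint (fun y => c * f y) = c * sint f.
Proof. by move=> bf; rewrite /sint RintegralZl//; exact: bsupp_integrable. Qed.

Lemma sint_le f g : bsupp f -> bsupp g -> (forall y, f y <= g y) -> sint f <= sint g.
Proof. by move=> bf bg fg; apply: le_Rintegral => //; exact: bsupp_integrable. Qed.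

Lemma eq_sint f g : f =1 g -> sint f = sint g.
Proof. by move=> /funext ->. Qed.

Lemma sint_shift f (z : space) : bsupp f -> sint (fun y => f (y + z)) = sint f.
Proof.
move=> [mf _ _].
apply: (@Rintegral_invariant _ _ _ (lebesgue_rV R n) (fun y => y + z) _ _ f) => //.
  apply: continuous_rV_measurable => x.
  by apply: (@cvgD _ _ _ (nbhs x)); [exact: cvg_id|exact: cvg_cst].
by move=> A mA; exact: lebesgue_rV_translation.
Qed.

Lemma sint_sum (I : Type) (r : seq I) (F : I -> space -> R) : (forall i, bsupp (F i)) ->
  bsupp (fun y => \sum_(i <- r) F i y) /\
  sint (fun y => \sum_(i <- r) F i y) = \sum_(i <- r) sint (F i).
Proof.
move=> bF; elim: r => [|i r [b e]].
  rewrite big_nil (_ : (fun y => _) = fun=> 0); last by apply/funext => y; rewrite big_nil.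
  split; last by rewrite /sint /Rintegral integral0.
  by split; [exact: measurable_cst|exists 0 => y; rewrite normr0|exists 0].
rewrite big_cons -e -sintD//.
rewrite (_ : (fun y => _) = fun y => F i y + \sum_(j <- r) F j y); last first.
  by apply/funext => y; rewrite big_cons.
by split=> //; exact: bsuppD.
Qed.

End space_integral.

(** With m + 1 equal steps, the quadratic errors add up to at most |C| (b - a)^2 / (m + 1), which
    vanishes as m grows. *)
Lemma telescope_le (R : realType) (J : R -> R) (a b c C : R) : a <= b ->
  (forall s h, 0 < h -> a <= s - h -> s <= b -> J s - J (s - h) <= h * c + C * h ^+ 2) ->
  J b - J a <= (b - a) * c.
Proof.
rewrite le_eqVlt => /predU1P[->|ab]; first by rewrite !subrr mul0r.
move=> HJ; have ab0 : 0 < b - a by rewrite subr_gt0.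
have main (m : nat) : J b - J a <= (b - a) * c + `|C| * (b - a) ^+ 2 / m.+1%:R.
  have m0 : 0 < m.+1%:R :> R by rewrite ltr0n.
  pose h := (b - a) / m.+1%:R; have h0 : 0 < h by rewrite divr_gt0.
  have hm : h * m.+1%:R = b - a by rewrite /h divfK// gt_eqF.
  have step k : (k <= m.+1)%N -> J (a + k%:R * h) - J a <= k%:R * (h * c + C * h ^+ 2).
    elim: k => [|k ih] km; first by rewrite !mul0r addr0 subrr.
    have e1 : a + k.+1%:R * h - h = a + k%:R * h by rewrite -natr1; ring.
    have := HJ (a + k.+1%:R * h) h h0; rewrite e1.
    have -> : a <= a + k%:R * h by rewrite lerDl mulr_ge0 ?ler0n// ltW.
    have -> : a + k.+1%:R * h <= b.
      by rewrite -lerBrDl -hm mulrC ler_pM2l// ler_nat.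
    move=> /(_ isT isT) H1; have := ih (ltnW km).
    have -> : k.+1%:R * (h * c + C * h ^+ 2) = k%:R * (h * c + C * h ^+ 2) + (h * c + C * h ^+ 2).
      by rewrite -natr1 mulrDl mul1r.
    by move: H1; lra.
  have := step m.+1 (leqnn _); rewrite mulrC hm addrCA subrr addr0.
  move/le_trans; apply; rewrite mulrDr mulrA [_ * h]mulrC hm lerD2l.
  rewrite (_ : m.+1%:R * _ = C * ((h * m.+1%:R) * h)); last by ring.
  rewrite hm /h -mulrA expr2 -!mulrA; apply: ler_wpM2r; last exact: ler_norm.
  by rewrite mulr_ge0 ?mulr_ge0 ?invr_ge0 ?ltW.
apply/ler_addgt0Pr => e e0.
pose m := Num.truncn (`|C| * (b - a) ^+ 2 / e).
apply: (le_trans (main m)); rewrite lerD2l ler_pdivrMr ?ltr0n// [e * _]mulrC -ler_pdivrMr//.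
by rewrite ltW//; exact: truncnS_gt.
Qed.

(** * Second differences and mollified slices *)

Section second_difference.
Context (R : realType) (n : nat).
Local Notation space := 'rV[R]_n.
Implicit Types (f g : space -> R).

Definition secdiff (f : space -> R) i (h : R) y :=
  f (y + h *: delta_mx 0 i) + f (y + (- h) *: delta_mx 0 i) - 2 * f y.

Lemma bsupp_secdiff f i h : bsupp f -> bsupp (secdiff f i h).
Proof. by move=> bf; apply: bsuppB; [apply: bsuppD; exact: bsupp_shift|exact: bsuppZ]. Qed.

Lemma indic_pos_bsupp (f : space -> R) : bsupp f -> bsupp (\1_[set y | 0 < f y]).
Proof.
move=> [mf _ [M fM]]; have mP : measurable [set y | 0 < f y].
  rewrite (_ : [set y | _] = setT `&` f @^-1` `]0, +oo[%classic); first exact: mf.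
  by apply/seteqP; split => y /=; rewrite in_itv/= andbT; [|case].
apply: (@bsupp_indic _ _ _ M) => // y /= fy; rewrite leNgt; apply/negP => /ltW/fM f0.
by move: fy; rewrite f0 ltxx.
Qed.

(* Convexity of the positive part, and translation invariance of the integral. *)
Lemma sint_secdiff_pos f i h : bsupp f ->
  sint (fun y => \1_[set y | 0 < f y] y * secdiff f i h y) <= 0.
Proof.
move=> bf; have bW := bsupp_max0 bf; set W := fun y => _ in bW.
apply: (@le_trans _ _ (sint (secdiff W i h))).
  apply: sint_le; [|exact: bsupp_secdiff|].
    by apply: bsuppM; [exact: bsupp_secdiff|exact: indic_pos_bsupp].
  move=> y; rewrite /secdiff /W indicE; case: (boolP (y \in _)) => [|].
    by rewrite inE/= mul1r => fy; rewrite (max_l (ltW fy)) lerD2r lerD// le_max lexx.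
  rewrite notin_setE/= => /negP; rewrite -leNgt mul0r => fy.
  by rewrite (max_r fy) mulr0 subr0 addr_ge0// le_max lexx orbT.
have bs k : bsupp (fun y => W (y + k *: delta_mx 0 i)) by exact: bsupp_shift.
rewrite /secdiff (sintB (bsuppD (bs h) (bs (- h))) (bsuppZ 2 bW)).
by rewrite (sintD (bs h) (bs (- h))) !(sint_shift _ bW) (sintZ _ bW); lra.
Qed.

(** Discrete integration by parts: translating the variable moves each shift from [f] to [g] with
    the opposite sign, and a second difference is even in h. *)
Lemma sint_secdiffC f g i h : bsupp f -> bsupp g ->
  sint (fun y => g y * secdiff f i h y) = sint (fun y => secdiff g i h y * f y).
Proof.
move=> bf bg.
have b1 k : bsupp (fun y => g y * f (y + k *: delta_mx 0 i)).
  by apply: bsuppM => //; exact: bsupp_shift.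
have b2 k : bsupp (fun y => g (y + k *: delta_mx 0 i) * f y).
  by apply: bsuppM => //; exact: bsupp_shift.
have shiftE k : sint (fun y => g y * f (y + k *: delta_mx 0 i)) =
    sint (fun y => g (y + (- k) *: delta_mx 0 i) * f y).
  rewrite -(sint_shift (k *: delta_mx 0 i) (b2 (- k))).
  by apply: eq_sint => y; rewrite scaleNr addrK.
have b3 : bsupp (fun y => g y * f y) by apply: bsuppM.
rewrite /secdiff.
transitivity (sint (fun y => g y * f (y + h *: delta_mx 0 i) +
    g y * f (y + (- h) *: delta_mx 0 i) - 2 * (g y * f y))).
  by apply: eq_sint => y; ring.
rewrite (sintB (bsuppD (b1 _) (b1 _)) (bsuppZ 2 b3)) (sintD (b1 _) (b1 _)) !shiftE opprK.
rewrite -(sintD (b2 _) (b2 _)) -(sintB (bsuppD (b2 _) (b2 _)) (bsuppZ 2 b3)).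
by apply: eq_sint => y; ring.
Qed.

End second_difference.

Section mollified_slices.
Context (R : realType) (n : nat).
Local Notation space := 'rV[R]_n.
Local Notation spacetime := ('rV[R]_n * R)%type.
Variables (K : set spacetime) (v phi : spacetime -> R).
Hypothesis mK : measurable (K : set ('rV[R]_n * measurableTypeR R)).
Hypothesis bK : bounded_set K.
Hypothesis iv : (dxdt R n).-integrable K (EFin \o v).
Hypothesis sphi : smooth phi.
Hypothesis zphi : exists M : R, forall p, M <= `|p| -> phi p = 0.

Let xdir i : spacetime := (delta_mx 0 i : space, 0 : R).
Let tdir : spacetime := (0 : space, 1 : R).
Let V s y := mollify K v phi (y, s).
Let L i s y := mollify K v ('D_(xdir i) ('D_(xdir i) phi)) (y, s).
Let A s y := mollify K v ('D_tdir phi) (y, s).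

Lemma mollify_slice_bsupp psi s : test_kernel psi -> bsupp (fun y => mollify K v psi (y, s)).
Proof.
move=> k; split.
- apply: continuous_measurable_rV => y.
  apply: (@continuous_comp _ _ _ (fun y : space => (y, s)) (mollify K v psi)).
    by apply: (@cvg_pair _ _ _ (nbhs y) (nbhs y) (nbhs s)); [exact: cvg_id|exact: cvg_cst].
  exact: (mollify_continuous mK iv k).
- have [B B0 psiB] := kernel_bounded k; exists (B * mass (dxdt R n) K v) => y.
  by apply: norm_pairing_le => //; exact: kernel_mbounded.
- have [M z] := mollify_support v bK k; exists M => y yM; apply: z.
  by rewrite prod_normE/= le_max yM.
Qed.

Let k0 : test_kernel phi. Proof. exact: kernel_smooth. Qed.
Let kL i : test_kernel ('D_(xdir i) ('D_(xdir i) phi)).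
Proof. by have [] := kernel_derive (xdir i) sphi zphi. Qed.
Let kA : test_kernel ('D_tdir phi). Proof. by have [] := kernel_derive tdir sphi zphi. Qed.
Let bV s : bsupp (V s). Proof. exact: mollify_slice_bsupp. Qed.
Let bL i s : bsupp (L i s). Proof. exact: mollify_slice_bsupp. Qed.
Let bA s : bsupp (A s). Proof. exact: mollify_slice_bsupp. Qed.

Let xshift (y : space) s i (h : R) :
  (y + h *: delta_mx 0 i, s) = (y, s) + h *: xdir i :> spacetime.
Proof. by apply/pair_equal_spec; split => //=; rewrite scaler0 addr0. Qed.

(** Divide by h^2 and let h tend to 0: Taylor's remainder contributes C h times the integral of
    [theta]. As the differences fall on V, the weight may be an indicator. *)
Lemma laplacian_bound (theta : space -> R) s i (c h0 : R) : bsupp theta ->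
  (forall y, 0 <= theta y) -> 0 < h0 ->
  (forall h, 0 < h -> h < h0 ->
     sint (fun y => theta y * secdiff (V s) i h y) <= c * h ^+ 2) ->
  sint (fun y => theta y * L i s y) <= c.
Proof.
move=> bt t0 h00 Hc; have [C C0 tay] := mollify_taylor mK iv (xdir i) sphi zphi.
have S0 : 0 <= sint theta by apply: Rintegral_ge0.
have bound h : 0 < h -> h < h0 -> sint (fun y => theta y * L i s y) <= c + h * (C * sint theta).
  move=> h_gt0 hh0; rewrite -(ler_pM2l (exprn_gt0 2 h_gt0)).
  rewrite -sintZ; last by apply: bsuppM => //; exact: bL.
  apply: (@le_trans _ _ (sint (fun y => theta y * secdiff (V s) i h y + C * h ^+ 3 * theta y))).
    apply: sint_le.
    - by apply: bsuppZ; apply: bsuppM => //; exact: bL.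
    - by apply: bsuppD; [apply: bsuppM => //; exact: bsupp_secdiff|exact: bsuppZ].
    - move=> y; rewrite mulrCA [C * _ * _]mulrC -mulrDr; apply: ler_wpM2l => //.
      have [_] := tay (y, s) h; rewrite ler_norml => /andP[+ _].
      rewrite gtr0_norm// /secdiff /V !xshift scaleNr /L; lra.
  rewrite sintD; [|by apply: bsuppM => //; exact: bsupp_secdiff|exact: bsuppZ].
  rewrite sintZ//; have := Hc _ h_gt0 hh0.
  by rewrite (_ : h ^+ 2 * _ = c * h ^+ 2 + C * h ^+ 3 * sint theta); [lra|ring].
apply/ler_addgt0Pr => e e0.
(* The first term keeps h below [h0], the second makes the remainder at most e; the + 1 avoids a
   division by 0. *)
pose h := Num.min (h0 / 2) (e / (C * sint theta + 1)).
have D0 : 0 < C * sint theta + 1 by rewrite ltr_wpDl// mulr_ge0.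
have h_gt0 : 0 < h by rewrite lt_min !divr_gt0.
have hh0 : h < h0 by rewrite gt_min; apply/orP; left; lra.
rewrite (le_trans (bound h h_gt0 hh0))// lerD2l.
apply: (@le_trans _ _ (h * (C * sint theta + 1))); first by rewrite ler_wpM2l ?(ltW h_gt0)// lerDl.
by rewrite -ler_pdivlMr// ge_min lexx orbT.
Qed.

Lemma laplacian_pos_part s i :
  sint (fun y => \1_[set y | 0 < V s y] y * L i s y) <= 0.
Proof.
apply: (@laplacian_bound _ s i 0 1) => //; first exact: indic_pos_bsupp.
by move=> h h0 h1; rewrite mul0r; exact: sint_secdiff_pos.
Qed.

(** Discrete integration by parts moves the second difference to [zeta]. As V >= 0, the upper bound
    c h^2 is enough, and [U] contains every point where that difference may be nonzero for |h| <
    h0. *)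
Lemma laplacian_semiconcave (zeta : space -> R) (U : set space) s i (c h0 : R) :
  bsupp zeta -> (forall y, 0 <= zeta y) -> (forall y, 0 <= V s y) -> 0 <= c ->
  (forall h y, secdiff zeta i h y <= c * h ^+ 2) ->
  bsupp (\1_U : space -> R) -> 0 < h0 ->
  (forall h y, `|h| < h0 -> ~ U y -> zeta (y + h *: delta_mx 0 i) = 0) ->
  sint (fun y => zeta y * L i s y) <= c * sint (fun y => \1_U y * V s y).
Proof.
move=> bz z0 V0 c0 zc bU h00 zU.
apply: (@laplacian_bound _ s i _ h0) => // h h_gt0 hh0.
rewrite sint_secdiffC//.
rewrite mulrAC -sintZ; last by apply: bsuppM.
apply: sint_le.
- by apply: bsuppM => //; exact: bsupp_secdiff.
- by apply: bsuppZ; exact: bsuppM.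
move=> y; rewrite mulrA; apply: ler_wpM2r; first exact: V0.
rewrite indicE; case: (boolP (y \in U)) => [_|]; first by rewrite mulr1.
rewrite notin_setE => Uy; rewrite mulr0 /secdiff !zU ?normrN ?gtr0_norm//.
have := zU 0 y; rewrite normr0 scale0r addr0 => -> //.
Qed.

(** Moving the centre of the kernel reverses the sign of first derivatives, so [- A] is the time
    derivative of V and the hypothesis reads V_t <= Delta V + kappa on {theta > 0}. The constant C
    is independent of [theta], s and h. *)
Lemma time_step : exists2 C : R, 0 <= C & forall (theta : space -> R) (kappa s h : R),
  bsupp theta -> (forall y, 0 <= theta y) -> 0 < h ->
  (forall y, 0 < theta y -> - A s y <= (\sum_(i < n) L i s y) + kappa) ->
  sint (fun y => theta y * (V s y - V (s - h) y)) <=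
  h * (\sum_(i < n) sint (fun y => theta y * L i s y) + kappa * sint theta) +
  C * sint theta * h ^+ 2.
Proof.
have [C C0 tay] := mollify_taylor mK iv tdir sphi zphi.
exists C => // theta kappa s h bt t0 h0 HA.
have bS : bsupp (fun y => \sum_(i < n) L i s y).
  by have [] := sint_sum (index_enum 'I_n) (fun i => bL i s).
have bSt i : bsupp (fun y => theta y * L i s y) by apply: bsuppM => //; exact: bL.
have [bSum <-] := sint_sum (index_enum 'I_n) bSt.
rewrite -sintZ// -sintD//; last exact: bsuppZ.
rewrite -sintZ; last by apply: bsuppD => //; exact: bsuppZ.
rewrite (_ : C * sint theta * h ^+ 2 = C * h ^+ 2 * sint theta); last by ring.
rewrite -sintZ// -sintD; [|by apply: bsuppZ; apply: bsuppD => //; exact: bsuppZ|exact: bsuppZ].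
apply: sint_le.
- by apply: bsuppM => //; apply: bsuppB; exact: bV.
- by apply: bsuppD; [apply: bsuppZ; apply: bsuppD => //|]; exact: bsuppZ.
move=> y; rewrite -mulr_sumr [kappa * _]mulrC -mulrDr mulrCA [C * _ * _]mulrC -mulrDr.
have := t0 y; rewrite le_eqVlt => /predU1P[<-|ty]; first by rewrite !mul0r.
rewrite ler_pM2l//; have hA := HA y ty.
have [+ _] := tay (y, s) h; rewrite ler_norml => /andP[+ _].
have -> : (y, s) - h *: tdir = (y, s - h).
  apply/pair_equal_spec; split => /=; first by rewrite scaler0 subr0.
  by congr (_ - _); exact: mulr1.
rewrite -/(V s y) -/(V (s - h) y) -/(A s y).
have : h * - A s y <= h * (\sum_(i < n) L i s y + kappa) by rewrite ler_pM2l.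
by rewrite mulrN; lra.
Qed.

End mollified_slices.

(** * Weak subsolutions of the heat equation with absorption *)

Section weak_subsolution.
Context (R : realType) (n : nat).
Local Notation space := 'rV[R]_n.
Local Notation spacetime := ('rV[R]_n * R)%type.
Implicit Types (K : set spacetime) (v f phi : spacetime -> R) (d p q : spacetime).

Definition translate q f : spacetime -> R := fun p => f (p - q).

Let quotient_shift f d q p :
  (fun h : R => h^-1 *: ((translate q f \o shift p) (h *: d) - translate q f p)) =
  (fun h : R => h^-1 *: ((f \o shift (p - q)) (h *: d) - f (p - q))).
Proof. by apply/funext => h /=; rewrite /translate addrA. Qed.

Lemma derive_translate f d q : 'D_d (translate q f) = translate q ('D_d f).
Proof. by apply/funext => p; rewrite /derive quotient_shift. Qed.

Lemma derive_translateE f d q p : 'D_d (translate q f) p = translate q ('D_d f) p.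
Proof. by rewrite -derive_translate. Qed.

Lemma smooth_translate phi q : smooth phi -> smooth (translate q phi).
Proof.
move=> sphi vs.
have -> : Defs.iterD (translate q phi) vs = translate q (Defs.iterD phi vs).
  by elim: vs => //= d vs ->; rewrite derive_translate.
have [c dr] := sphi vs; split=> [p|p d]; last by rewrite /derivable quotient_shift; exact: dr.
apply: (@continuous_comp _ _ _ (fun p : spacetime => p - q) (Defs.iterD phi vs)); last exact: c.
by apply: (@cvgB _ _ _ (nbhs p)); [exact: cvg_id|exact: cvg_cst].
Qed.

(** The weak form of v_t - Delta v + f <= 0. Test functions vanish off [K] instead of having compact
    support in an open set, so that all integrals are over [K]. *)
Definition weak_subsol K v f := forall phi, smooth phi -> (forall p, 0 <= phi p) ->
  (forall p, ~ K p -> phi p = 0) ->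
  \int[dxdt R n]_(p in K) (- v p * dt phi p - v p * laplacian phi p + f p * phi p) <= 0.

Definition mollifier (e : R) phi := [/\ smooth phi, (forall p, 0 <= phi p),
  (forall p, e <= `|p| -> phi p = 0) & \int[dxdt R n]_p phi p = 1].

Variables (K : set spacetime) (v : spacetime -> R).
Hypothesis mK : measurable (K : set ('rV[R]_n * measurableTypeR R)).
Hypothesis iv : (dxdt R n).-integrable K (EFin \o v).
Variables (e : R) (phi : spacetime -> R).
Hypothesis mphi : mollifier e phi.

Let sphi : smooth phi. Proof. by case: mphi. Qed.
Let phi0 p : 0 <= phi p. Proof. by case: mphi. Qed.
Let zphi p : e <= `|p| -> phi p = 0. Proof. by case: mphi => _ _ + _; apply. Qed.
Let kphi : test_kernel phi. Proof. by apply: kernel_smooth => //; exists e. Qed.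

Let mbphi q : mbounded (K : set ('rV[R]_n * measurableTypeR R)) (fun p => phi (p - q)).
Proof. exact: kernel_mbounded. Qed.

Let out p q : (~ `|p - q| < e) -> phi (p - q) = 0.
Proof. by move=> /negP; rewrite -leNgt; exact: zphi. Qed.

Lemma mollifier_integrable q : (dxdt R n).-integrable K (EFin \o (fun p => phi (p - q))).
Proof.
have := @continuous_cpt_integrable R n (fun p => phi (p - q)) (e + `|q|).
move=> /(_ _ _)/integrableS; apply => //.
  by have [] := smooth_translate q sphi [::].
by move=> p pM; apply: zphi; have := ler_normD (p - q) q; rewrite subrK; lra.
Qed.

Lemma mollifier_mass q : (forall p, `|p - q| < e -> K p) ->
  \int[dxdt R n]_(p in K) phi (p - q) = 1.
Proof.
move=> qK; rewrite Rintegral_mkcond; case: mphi => _ _ _ <-.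
rewrite -(@Rintegral_invariant _ _ _ (dxdt R n) (fun p : spacetime => p + - q) _ _ phi).
- apply: eq_Rintegral => p _; rewrite patchE; case: ifPn => //.
  by rewrite notin_setE => Kp; rewrite out// => /qK.
- have m1 : measurable_fun setT (fun x : space => x - q.1).
    apply: continuous_rV_measurable => x.
    by apply: (@cvgB _ _ _ (nbhs x)); [exact: cvg_id|exact: cvg_cst].
  have m2 : measurable_fun setT ((fun t => t - q.2) : measurableTypeR R -> measurableTypeR R).
    exact: measurable_funB.
  exact: (measurable_fun_pair (measurableT_comp m1 measurable_fst) (measurableT_comp m2 measurable_snd)).
- by move=> A mA; exact: dxdt_translation.
- by apply: continuous_measurable_prod; have [] := sphi [::].
Qed.

Lemma mollify_le q (c : R) : (forall p, `|p - q| < e -> K p) ->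
  (forall p, `|p - q| < e -> v p <= c) -> mollify K v phi q <= c.
Proof.
move=> qK vc; rewrite -[c]mulr1 -(mollifier_mass qK) -RintegralZl//; last exact: mollifier_integrable.
apply: le_Rintegral => //; first exact: pairing_integrable.
  by have := integrableZl mK c (mollifier_integrable q); apply: eq_integrable.
move=> p Kp; have [pe|pe] := ltP `|p - q| e; last by rewrite zphi// !mulr0.
by apply: ler_wpM2r => //; exact: vc.
Qed.

Lemma mollify_ge q (c : R) : (forall p, `|p - q| < e -> K p) ->
  (forall p, `|p - q| < e -> c <= v p) -> c <= mollify K v phi q.
Proof.
move=> qK vc; rewrite -[c]mulr1 -(mollifier_mass qK) -RintegralZl//; last exact: mollifier_integrable.
apply: le_Rintegral => //; last first.
- move=> p Kp; have [pe|pe] := ltP `|p - q| e; last by rewrite zphi// !mulr0.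
  by apply: ler_wpM2r => //; exact: vc.
- exact: pairing_integrable.
- by have := integrableZl mK c (mollifier_integrable q); apply: eq_integrable.
Qed.

(** The threshold 0 calls for no normalisation of the kernel, so the ball around q may leave [K];
    this covers the points near the edge of [K]. *)
Lemma mollify_le0 q : (forall p, K p -> `|p - q| < e -> v p <= 0) -> mollify K v phi q <= 0.
Proof.
move=> v0; rewrite -oppr_ge0 -mulN1r -(pairingZ mK iv)//.
apply: Rintegral_ge0 => p Kp; have [pe|pe] := ltP `|p - q| e; last by rewrite zphi// !mulr0.
by rewrite mulN1r mulrN -mulNr mulr_ge0// oppr_ge0 v0.
Qed.

Lemma mollify_ge0 q : (forall p, K p -> `|p - q| < e -> 0 <= v p) -> 0 <= mollify K v phi q.
Proof.
move=> v0; apply: Rintegral_ge0 => p Kp.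
have [pe|pe] := ltP `|p - q| e; last by rewrite zphi// !mulr0.
by rewrite mulr_ge0// v0.
Qed.

(** Testing with the translate of [phi] centred at q puts all derivatives on the kernel; [phi] has
    mass 1, so the term in [f] is at least -kappa. *)
Lemma weak_mollified (f : spacetime -> R) q (kappa : R) :
  (dxdt R n).-integrable K (EFin \o f) ->
  weak_subsol K v f -> (forall p, `|p - q| < e -> K p) ->
  (forall p, `|p - q| < e -> - kappa <= f p) ->
  - mollify K v ('D_((0 : space), (1 : R)) phi) q <=
  \sum_(i < n) mollify K v ('D_((delta_mx 0 i : space), (0 : R))
     ('D_((delta_mx 0 i : space), (0 : R)) phi)) q + kappa.
Proof.
move=> If weak qK fk.
have := weak _ (smooth_translate q sphi) (fun p => phi0 _).
have z : forall p, ~ K p -> phi (p - q) = 0 by move=> p Kp; apply: out => pq; exact/Kp/qK.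
move=> /(_ z).
have [kd kdd] : test_kernel ('D_((0 : space), (1 : R)) phi) /\ forall i, test_kernel
   ('D_((delta_mx 0 i : space), (0 : R)) ('D_((delta_mx 0 i : space), (0 : R)) phi)).
  have ex : exists M : R, forall p, M <= `|p| -> phi p = 0 by exists e.
  split; first by have [] := kernel_derive ((0 : space), (1 : R)) sphi ex.
  by move=> i; have [] := kernel_derive ((delta_mx 0 i : space), (0 : R)) sphi ex.
pose F p := 'D_((0 : space), (1 : R)) phi (p - q).
pose G p := \sum_(i < n) 'D_((delta_mx 0 i : space), (0 : R))
     ('D_((delta_mx 0 i : space), (0 : R)) phi) (p - q).
have mF : mbounded (K : set ('rV[R]_n * measurableTypeR R)) F.
  exact: (kernel_mbounded K q kd).
have [mG pG] : mbounded (K : set ('rV[R]_n * measurableTypeR R)) G /\ pairing (dxdt R n) K v G =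
  \sum_(i < n) mollify K v ('D_((delta_mx 0 i : space), (0 : R))
     ('D_((delta_mx 0 i : space), (0 : R)) phi)) q.
  rewrite /G; elim: (index_enum _) => [|i r [ih1 ih2]].
    rewrite big_nil (_ : (fun p => _) = fun=> 0); last by apply/funext => p; rewrite big_nil.
    split; first by split; [exact: measurable_cst|exists 0 => p _; rewrite normr0].
    rewrite /pairing (@eq_Rintegral _ _ _ _ _ (fun=> 0)) => [|p _]; last by rewrite mulr0.
    by rewrite /Rintegral integral0.
  rewrite big_cons -ih2; under eq_fun do rewrite big_cons.
  have m1 := kernel_mbounded K q (kdd i).
  by split; [exact: mboundedD|rewrite (pairingD mK iv m1 ih1)].
move=> W; have {W} : \int[dxdt R n]_(p in K) (v p * ((-1) * (F p + G p)) + f p * phi (p - q)) <= 0.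
  apply: le_trans W; rewrite le_eqVlt; apply/orP; left; apply/eqP; apply: eq_Rintegral => p _.
  rewrite /dt derive_translateE.
  rewrite /laplacian (eq_bigr (fun i => 'D_((delta_mx 0 i : space), (0 : R))
     ('D_((delta_mx 0 i : space), (0 : R)) phi) (p - q))); last first.
    by move=> i _; rewrite derive_translate derive_translateE.
  by rewrite -/(G p) /translate -/(F p); ring.
have mFG := mboundedZ (-1) (mboundedD mF mG).
have E0 : \int[dxdt R n]_(p in K) (v p * ((-1) * (F p + G p))) =
    -1 * (mollify K v ('D_((0 : space), (1 : R)) phi) q +
    \sum_(i < n) mollify K v ('D_((delta_mx 0 i : space), (0 : R))
     ('D_((delta_mx 0 i : space), (0 : R)) phi)) q).
  rewrite -pG; transitivity (-1 * pairing (dxdt R n) K v (fun p => F p + G p)).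
    exact: (pairingZ mK iv (-1) (mboundedD mF mG)).
  by congr (_ * _); exact: (pairingD mK iv mF mG).
rewrite RintegralD//; [|exact: (pairing_integrable mK iv mFG)|exact: pairing_integrable].
rewrite E0.
have : - kappa <= \int[dxdt R n]_(p in K) (f p * phi (p - q)).
  rewrite -[X in X <= _]mulr1 -(mollifier_mass qK) -RintegralZl//; last exact: mollifier_integrable.
  apply: le_Rintegral => //; last first.
  - move=> p Kp; have [pe|pe] := ltP `|p - q| e; last by rewrite zphi// !mulr0.
    by apply: ler_wpM2r => //; exact: fk.
  - exact: pairing_integrable.
  - by have := integrableZl mK (- kappa) (mollifier_integrable q); apply: eq_integrable.
by move: (\sum_i _) (mollify _ _ _ _) (Rintegral _ _ _) => x y zz; lra.
Qed.

End weak_subsolution.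

Lemma le_of_eps (R : realFieldType) (x y D : R) : 0 <= D ->
  (forall w, 0 < w -> x <= y + w * D) -> x <= y.
Proof.
move=> D0 H; apply/ler_addgt0Pr => e e0; have D1 : 0 < D + 1 by rewrite ltr_wpDl.
apply: (le_trans (H (e / (D + 1)) _)); first by rewrite divr_gt0.
by rewrite lerD2l mulrAC ler_pdivrMr// ler_wpM2l ?(ltW e0)// lerDl.
Qed.

Lemma chain_le (R : realFieldType) (x y p q d0 d1 d : R) :
  p - q <= d -> x <= p + d0 -> q <= y + d1 -> x <= y + (d0 + d1 + d).
Proof. lra. Qed.

Lemma dist_lt_bounds (R : realDomainType) (x y w : R) : `|x - y| < w -> x <= y + w /\ y - w <= x.
Proof. by rewrite ltr_norml => /andP[]; lra. Qed.

(** * Monotonicity in time *)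

Section evolution.
Context (R : realType) (n : nat).
Local Notation space := 'rV[R]_n.
Local Notation spacetime := ('rV[R]_n * R)%type.

Lemma bsupp_patch (K : set space) (f : space -> R) : compact K ->
  {within K, continuous f} -> bsupp (f \_ K).
Proof.
move=> cK cf; have mK := compact_measurable_rV cK.
have [B B0 fB] := compact_bounded_fun cK cf.
have [M M0 KM] := compact_le_norm cK.
split.
- apply/(measurable_restrictT _ mK); exact: within_continuous_measurable_rV.
- by exists B => y; rewrite patchE; case: ifPn => [|_]; rewrite ?normr0 ?(ltW B0)// inE => /fB.
- exists (M + 1) => y yM; rewrite patchE; case: ifPn => //.
  by rewrite inE => /KM; lra.
Qed.

Lemma sint_patch (K : set space) (f : space -> R) :
  sint (f \_ K) = \int[lebesgue_rV R n]_(y in K) f y.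
Proof. by rewrite /sint -Rintegral_mkcond. Qed.

Lemma dist_within_continuous (V : normedModType R) (A : set V) (g : V -> R) :
  (forall x, A x -> forall w : R, 0 < w -> exists2 e : R, 0 < e &
     forall y, A y -> `|x - y| < e -> `|g x - g y| < w) -> {within A, continuous g}.
Proof.
move=> H; apply/subspace_continuousP => x Ax; apply/cvgrPdist_lt => w w0.
rewrite near_withinE; have [e e0 He] := H x Ax w w0.
by apply: filterS (norm_nbhs x e0) => y xy Ay; exact: He.
Qed.

Lemma within_slice (K1 : set space) (J : set R) (v : spacetime -> R) s :
  {within K1 `*` J, continuous v} -> J s -> {within K1, continuous (fun y => v (y, s))}.
Proof.
move=> /within_continuous_distP cv Js; apply: dist_within_continuous => y Ky w w0.
have [e e0 H] := cv (y, s) (conj Ky Js) w w0; exists e => // z Kz yz; apply: H => //.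
by rewrite prod_normE/= subrr normr0 gt_max yz.
Qed.

Variables (K0 K1 : set space) (eta a' a b b' : R) (v f : spacetime -> R).
Hypothesis cK0 : compact K0.
Hypothesis cK1 : compact K1.
Hypothesis eta0 : 0 < eta.
Hypothesis K01 : forall x y, K0 x -> `|x - y| < eta -> K1 y.
Hypothesis aa : a' < a.
Hypothesis ab : a <= b.
Hypothesis bb : b < b'.
Let K : set spacetime := K1 `*` `[a', b'].
Hypothesis cv : {within K, continuous v}.
Hypothesis iv : (dxdt R n).-integrable K (EFin \o v).
Hypothesis if_ : (dxdt R n).-integrable K (EFin \o f).
Hypothesis wv : weak_subsol K v f.

Let cK : compact K.
Proof. by apply: compact_setX => //; exact: segment_compact. Qed.

Let mK : measurable (K : set ('rV[R]_n * measurableTypeR R)).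
Proof. exact: compact_measurable_prod. Qed.

Let bK : bounded_set K. Proof. exact: compact_bounded. Qed.

Let K0K1 : K0 `<=` K1.
Proof. by move=> x /K01; apply; rewrite subrr normr0. Qed.

Let size (A : set space) := sint (\1_A : space -> R).

Let bsupp_compact (A : set space) : compact A -> bsupp (\1_A : space -> R).
Proof.
move=> cA; have [M _ AM] := compact_le_norm cA.
by apply: (bsupp_indic _ AM); exact: compact_measurable_rV.
Qed.

Let size_ge0 A : 0 <= size A.
Proof. by apply: Rintegral_ge0 => y _. Qed.

(** The factor 2 serves to compare two points of the same kernel ball of radius e. The function [g]
    is [f] in the comparison and [v] itself in the semiconcave case. *)
Let radius (g : spacetime -> R) (w : R) : {within K, continuous g} -> 0 < w -> exists2 e : R,
  [/\ 0 < e, e < eta / 2, e < a - a' & e < b' - b] &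
  forall p q, K p -> K q -> `|p - q| < 2 * e -> `|v p - v q| < w /\ `|g p - g q| < w.
Proof.
move=> cg w0; have [r r0 vr] := compact_unif_continuous cK cv w0.
have [r' r'0 gr] := compact_unif_continuous cK cg w0.
near (0:R)^'+ => e; exists e.
  split; near: e; first exact: nbhs_right_gt.
  - by apply: nbhs_right_lt; rewrite divr_gt0.
  - by apply: nbhs_right_lt; rewrite subr_gt0.
  - by apply: nbhs_right_lt; rewrite subr_gt0.
have er : e < r / 2 by near: e; apply: nbhs_right_lt; rewrite divr_gt0.
have er' : e < r' / 2 by near: e; apply: nbhs_right_lt; rewrite divr_gt0.
by move=> p q Kp Kq pq; split; [apply: vr|apply: gr] => //; lra.
Unshelve. all: by end_near. Qed.

(** One half of [eta] bounds the distance from y to [K0], the other half the kernel radius; in time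
    the kernel fits into the gaps a - a' and b' - b. *)
Let near_K (x y : space) (s e : R) p : e < eta / 2 -> e < a - a' -> e < b' - b ->
  K0 x -> `|x - y| < eta / 2 -> a <= s <= b -> `|p - (y, s)| < e -> K p.
Proof.
move=> e1 e2 e3 Kx xy /andP[as_ sb]; rewrite prod_normE gt_max /= => /andP[py ps]; split => /=.
  apply: (K01 Kx); rewrite -(subrKA y) (le_lt_trans (ler_normD _ _))//.
  by rewrite (distrC y); lra.
by rewrite in_itv/=; move: ps; rewrite ltr_norml => /andP[]; lra.
Qed.

Section comparison.
Hypothesis cf : {within K, continuous f}.
Hypothesis fsign : forall p, K p -> 0 < v p -> 0 <= f p.
Hypothesis vsign : forall p, K p -> ~ K0 p.1 -> v p <= 0.

(** A single tolerance w controls the errors: the moduli of continuity of [v] and [f] fix the kernel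
    radius, for which the inequality V_t <= Delta V holds up to w where V > 0. The time step tends
    to 0 inside [telescope_le], and w tends to 0 last. *)
Lemma positive_part_decreasing :
  \int[lebesgue_rV R n]_(y in K0) Num.max (v (y, b)) 0 <=
  \int[lebesgue_rV R n]_(y in K1) Num.max (v (y, a)) 0.
Proof.
have Ks s : a <= s <= b -> `[a', b']%classic s by move=> /andP[? ?]; rewrite /= in_itv/=; move: aa bb; lra.
have Ka : `[a', b']%classic a by apply: Ks; rewrite lexx.
have Kb : `[a', b']%classic b by apply: Ks; rewrite lexx andbT.
have bv s (A : set space) : `[a', b']%classic s -> compact A -> A `<=` K1 ->
    bsupp ((fun y => Num.max (v (y, s)) 0) \_ A).
  move=> Js cA AK; have := bsupp_max0 (bsupp_patch cA (continuous_subspaceW AK (within_slice cv Js))).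
  congr bsupp; apply/funext => y; rewrite !patchE; case: ifPn => // _; exact: maxxx.
have b0 := bv b K0 Kb cK0 K0K1; have b1 := bv a K1 Ka cK1 (@subset_refl _ _).
rewrite -!sint_patch.
apply: (@le_of_eps _ _ _ (size K0 + size K1 + (b - a) * size K1)) => [|w w0].
  by rewrite !addr_ge0// ?mulr_ge0// subr_ge0.
have [e [e0 e1 e2 e3] vfw] := radius cf w0; have e2e : e < 2 * e by lra.
have [phi mphi] := @mollifier_exists R n e e0; have [sphi phi0 zphi _] := mphi.
have zz : exists M : R, forall p, M <= `|p| -> phi p = 0 by exists e.
have kphi := kernel_smooth sphi zz.
pose V s y := mollify K v phi (y, s).
have bV s : bsupp (V s) by exact: mollify_slice_bsupp.
(* The contrapositive of [mollify_le0]: V > 0 at a point forces v > 0 somewhere under the kernel,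
   and [vsign] places that point over [K0]. *)
have pos s y : 0 < V s y -> exists p, [/\ K p, K0 p.1, `|p - (y, s)| < e & 0 < v p].
  move=> Vy; apply: contrapT => H; move: Vy; rewrite ltNge => /negP; apply.
  apply: (mollify_le0 mK iv mphi) => p Kp pe; rewrite leNgt; apply/negP => vp.
  apply: H; exists p; split => //; apply: contrapT => /(vsign Kp).
  by rewrite leNgt vp.
have posK s y p : a <= s <= b -> K0 p.1 -> `|p - (y, s)| < e ->
    forall p', `|p' - (y, s)| < e -> K p'.
  move=> sab K0p pe p'; apply: (@near_K p.1 y s e p') => //.
  by rewrite (lt_trans _ e1)//; move: pe; rewrite prod_normE gt_max => /andP[].
have close (p p' q : spacetime) : `|p - q| < e -> `|p' - q| < e -> `|p - p'| < 2 * e.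
  move=> pq p'q; rewrite -(subrKA q) (le_lt_trans (ler_normD _ _))// (distrC q).
  by rewrite mulrDl mul1r ltrD.
have [C C0 step] := time_step mK bK iv sphi zz.
have posM s := indic_pos_bsupp (bV s).
have size_pos s : a <= s <= b -> sint (\1_[set y | 0 < V s y]) <= size K1.
  move=> sab; apply: sint_le => //; first exact: bsupp_compact.
  move=> y; rewrite !indicE; case: (boolP (y \in _)) => // /set_mem/= /[dup] Vy /pos[p [Kp K0p pe vp]].
  rewrite mem_set//; have [] // := posK s y p sab K0p pe (y, s).
  by rewrite subrr normr0.
have J_le : sint (fun y => Num.max (V b y) 0) - sint (fun y => Num.max (V a y) 0) <=
    (b - a) * (w * size K1).
  apply: (@telescope_le _ (fun s => sint (fun y => Num.max (V s y) 0)) a b _ (C * size K1)) => // s h h0 as_ sb.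
  have sab : a <= s <= b by rewrite sb andbT; lra.
  rewrite -sintB; [|exact: bsupp_max0|exact: bsupp_max0].
  (* Convexity of the positive part, with the indicator of {V(s) > 0} as a subgradient at the later
     time s. *)
  apply: (@le_trans _ _ (sint (fun y => \1_[set y | 0 < V s y] y * (V s y - V (s - h) y)))).
    apply: sint_le; first by apply: bsuppB; exact: bsupp_max0.
      by apply: bsuppM => //; exact: bsuppB.
    move=> y; rewrite indicE; case: (boolP (y \in _)) => [|].
      by rewrite inE/= mul1r => Vy; rewrite (max_l (ltW Vy)) lerB// le_max lexx.
    rewrite notin_setE/= => /negP; rewrite -leNgt mul0r => Vy.
    by rewrite (max_r Vy) sub0r oppr_le0 le_max lexx orbT.
  apply: (le_trans (step _ w s h (posM s) _ h0 _)) => // [y|].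
    rewrite indicE; case: (boolP (y \in _)); last by rewrite ltxx.
    rewrite inE/= => Vy _; have [p [Kp K0p pe vp]] := pos s y Vy.
    have qK := posK s y p sab K0p pe.
    (* f >= 0 at the point p where v > 0, and [f] varies by less than w over the kernel; so f >= -w
       there, which is the choice kappa = w. *)
    apply: (weak_mollified mK iv mphi if_ wv qK) => p' p'e.
    have [_ +] := vfw p p' Kp (qK _ p'e) (close _ _ _ pe p'e).
    by have := fsign Kp vp; rewrite ltr_norml => ? /andP[]; lra.
  have sz := size_pos s sab; apply: lerD; last first.
    by rewrite ler_wpM2r ?sqr_ge0// ler_wpM2l.
  rewrite ler_pM2l//; apply: (@le_trans _ _ (0 + w * size K1)); last by rewrite add0r.
  apply: lerD; last by rewrite ler_pM2l.
  by apply: sumr_le0 => i _; exact: laplacian_pos_part.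
(* At time b the bound V >= v - w is used on [K0]; at time a the bound V <= v + w is used wherever V
   > 0, which may leave [K0] but not [K1]. Hence the two domains of the statement. *)
have Jb : sint ((fun y => Num.max (v (y, b)) 0) \_ K0) <=
    sint (fun y => Num.max (V b y) 0) + w * size K0.
  rewrite -sintZ; last exact: bsupp_compact.
  rewrite -sintD; [|exact: bsupp_max0|by apply: bsuppZ; exact: bsupp_compact].
  apply: sint_le => //.
    by apply: bsuppD; [exact: bsupp_max0|apply: bsuppZ; exact: bsupp_compact].
  move=> y; rewrite patchE indicE; case: ifPn => [|_]; last first.
    by rewrite mulr0 addr0 le_max lexx orbT.
  rewrite inE mulr1 => K0y; rewrite ge_max; apply/andP; split; last first.
    by rewrite addr_ge0 ?(ltW w0)// le_max lexx orbT.
  rewrite -lerBlDr le_max; apply/orP; left.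
  have qK : forall p, `|p - (y, b)| < e -> K p.
    by move=> p; apply: (@near_K y y b e p) => //; rewrite ?subrr ?normr0 ?divr_gt0// ab lexx.
  apply: (mollify_ge mK iv mphi qK) => p pe.
  have Kyb : K (y, b) by apply: qK; rewrite subrr normr0.
  have [+ _] := vfw p (y, b) (qK _ pe) Kyb (lt_trans pe e2e).
  by case/dist_lt_bounds.
have Ja : sint (fun y => Num.max (V a y) 0) <=
    sint ((fun y => Num.max (v (y, a)) 0) \_ K1) + w * size K1.
  rewrite -sintZ; last exact: bsupp_compact.
  rewrite -sintD; [|exact: b1|by apply: bsuppZ; exact: bsupp_compact].
  apply: sint_le; first exact: bsupp_max0.
    by apply: bsuppD => //; apply: bsuppZ; exact: bsupp_compact.
  move=> y; have [Vy|Vy] := leP (V a y) 0.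
    rewrite patchE indicE; case: ifPn => _; last by rewrite mulr0 addr0.
    by rewrite mulr1 addr_ge0 ?(ltW w0)// le_max lexx orbT.
  have [p [Kp K0p pe vp]] := pos a y Vy.
  have qK := posK a y p _ K0p pe; rewrite lexx ab in qK; have {}qK := qK isT.
  have Kya : K (y, a) by apply: qK; rewrite subrr normr0.
  have K1y : K1 y by case: Kya.
  rewrite patchE indicE mem_set// mulr1.
  apply: (@le_trans _ _ (v (y, a) + w)); last by rewrite lerD2r le_max lexx.
  apply: (mollify_le mK iv mphi qK) => p' p'e.
  have [+ _] := vfw p' (y, a) (qK _ p'e) Kya (lt_trans p'e e2e).
  by case/dist_lt_bounds.
rewrite !mulrDr [w * (_ * _)]mulrCA; exact: chain_le J_le Jb Ja.
Qed.

End comparison.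

Section semiconcave_weight.
Variables (zeta : space -> R) (c M : R).
Hypothesis mz : measurable_fun setT zeta.
Hypothesis bz : exists B : R, forall y, `|zeta y| <= B.
Hypothesis z0 : forall y, 0 <= zeta y.
Hypothesis zK0 : forall y, ~ K0 y -> zeta y = 0.
Hypothesis c0 : 0 <= c.
Hypothesis zc : forall i h y, secdiff zeta i h y <= c * h ^+ 2.
Hypothesis v0 : forall p, K p -> 0 <= v p.
Hypothesis f0 : forall p, K p -> 0 <= f p.
Hypothesis vM : forall s, a <= s <= b -> \int[lebesgue_rV R n]_(y in K1) v (y, s) <= M.

Let bzeta : bsupp zeta.
Proof.
have [B _ KB] := compact_le_norm cK0; split => //.
by exists (B + 1) => y yB; apply: zK0 => /KB; lra.
Qed.

(** Each of the n directions contributes at most c times the mass of the mollified function near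
    [K0], and this mass is at most M up to an error that vanishes with the kernel radius. *)
Lemma semiconcave_almost_decreasing :
  \int[lebesgue_rV R n]_(y in K0) (zeta y * v (y, b)) <=
  \int[lebesgue_rV R n]_(y in K0) (zeta y * v (y, a)) + (b - a) * (n%:R * (c * M)).
Proof.
have Ks s : a <= s <= b -> `[a', b']%classic s by move=> /andP[? ?]; rewrite /= in_itv/=; move: aa bb; lra.
pose P s := (fun y => v (y, s)) \_ K1.
have bP s : a <= s <= b -> bsupp (P s) by move=> /Ks Js; exact: (bsupp_patch cK1 (within_slice cv Js)).
have bzP s : a <= s <= b -> bsupp (fun y => zeta y * P s y) by move=> /bP ?; exact: bsuppM.
have PE s : \int[lebesgue_rV R n]_(y in K0) (zeta y * v (y, s)) = sint (fun y => zeta y * P s y).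
  rewrite -sint_patch; apply: eq_sint => y; rewrite /P !patchE.
  case: (boolP (y \in K0)) => [|]; last by rewrite notin_setE => /zK0 ->; rewrite mul0r.
  by rewrite inE => /K0K1 ?; rewrite mem_set.
have sa : a <= a <= b by rewrite lexx.
have sb : a <= b <= b by rewrite lexx andbT.
rewrite !PE.
have sz0 : 0 <= sint zeta by apply: Rintegral_ge0.
apply: (@le_of_eps _ _ _ (sint zeta + sint zeta + (b - a) * (n%:R * (c * size K1)))) => [|w w0].
  by rewrite !addr_ge0// !mulr_ge0 ?ler0n// subr_ge0.
have [e [e0 e1 e2 e3] vfw] := radius cv w0; have e2e : e < 2 * e by lra.
have [phi mphi] := @mollifier_exists R n e e0; have [sphi phi0 zphi _] := mphi.
have zz : exists M : R, forall p, M <= `|p| -> phi p = 0 by exists e.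
have kphi := kernel_smooth sphi zz.
pose V s y := mollify K v phi (y, s).
have bV s : bsupp (V s) by exact: mollify_slice_bsupp.
have V0 s y : 0 <= V s y by apply: (mollify_ge0 mphi) => p /v0.
(* Half of the margin: shifts of [K0] by less than eta/2 stay in [U], and the other half keeps the
   kernels centred in [U] over [K1]. *)
pose U := [set y | exists2 x, K0 x & `|x - y| < eta / 2].
have K0U : K0 `<=` U by move=> y K0y; exists y => //; rewrite subrr normr0 divr_gt0.
have UK s y : a <= s <= b -> U y -> forall p, `|p - (y, s)| < e -> K p.
  by move=> sab [x K0x xy] p; exact: (@near_K x y s e p).
have UK1 : U `<=` K1.
  by move=> y /(UK a y sa)/(_ (y, a)); rewrite subrr normr0 => /(_ e0)[].
have bU : bsupp (\1_U : space -> R).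
  have [B _ KB] := compact_le_norm cK1; apply: (@bsupp_indic _ _ _ B) => [|y /UK1/KB//].
  apply: open_measurable_rV; rewrite openE => y [x K0x xy].
  have d0 : 0 < eta / 2 - `|x - y| by rewrite subr_gt0.
  apply: filterS (norm_nbhs y d0) => y' yy'; exists x => //.
  by rewrite -(subrKA y) (le_lt_trans (ler_normD _ _))//; move: yy' => /=; lra.
have VU s y : a <= s <= b -> U y -> V s y <= P s y + w /\ P s y <= V s y + w.
  move=> sab Uy; have qK := UK s y sab Uy.
  have Kys : K (y, s) by apply: qK; rewrite subrr normr0.
  rewrite /P patchE mem_set; last exact: UK1.
  split; first apply: (mollify_le mK iv mphi qK) => p pe.
    have [+ _] := vfw p (y, s) (qK _ pe) Kys (lt_trans pe e2e).
    by case/dist_lt_bounds.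
  rewrite -lerBlDr; apply: (mollify_ge mK iv mphi qK) => p pe.
  have [+ _] := vfw p (y, s) (qK _ pe) Kys (lt_trans pe e2e).
  by case/dist_lt_bounds.
have [C C0 step] := time_step mK bK iv sphi zz.
have bzV s : bsupp (fun y => zeta y * V s y) by apply: bsuppM.
have bK1 := bsupp_compact cK1.
have sU s : a <= s <= b -> sint (fun y => \1_U y * V s y) <= M + w * size K1.
  move=> sab; apply: (@le_trans _ _ (sint (fun y => P s y + w * \1_K1 y))).
    apply: sint_le; first exact: bsuppM.
      by apply: bsuppD; [exact: bP|exact: bsuppZ].
    move=> y; rewrite !indicE; case: (boolP (y \in U)) => [|_].
      by rewrite inE mul1r => Uy; rewrite mem_set ?mulr1; [case: (VU s y sab Uy)|exact: UK1].
    rewrite mul0r addr_ge0// ?mulr_ge0 ?(ltW w0)// /P patchE; case: ifPn => // /set_mem K1y.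
    by apply: v0; split => //; exact: Ks.
  rewrite sintD; [|exact: bP|exact: bsuppZ].
  by rewrite sintZ// lerD2r sint_patch; exact: vM.
have J_le : sint (fun y => zeta y * V b y) - sint (fun y => zeta y * V a y) <=
    (b - a) * (n%:R * (c * (M + w * size K1))).
  apply: (@telescope_le _ (fun s => sint (fun y => zeta y * V s y)) a b _ (C * sint zeta)) => // s h h_0 as_ sb'.
  have sab : a <= s <= b by rewrite sb' andbT (le_trans as_)// gerBl ltW.
  rewrite -sintB//.
  apply: (@le_trans _ _ (sint (fun y => zeta y * (V s y - V (s - h) y)))).
    apply: sint_le; first exact: bsuppB.
      by apply: bsuppM => //; exact: bsuppB.
    by move=> y; rewrite mulrBr.
  (* kappa = 0: since f >= 0 on [K], the mollified function satisfies V_t <= Delta V exactly where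
     [zeta] is positive. *)
  apply: (le_trans (step _ 0 s h bzeta z0 h_0 _)) => [y zy|].
    apply: (weak_mollified mK iv mphi if_ wv).
      apply: UK => //; apply: K0U; apply: contrapT => /zK0 z; by rewrite z ltxx in zy.
    move=> p pe; rewrite oppr0; apply: f0; apply: UK pe => //.
    by apply: K0U; apply: contrapT => /zK0 z; rewrite z ltxx in zy.
  rewrite lerD2r ler_pM2l// mul0r addr0.
  apply: (@le_trans _ _ (\sum_(i < n) c * (M + w * size K1))); last first.
    by rewrite sumr_const card_ord [leRHS]mulr_natl.
  apply: ler_sum => i _.
  have h2 : 0 < eta / 2 by rewrite divr_gt0.
  apply: (le_trans (@laplacian_semiconcave _ _ _ _ _ mK bK iv sphi zz zeta U s i c (eta / 2) bzeta z0 (V0 s) c0 (zc i) bU h2 _)).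
    move=> h' y h'e Uy; apply: zK0 => K0y; apply: Uy; exists (y + h' *: delta_mx 0 i) => //.
    rewrite addrC addKr; apply: le_lt_trans h'e; rewrite normrZ ler_piMr//.
    by rewrite [leLHS]mx_normrE; apply: bigmax_le => // -[? ?] _; rewrite mxE; case: (_ && _); rewrite ?normr1 ?normr0.
  by rewrite ler_wpM2l// sU.
have Jb : sint (fun y => zeta y * P b y) <= sint (fun y => zeta y * V b y) + w * sint zeta.
  rewrite -sintZ// -sintD//; last exact: bsuppZ.
  apply: sint_le; [exact: bzP|by apply: bsuppD => //; exact: bsuppZ|move=> y].
  rewrite [w * _]mulrC -mulrDr; have [/K0U Uy|/zK0 ->] := pselect (K0 y); last by rewrite !mul0r.
  by apply: ler_wpM2l => //; case: (VU b y sb Uy).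
have Ja : sint (fun y => zeta y * V a y) <= sint (fun y => zeta y * P a y) + w * sint zeta.
  rewrite -sintZ// -sintD; [|exact: bzP|exact: bsuppZ].
  apply: sint_le; [by []|by apply: bsuppD; [exact: bzP|exact: bsuppZ]|move=> y].
  rewrite [w * _]mulrC -mulrDr; have [/K0U Uy|/zK0 ->] := pselect (K0 y); last by rewrite !mul0r.
  by apply: ler_wpM2l => //; case: (VU a y sa Uy).
have := chain_le J_le Jb Ja; move/le_trans; apply.
by rewrite le_eqVlt; apply/orP; left; apply/eqP; ring.
Qed.

End semiconcave_weight.
End evolution.

(** One enumeration of pairs serves all nonnegative double series, so that a doubly indexed family
    of functions can be read as a single covering sequence. *)
Lemma nneseries_pair (R : realType) : exists g : nat -> nat * nat,
  forall a : nat -> nat -> \bar R, (forall i j, (0 <= a i j)%E) ->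
  (\sum_(m <oo) a (g m).1 (g m).2 = \sum_(i <oo) \sum_(j <oo) a i j)%E.
Proof.
have /card_esym/ppcard_eqP[g] := card_nat2.
exists g => a a0.
rewrite nneseries_esumT; last by [].
rewrite [RHS]nneseries_esumT; last by move=> i; exact: nneseries_ge0.
under [RHS]eq_esum do rewrite nneseries_esumT//.
rewrite (@esum_esum R nat nat setT (fun=> setT) a)//.
rewrite (@reindex_esum R nat (nat * nat)%type setT _ g (fun k => a k.1 k.2))//.
have -> : [set: nat] `*`` (fun=> [set: nat]) = setT by apply/seteqP; split.
exact: 'bij_g.
Qed.

(** * Continuous functions of compact support *)

Section continuous_cpt_algebra.
Context (R : realType) (n : nat).
Local Notation space := 'rV[R]_n.
Variable W : set space.
Hypothesis oW : open W.
Implicit Types f g : space -> R.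
Local Notation Cc := (continuous_cpt W).

Lemma continuous_cptD f g : Cc f -> Cc g -> Cc (fun x => f x + g x).
Proof.
move=> [cf [A [cA AW fA]]] [cg [B [cB BW gB]]]; split.
  by move=> x; exact: (cvgD (cf x) (cg x)).
exists (A `|` B); split; first exact: compactU.
  by move=> x [/AW|/BW].
by move=> x /not_orP[/fA -> /gB ->]; rewrite addr0.
Qed.

Lemma continuous_cptMl f g : Cc f -> continuous g -> Cc (fun x => f x * g x).
Proof.
move=> [cf [A [cA AW fA]]] cg; split; first by move=> x; exact: (cvgM (cf x) (cg x)).
by exists A; split => // x /fA ->; rewrite mul0r.
Qed.

Lemma continuous_cptZ f (c : R) : Cc f -> Cc (fun x => c * f x).
Proof.
move=> /(@continuous_cptMl _ (cst c)) H; under eq_fun do rewrite mulrC.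
by apply: H; exact: cst_continuous.
Qed.

Lemma continuous_cptB f g : Cc f -> Cc g -> Cc (fun x => f x - g x).
Proof.
move=> Cf /(continuous_cptZ (-1))/(continuous_cptD Cf).
by under eq_fun do rewrite mulN1r.
Qed.

Lemma continuous_cpt0 : Cc (fun=> 0).
Proof. by split; [exact: cst_continuous|exists set0; split => //; exact: compact0]. Qed.

Lemma continuous_max0 f : continuous f -> continuous (fun x => Num.max (f x) 0).
Proof. by move=> cf x; apply: continuous_max; [exact: cf|exact: cst_continuous]. Qed.

Lemma continuous_min1 f (c : R) : continuous f -> continuous (fun x => Num.min (f x) c).
Proof. by move=> cf x; apply: continuous_min; [exact: cf|exact: cst_continuous]. Qed.

(** Half of the margin of [K] in [W] is spent on the neighbourhood and the other half on its
    closure. *)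
Lemma compact_thickening (K : set space) : compact K -> K `<=` W ->
  exists K1 (e : R), [/\ compact K1, K1 `<=` W, 0 < e &
    forall x y, K x -> `|x - y| < e -> K1 y].
Proof.
move=> cK KW; have [e e0 eW] := compact_open_margin cK oW KW.
pose G := [set y | exists2 x, K x & `|x - y| < e / 2].
have e20 : 0 < e / 2 by rewrite divr_gt0.
have Gnear y (r : R) : 0 < r -> closure G y -> exists2 x, K x & `|x - y| < e / 2 + r.
  move=> r0 /(_ _ (norm_nbhs y r0))[z [[x Kx xz] /= yz]]; exists x => //.
  by rewrite -(subrKA z) (le_lt_trans (ler_normD _ _))// (distrC z) ltrD.
exists (closure G), (e / 2); split => //.
- have [M _ KM] := compact_le_norm cK.
  apply: bounded_closed_compact; last exact: closed_closure.
  exists (M + (e / 2 + 1)); split; first exact: num_real.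
  move=> r Mr y /(Gnear _ 1 ltr01)[x /KM xM xy]; rewrite /= (le_trans _ (ltW Mr))//.
  by have := ler_normB x (x - y); rewrite subKr; lra.
- by move=> y /(Gnear _ (e / 2) e20)[x Kx]; rewrite -splitr; exact: eW.
- by move=> x y Kx xy; apply: subset_closure; exists x.
Qed.

(** Urysohn's lemma: [K] and the complement of its thickening are at positive distance, hence
    uniformly separated. *)
Lemma continuous_cpt_cutoff (K : set space) : compact K -> K `<=` W ->
  exists chi, [/\ Cc chi, (forall x, 0 <= chi x <= 1) & forall x, K x -> chi x = 1].
Proof.
move=> cK KW; have [K1 [e [cK1 K1W e0 KK1]]] := compact_thickening cK KW.
have : uniform_separator (~` K1) K.
  apply: uniform_separatorW; exists [set xy | ball xy.1 e xy.2].
    exact: (entourage_ball _ (PosNum e0)).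
  apply/seteqP; split => // -[x k] [[/= K1x Kk] xk]; apply: K1x; apply: (KK1 k) => //.
  by rewrite distrC; move: xk; rewrite -ball_normE.
move=> /(@uniform_separatorP _ R)[chi [cchi chi01 chi0 chi1]].
exists chi; split.
- split => //; exists K1; split => // y K1y.
  by apply: chi0; exists y.
- by move=> x; have := chi01 (chi x); rewrite /= in_itv/=; apply; exists x.
- by move=> x Kx; apply: chi1; exists x.
Qed.

End continuous_cpt_algebra.

(** * The Riesz representation theorem for positive functionals on C_c(W) *)

Section outer_measure_of_functional.
Context (R : realType) (n : nat).
Local Notation space := 'rV[R]_n.
Variables (W : set space) (L : (space -> R) -> R).
Hypothesis oW : open W.
Implicit Types f g : space -> R.
Local Notation Cc := (continuous_cpt W).
Hypothesis LD : forall f g, Cc f -> Cc g -> L (fun x => f x + g x) = L f + L g.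
Hypothesis LZ : forall c f, Cc f -> L (fun x => c * f x) = c * L f.
Hypothesis L0 : forall f, Cc f -> (forall x, 0 <= f x) -> 0 <= L f.

Let LB f g : Cc f -> Cc g -> L (fun x => f x - g x) = L f - L g.
Proof.
move=> Cf Cg; rewrite -mulN1r -LZ// -LD//; last exact: continuous_cptZ.
by congr L; apply/funext => x; rewrite mulN1r.
Qed.

Let L_le f g : Cc f -> Cc g -> (forall x, f x <= g x) -> L f <= L g.
Proof.
move=> Cf Cg fg; rewrite -subr_ge0 -LB//; apply: L0; first exact: continuous_cptB.
by move=> x; rewrite subr_ge0.
Qed.

Let L_zero : L (fun=> 0) = 0.
Proof.
have := LZ 0 (continuous_cpt0 W); rewrite [RHS]mul0r => {2}<-.
by congr L; apply/funext => x; rewrite mul0r.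
Qed.

Let L_sum (g : nat -> space -> R) m : (forall k, Cc (g k)) ->
  Cc (fun x => \sum_(k < m) g k x) /\ L (fun x => \sum_(k < m) g k x) = \sum_(k < m) L (g k).
Proof.
move=> Cg; elim: m => [|m [C e]].
  under eq_fun do rewrite big_ord0; rewrite big_ord0.
  by split; [exact: continuous_cpt0|exact: L_zero].
under eq_fun do rewrite big_ord_recr/=; rewrite big_ord_recr/= -e -LD//.
by split => //; exact: continuous_cptD.
Qed.

(* Dini's argument. *)
Let L_series_le f (g : nat -> space -> R) : Cc f -> (forall k, Cc (g k)) ->
  (forall k x, 0 <= g k x) ->
  (forall x, W x -> ((f x)%:E <= \sum_(k <oo) (g k x)%:E)%E) ->
  ((L f)%:E <= \sum_(k <oo) (L (g k))%:E)%E.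
Proof.
move=> Cf Cg g0 fg; have [cf [K [cK KW fK]]] := Cf.
have [chi [Cchi chi01 chi1]] := continuous_cpt_cutoff oW cK KW.
have chi_ge0 x : 0 <= chi x by case/andP: (chi01 x).
have Lchi : 0 <= L chi by exact: L0.
suff H w : 0 < w -> ((L f)%:E <= \sum_(k <oo) (L (g k))%:E + (w * L chi)%:E)%E.
  apply/lee_addgt0Pr => e e0; have D0 : 0 < L chi + 1 by rewrite ltr_wpDl.
  apply: (le_trans (H (e / (L chi + 1)) _)); first by rewrite divr_gt0.
  rewrite leeD2l// lee_fin mulrAC ler_pdivrMr// ler_wpM2l ?(ltW e0)// lerDl//.
move=> w0.
(* On the compact [K] a single partial sum exceeds f - w; the loss w is then paid by w chi, as chi =
   1 on [K]. *)
have [m Hm] : exists m, forall x, K x -> f x - w <= \sum_(k < m) g k x.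
  have /compact_near_coveringP ncK := cK.
  have := ncK nat \oo (fun m x => f x - w <= \sum_(k < m) g k x) _ _ => /(_ _).
  case.
  - move=> x Kx.
    have [m Hm] : exists m, f x - w / 2 < \sum_(k < m) g k x.
      apply: contrapT => H; have := fg x (KW x Kx).
      apply/negP; rewrite -ltNge; apply: (@le_lt_trans _ _ (f x - w / 2)%:E); last first.
        by rewrite lte_fin; lra.
      apply: lime_le; first by apply: is_cvg_nneseries => k _ _; rewrite lee_fin.
      apply: nearW => m; rewrite sumEFin lee_fin big_mkord leNgt; apply/negP => Hm.
      by apply: H; exists m.
    have [Cs _] := L_sum m Cg; have [cs _] := Cs.
    have c1 : {for x, continuous (fun y => \sum_(k < m) g k y - f y)}.
      by apply: (cvgB (cs x) (cf x)).
    have w2 : 0 < w / 2 by rewrite divr_gt0.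
    have /cvgrPdist_lt/(_ _ w2) nx := c1.
    exists ([set y | `|\sum_(k < m) g k x - f x - (\sum_(k < m) g k y - f y)| < w / 2], [set i | (m <= i)%N]).
      by split; [exact: nx|exists m].
    move=> [y i] /= [/ltr_normlW H mi].
    apply: (@le_trans _ _ (\sum_(k < m) g k y)); first by lra.
    rewrite -!(big_mkord xpredT (fun k => g k y)) [leRHS](big_cat_nat (leq0n m) mi)/= lerDl.
    by apply: sumr_ge0.
  - by move=> m _ Hm; exists m => x Kx; apply: (Hm m) => //=.
have [Cs Ls] := L_sum m Cg.
apply: (@le_trans _ _ ((\sum_(k < m) L (g k)) + w * L chi)%:E).
  rewrite lee_fin -Ls -LZ// -LD//; last exact: continuous_cptZ.
  apply: L_le => //; first by apply: continuous_cptD => //; exact: continuous_cptZ.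
  move=> x; have [Kx|Kx] := pselect (K x).
    by rewrite chi1// mulr1 -lerBlDr Hm.
  by rewrite fK// addr_ge0// ?mulr_ge0 ?sumr_ge0// ltW.
rewrite EFinD leeD2r// -sumEFin.
rewrite -(big_mkord xpredT (fun k => (L (g k))%:E)).
by apply: nneseries_lim_ge => k _ _; rewrite lee_fin; exact: L0.
Qed.

(** A Daniell-type construction: sets are covered by nonnegative functions of C_c(W) instead of open
    sets, at the cost of the sum of their values by [L]. The condition bears on [W] only, so the
    complement of [W] costs nothing. *)
Definition covering (A : set space) (f : nat -> space -> R) :=
  [/\ forall k, Cc (f k), forall k x, 0 <= f k x &
      forall x, A x -> W x -> (1 <= \sum_(k <oo) (f k x)%:E)%E].

Definition outer_of_functional (A : set space) : \bar R :=
  ereal_inf [set (\sum_(k <oo) (L (f k))%:E)%E | f in covering A].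

Local Notation ostar := outer_of_functional.

Let L_cover_ge0 A (f : nat -> space -> R) : covering A f -> forall k, (0 <= (L (f k))%:E)%E.
Proof. by move=> [Cf f0 _] k; rewrite lee_fin; exact: L0. Qed.

Let ostar_le A (f : nat -> space -> R) : covering A f -> (ostar A <= \sum_(k <oo) (L (f k))%:E)%E.
Proof. by move=> cf; apply: ereal_inf_lbound; exists f. Qed.

Let ostar_le2 A (g : nat -> nat -> space -> R) : (forall i j, Cc (g i j)) ->
  (forall i j x, 0 <= g i j x) ->
  (forall x, A x -> W x -> (1 <= \sum_(i <oo) \sum_(j <oo) (g i j x)%:E)%E) ->
  (ostar A <= \sum_(i <oo) \sum_(j <oo) (L (g i j))%:E)%E.
Proof.
move=> Cg g0 g1; have [e eE] := nneseries_pair R.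
rewrite -eE; last by move=> i j; rewrite lee_fin; exact: L0.
apply: (@ostar_le A (fun m => g (e m).1 (e m).2)); split => // x Ax Wx.
rewrite (eE (fun i j => (g i j x)%:E)); last by move=> i j; rewrite lee_fin.
exact: g1.
Qed.

Let ostar_ge0 A : (0 <= ostar A)%E.
Proof.
apply: le_ereal_inf_tmp => _ [f cf <-]; apply: nneseries_ge0 => k _ _; exact: L_cover_ge0 cf k.
Qed.

Let ostar0 : ostar set0 = 0%E.
Proof.
apply/eqP; rewrite eq_le ostar_ge0 andbT.
apply: (le_trans (@ostar_le set0 (fun _ _ => 0) _)); last by rewrite L_zero eseries0.
by split => //; move=> k; exact: continuous_cpt0.
Qed.

Let ostar_mono A B : A `<=` B -> (ostar A <= ostar B)%E.
Proof.
move=> AB; apply: le_ereal_inf_tmp => _ [f [Cf f0 f1] <-]; apply: ostar_le; split => // x /AB; exact: f1.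
Qed.

Let ostar_adherent A (e : R) : (ostar A < +oo)%E -> 0 < e ->
  exists2 f : nat -> space -> R, covering A f & (\sum_(k <oo) (L (f k))%:E <= ostar A + e%:E)%E.
Proof.
move=> Aoo e0; have fA : ostar A \is a fin_num by rewrite ge0_fin_numE.
have [_ [f cf <-] /ltW fe] := lb_ereal_inf_adherent e0 fA.
by exists f.
Qed.

Let ostar_sigma_subadditive : sigma_subadditive ostar.
Proof.
move=> A; have [[i ioo]|] := pselect (exists i, ostar (A i) = +oo%E).
  rewrite (eseries_pinfty _ _ ioo) ?leey// => k _.
  by rewrite -ltNye (lt_le_trans _ (ostar_ge0 _)).
rewrite -forallNE => Aoo.
apply/lee_addgt0Pr => e e0.
apply: (le_trans _ (epsilon_trick _ _ (ltW e0))); last by move=> k; exact: ostar_ge0.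
have ek0 k : 0 < e / (2 ^ k.+1)%:R by rewrite divr_gt0// ltr0n expn_gt0.
have /choice[f Hf] : forall k, exists f : nat -> space -> R, covering (A k) f /\
    (\sum_(j <oo) (L (f j))%:E <= ostar (A k) + (e / (2 ^ k.+1)%:R)%:E)%E.
  move=> k; have Akoo : (ostar (A k) < +oo)%E by rewrite ltey; exact/eqP.
  by have [f cf fe] := ostar_adherent Akoo (ek0 k); exists f.
apply: (@le_trans _ _ (\sum_(i <oo) \sum_(j <oo) (L (f i j))%:E)%E).
  apply: ostar_le2 => [i j|i j x|x [i _ Aix] Wx].
  - by have [[]] := Hf i.
  - by have [[]] := Hf i.
  - have [[_ f0 f1] _] := Hf i; apply: (le_trans (f1 x Aix Wx)).
    have pos k : (0 <= \sum_(j <oo) (f k j x)%:E)%E.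
      by apply: nneseries_ge0 => j _ _; rewrite lee_fin; have [[_ + _] _] := Hf k.
    rewrite [leRHS](@nneseriesD1 _ _ i predT)//= leeDl//.
    by apply: nneseries_ge0 => k _ _.
apply: lee_nneseries => [k _ _|k _]; last by have [_] := Hf k.
by apply: nneseries_ge0 => j _ _; have [cf _] := Hf k; exact: L_cover_ge0 cf j.
Qed.

Let om : {outer_measure set space -> \bar R} :=
  HB.pack ostar (isOuterMeasure.Build R space ostar ostar0 ostar_ge0 ostar_mono ostar_sigma_subadditive).

(* The cutoffs [phi k] increase to the indicator of [h > 0]; splitting every
   function of a covering of [X] along them covers the two halves of [X]. *)
Let positive_caratheodory (h : space -> R) : continuous h -> om.-caratheodory [set x | 0 < h x].
Proof.
move=> ch; apply: le_caratheodory_measurable => X.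
have [Xoo|] := ltP (ostar X) +oo%E; last by rewrite leye_eq => /eqP Xoo; rewrite [leRHS]Xoo leey.
apply/lee_addgt0Pr => e e0; rewrite /=.
pose phi (k : nat) x := Num.min (k%:R * Num.max (h x) 0) 1.
have phi0 x : phi 0%N x = 0 by rewrite /phi mul0r min_l.
have phi_ge0 k x : 0 <= phi k x by rewrite le_min ler01 mulr_ge0// le_max lexx orbT.
have phi_le1 k x : phi k x <= 1 by rewrite ge_min lexx orbT.
have cphi k : continuous (phi k).
  apply: continuous_min1 => x.
  have cm : continuous (fun x => Num.max (h x) 0) by exact: continuous_max0.
  have ck : continuous (fun _ : space => k%:R : R) by move=> y; exact: cst_continuous.
  exact: (cvgM (ck x) (cm x)).
have dphi k x : 0 <= phi k.+1 x - phi k x.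
  rewrite subr_ge0 le_min phi_le1 andbT ge_min; apply/orP; left.
  by rewrite ler_wpM2r ?ler_nat// le_max lexx orbT.
have phi1 x : 0 < h x -> exists k, phi k x = 1.
  move=> hx; exists (Num.truncn (h x)^-1).+1; rewrite /phi (max_l (ltW hx)) min_r//.
  by rewrite -ler_pdivrMr// div1r ltW// truncnS_gt.
have phiN k x : ~ 0 < h x -> phi k x = 0.
  by move=> /negP; rewrite -leNgt => hx; rewrite /phi (max_r hx) mulr0 min_l.
have [f [Cf f0 f1] fe] := ostar_adherent Xoo (divr_gt0 e0 (ltr0n R 2)).
(* The sums of [g i] over k telescope and reach [f i] on {h > 0}, where some [phi k] equals 1; so
   the double family covers that half of [X], whereas a single product of [f i] with one cutoff may
   not. *)
pose g i k x := f i x * (phi k.+1 x - phi k x).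
have Cg i k : Cc (g i k).
  by apply: continuous_cptMl => // x; exact: (cvgB (cphi _ x) (cphi _ x)).
have g0 i k x : 0 <= g i k x by rewrite mulr_ge0.
have sum_g i m x : \sum_(0 <= k < m) g i k x = f i x * phi m x.
  by rewrite -mulr_sumr telescope_sumr// phi0 subr0.
have Cfphi i m : Cc (fun x => f i x * phi m x) by exact: continuous_cptMl.
have sum_Lg i m : \sum_(0 <= k < m) L (g i k) = L (fun x => f i x * phi m x).
  rewrite big_mkord; have [_ <-] := L_sum m (Cg i); congr L; apply/funext => x.
  by rewrite -sum_g big_mkord.
have Lfphi i m : L (fun x => f i x * phi m x) <= L (f i).
  by apply: L_le => // x; rewrite ler_piMr.
pose S i := (\sum_(k <oo) (L (g i k))%:E)%E.
have Lg0 i k : (0 <= (L (g i k))%:E)%E by rewrite lee_fin; exact: L0.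
have S_le i : (S i <= (L (f i))%:E)%E.
  apply: lime_le; first exact: is_cvg_nneseries.
  by apply: nearW => m; rewrite sumEFin sum_Lg lee_fin.
have S0 i : (0 <= S i)%E by apply: nneseries_ge0.
have Sfin i : S i \is a fin_num by rewrite ge0_fin_numE// (le_lt_trans (S_le i))// ltry.
(* For each i a finite level already carries all but a geometrically small part of the cost of the
   i-th series. *)
have /choice[m Hm] : forall i, exists m,
    (S i <= (L (fun x => f i x * phi m x) + e / 2 / (2 ^ i.+1)%:R)%:E)%E.
  move=> i; have e2 : 0 < e / 2 / (2 ^ i.+1)%:R by rewrite !divr_gt0// ltr0n expn_gt0.
  apply: contrapT => H.
  have : (S i <= S i - (e / 2 / (2 ^ i.+1)%:R)%:E)%E.
    apply: lime_le; first exact: is_cvg_nneseries.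
    apply: nearW => k; rewrite sumEFin sum_Lg leeBrDr// -EFinD ltW// ltNge.
    by apply/negP => Hk; apply: H; exists k.
  by rewrite leNgt lteBlDr// lteDl// lte_fin e2.
have part1 : (ostar (X `&` [set x | (0 < h x)%R]) <= \sum_(i <oo) S i)%E.
  apply: ostar_le2 => // x [Xx /= hx] Wx; apply: (le_trans (f1 x Xx Wx)).
  apply: lee_nneseries => [i _ _|i _]; first by rewrite lee_fin.
  have [k pk] := phi1 x hx.
  apply: (@le_trans _ _ (\sum_(0 <= j < k) (g i j x)%:E)%E).
    by rewrite sumEFin sum_g pk mulr1.
  by apply: nneseries_lim_ge => j _ _; rewrite lee_fin.
(* Where h <= 0 all cutoffs vanish, so [b i] equals [f i] and still covers; its cost is what the
   level [m i] leaves of the cost of [f i]. *)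
pose b i x := f i x - f i x * phi (m i) x.
have Cb i : Cc (b i) by exact: continuous_cptB.
have b0 i x : 0 <= b i x by rewrite subr_ge0 ler_piMr.
have Lb i : L (b i) = L (f i) - L (fun x => f i x * phi (m i) x) by rewrite -LB.
have part2 : (ostar (X `&` ~` [set x | (0 < h x)%R]) <= \sum_(i <oo) (L (b i))%:E)%E.
  apply: ostar_le; split => // x [Xx /= hx] Wx; apply: (le_trans (f1 x Xx Wx)).
  apply: lee_nneseries => [i _ _|i _]; first by rewrite lee_fin.
  by rewrite /b phiN// mulr0 subr0.
have Lb0 i : (0 <= (L (b i))%:E)%E by rewrite lee_fin; exact: L0.
apply: (le_trans (leeD part1 part2)).
rewrite -nneseriesD//.
apply: (@le_trans _ _ (\sum_(i <oo) ((L (f i))%:E + (e / 2 / (2 ^ i.+1)%:R)%:E))%E).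
  apply: lee_nneseries => [i _ _|i _]; first by rewrite adde_ge0.
  rewrite Lb -(fineK (Sfin i)) -!EFinD lee_fin.
  by have := Hm i; rewrite -(fineK (Sfin i)) lee_fin; lra.
apply: (le_trans (epsilon_trick _ _ _)).
- by move=> i; rewrite lee_fin; exact: L0.
- by rewrite divr_ge0// ltW.
apply: (le_trans (leeD2r _ fe)); rewrite -addeA -EFinD leeD2l// lee_fin; lra.
Qed.

(** The half-spaces x_i > c have the form {h > 0} with h continuous, and measurability of the
    identity into the Borel sets can be checked coordinatewise. *)
Let borel_caratheodory (A : set space) : measurable A -> om.-caratheodory A.
Proof.
move=> mA.
have mid : measurable_fun setT (id : caratheodory_type om -> space).
  apply: measurable_fun_rV => i.
  apply: (measurability _ (RGenOInfty.measurableE R)) => _ [_ [c ->] <-].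
  rewrite setTI (_ : _ @^-1` _ = [set x : space | 0 < x 0 i - c]).
    apply: positive_caratheodory => x.
    have c1 : continuous (fun x : space => x 0 i) by move=> y; exact: coord_continuous.
    have c2 : continuous (fun _ : space => c) by move=> y; exact: cst_continuous.
    exact: (cvgB (c1 x) (c2 x)).
  by apply/seteqP; split => x /=; rewrite in_itv/= andbT subr_gt0.
have := mid measurableT A mA; rewrite setTI; exact.
Qed.

Let ostar_semi_sigma_additive : semi_sigma_additive (ostar : set space -> \bar R).
Proof.
move=> A mA tA mUA.
have := @caratheodory_measure_sigma_additive R _ om A.
by apply => // [k|]; exact: borel_caratheodory.
Qed.

Let mu : {measure set space -> \bar R} :=
  HB.pack (ostar : set space -> \bar R) (isMeasure.Build _ space R ostar ostar0 ostar_ge0 ostar_semi_sigma_additive).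

(** The single function F / c, padded with zeros, is a covering of [A]. *)
Let measure_le (A : set space) F (c : R) : 0 < c -> Cc F -> (forall x, 0 <= F x) ->
  (forall x, A x -> W x -> c <= F x) -> (c%:E * ostar A <= (L F)%:E)%E.
Proof.
move=> c0 CF F0 AF; pose f (k : nat) : space -> R := if k is 0%N then fun x => c^-1 * F x else fun=> 0.
have Cf k : Cc (f k) by case: k => [|k]; [exact: continuous_cptZ|exact: continuous_cpt0].
have f0 k x : 0 <= f k x by case: k => [|k]//=; rewrite mulr_ge0// invr_ge0 ltW.
have sumf (G : (space -> R) -> R) : (forall k, 0 <= G (f k)) -> G (fun=> 0) = 0 ->
    (\sum_(k <oo) (G (f k))%:E = (G (f 0%N))%:E)%E.
  move=> G0 Gz; rewrite nneseries_recl//; last by move=> k _; rewrite lee_fin.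
  by rewrite eseries_cond/= eseries0 ?adde0// => -[|k]//= _ _; rewrite Gz.
have cov : covering A f.
  split => // x Ax Wx; rewrite (sumf (fun h => h x))// lee_fin /=.
  by rewrite ler_pdivlMl// mulr1; exact: AF.
have := ostar_le cov; rewrite (sumf L)//=; last by move=> k; exact: L0.
by rewrite LZ// -(@lee_pmul2l _ c%:E)// -EFinM mulrA divff ?mul1r ?gt_eqF.
Qed.

(** F / c is at most 1 on [A] and nonpositive elsewhere, so the sum of any covering of [A] dominates
    it on [W], and Dini's argument bounds its image by the cost. *)
Let le_measure_fun (A : set space) F (c : R) : 0 < c -> Cc F ->
  (forall x, A x -> F x <= c) -> (forall x, ~ A x -> F x <= 0) ->
  ((L F)%:E <= c%:E * ostar A)%E.
Proof.
move=> c0 CF Fc F0.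
rewrite -(@lee_pmul2l _ c^-1%:E) ?lte_fin ?invr_gt0// muleA -!EFinM mulVf ?gt_eqF// mul1e.
apply: le_ereal_inf_tmp => _ [f [Cf f0 f1] <-]; rewrite -LZ//.
apply: L_series_le => // [|x Wx]; first exact: continuous_cptZ.
have [Ax|Ax] := pselect (A x).
  apply: (le_trans _ (f1 x Ax Wx)); rewrite lee_fin ler_pdivrMl// mulr1; exact: Fc.
apply: (@le_trans _ _ 0%E); first by rewrite lee_fin pmulr_rle0 ?invr_gt0//; exact: F0.
by apply: nneseries_ge0 => k _ _; rewrite lee_fin.
Qed.

Let compact_measure_lt_pinfty (K : set space) : compact K -> K `<=` W -> (ostar K < +oo)%E.
Proof.
move=> cK KW; have [chi [Cchi chi01 chi1]] := continuous_cpt_cutoff oW cK KW.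
rewrite -[ostar K]mul1e; apply: (@le_lt_trans _ _ (L chi)%:E); last exact: ltry.
apply: measure_le => // [x|x Kx _]; first by case/andP: (chi01 x).
by rewrite chi1.
Qed.

Let min_cpt f (c : R) : 0 <= c -> Cc f -> Cc (fun x => Num.min (f x) c).
Proof.
move=> c0 [cf [K [cK KW fK]]]; split; first exact: continuous_min1.
by exists K; split => // x /fK ->; rewrite min_l.
Qed.

(* Layer cake: the [k]-th layer of [f] is [d] on [f >= (k + 1) d] and vanishes
   off [f > k d], so that both its integral and its image by [L] are comparable
   with the measures of these sets. *)
Let representation_ge0 f : Cc f -> (forall x, 0 <= f x) -> (\int[mu]_x (f x)%:E = (L f)%:E)%E.
Proof.
move=> Cf f0; have [cf [K [cK KW fK]]] := Cf.
have [chi [Cchi chi01 chi1]] := continuous_cpt_cutoff oW cK KW.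
have chi_ge0 x : 0 <= chi x by case/andP: (chi01 x).
have Lchi : 0 <= L chi by exact: L0.
have [M M0 fM] : exists2 M, 0 < M & forall x, f x <= M.
  have [M M0 KM] := compact_bounded_fun cK (continuous_subspaceT cf).
  exists M => // x; have [/KM|/fK ->] := pselect (K x); last exact: ltW.
  by apply: le_trans; exact: ler_norm.
have mint (c : R) : 0 <= c -> measurable_fun setT (EFin \o (fun x => Num.min (f x) c)).
  move=> c0; apply/measurable_EFinP; apply: continuous_measurable_rV; exact: continuous_min1.
pose lay (d : R) (k : nat) x := Num.min (f x) (k.+1%:R * d) - Num.min (f x) (k%:R * d).
have Clay d k : 0 <= d -> Cc (lay d k).
  by move=> d0; apply: continuous_cptB; apply: min_cpt => //; rewrite mulr_ge0.
have lay0 d k x : 0 <= d -> 0 <= lay d k x.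
  move=> d0; rewrite subr_ge0 le_min ge_min lexx/= ge_min; apply/orP; right.
  by rewrite ler_wpM2r// ler_nat.
have layd d k x : 0 <= d -> lay d k x <= d.
  move=> d0; rewrite /lay -natr1 mulrDl mul1r.
  by rewrite /Num.min; case: ifPn; case: ifPn; rewrite -?leNgt; lra.
have layE d k x : 0 <= d -> k.+1%:R * d <= f x -> lay d k x = d.
  move=> d0 kf; rewrite /lay !min_r//; first by rewrite -natr1; ring.
  by rewrite (le_trans _ kf)// ler_wpM2r// ler_nat.
have layN d k x : 0 <= d -> f x <= k%:R * d -> lay d k x = 0.
  move=> d0 fk; rewrite /lay !min_l ?subrr// (le_trans fk)//.
  by rewrite ler_wpM2r// ler_nat.
have sum_lay d m x : \sum_(k < m) lay d k x = Num.min (f x) (m%:R * d).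
  rewrite -(big_mkord xpredT (fun k => lay d k x)) telescope_sumr//.
  by rewrite mul0r [X in _ - X]min_r// subr0.
have mlay d k : 0 <= d -> measurable_fun setT (EFin \o lay d k).
  by move=> d0; apply/measurable_EFinP; apply: continuous_measurable_rV; have [] := Clay d k d0.
have sum_int d m : 0 <= d -> (\sum_(k < m) \int[mu]_x (lay d k x)%:E =
    \int[mu]_x (Num.min (f x) (m%:R * d))%:E)%E.
  move=> d0; rewrite -ge0_integral_sum//.
  - by apply: eq_integral => x _; rewrite sumEFin sum_lay.
  - by move=> k; exact: mlay.
  - by move=> k x _; rewrite lee_fin lay0.
have sum_L d m : 0 <= d -> \sum_(k < m) L (lay d k) = L (fun x => Num.min (f x) (m%:R * d)).
  move=> d0; have [_ <-] := L_sum m (fun k => Clay d k d0); congr L; apply/funext => x.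
  exact: sum_lay.
have mset (c : R) : measurable [set x | c <= f x] /\ measurable [set x | c < f x].
  have mf : measurable_fun setT f by exact: continuous_measurable_rV.
  split.
    rewrite (_ : [set x | _] = setT `&` f @^-1` `[c, +oo[%classic); first exact: mf.
    by apply/seteqP; split => x /=; rewrite in_itv/= andbT; [|case].
  rewrite (_ : [set x | _] = setT `&` f @^-1` `]c, +oo[%classic); first exact: mf.
  by apply/seteqP; split => x /=; rewrite in_itv/= andbT; [|case].
have int_ind (c : R) (A : set space) : 0 <= c -> measurable A ->
    (\int[mu]_x (c * \1_A x)%:E = c%:E * ostar A)%E.
  move=> c0 mA; under eq_integral do rewrite EFinM.
  rewrite ge0_integralZl//; last by exact/measurable_EFinP/measurable_indic.
  by rewrite integral_indic// setIT.
have mind (c : R) (A : set space) : measurable A -> measurable_fun setT (EFin \o (fun x => c * \1_A x)).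
  by move=> mA; apply/measurable_EFinP; apply: measurable_funM => //; exact: measurable_indic.
(* Layer k + 1 vanishes unless f > (k + 1) d, whereas layer k equals d as soon as f >= (k + 1) d:
   shifting the index by one makes them comparable through the measure of that set. *)
have lower d k : 0 < d -> ((L (lay d k.+1))%:E <= \int[mu]_x (lay d k x)%:E)%E.
  move=> d0; have d0' := ltW d0; have [mA _] := mset (k.+1%:R * d).
  apply: (@le_trans _ _ (d%:E * ostar [set x | (k.+1%:R * d <= f x)%R])%E).
    apply: le_measure_fun => // [|x _|x /= /negP]; [exact: Clay|exact: layd|].
    by rewrite -ltNge => /ltW fx; rewrite layN.
  rewrite -int_ind//; apply: ge0_le_integral => //.
  - by move=> x _; rewrite lee_fin mulr_ge0.
  - exact: mind.
  - exact: mlay.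
  - move=> x _; rewrite lee_fin indicE; case: (boolP (_ \in _)) => [|_]; last by rewrite mulr0 lay0.
    by rewrite inE/= => fx; rewrite mulr1 layE.
have upper d k : 0 < d -> (\int[mu]_x (lay d k.+1 x)%:E <= (L (lay d k))%:E)%E.
  move=> d0; have d0' := ltW d0; have [_ mA] := mset (k.+1%:R * d).
  apply: (@le_trans _ _ (d%:E * ostar [set x | (k.+1%:R * d < f x)%R])%E).
    rewrite -int_ind//; apply: ge0_le_integral => //.
    - by move=> x _; rewrite lee_fin lay0.
    - exact: mlay.
    - exact: mind.
    - move=> x _; rewrite lee_fin indicE; case: (boolP (_ \in _)) => [_|]; first by rewrite mulr1 layd.
      by rewrite notin_setE/= => /negP; rewrite -leNgt => fx; rewrite mulr0 layN.
  apply: measure_le => // [|x|x /ltW fx _]; [exact: Clay|exact: lay0|by rewrite layE].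
(* The shift of the index leaves out only the bottom layer, which is at most d chi and hence
   negligible for small d. *)
have L_lay0 d : 0 < d -> L (lay d 0%N) <= d * L chi.
  move=> d0; have d0' := ltW d0; rewrite -LZ//; apply: L_le => [||x]; [exact: Clay|exact: continuous_cptZ|].
  have [Kx|Kx] := pselect (K x); first by rewrite chi1// mulr1 layd.
  by rewrite layN ?mulr_ge0// mul0r fK.
have int_lay0 d : 0 < d -> (\int[mu]_x (lay d 0%N x)%:E <= (d * L chi)%:E)%E.
  move=> d0; have d0' := ltW d0; have [_ mA] := mset 0.
  apply: (@le_trans _ _ (d%:E * ostar [set x | (0 < f x)%R])%E).
    rewrite -int_ind//; apply: ge0_le_integral => //.
    - by move=> x _; rewrite lee_fin lay0.
    - exact: mlay.
    - exact: mind.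
    - move=> x _; rewrite lee_fin indicE; case: (boolP (_ \in _)) => [_|]; first by rewrite mulr1 layd.
      by rewrite notin_setE/= => /negP; rewrite -leNgt => fx; rewrite mulr0 layN// mul0r.
  rewrite EFinM lee_pmul2l//; rewrite -[leLHS]mul1e; apply: measure_le => // x /= fx _.
  by rewrite chi1//; apply: contrapT => /fK fx0; rewrite fx0 ltxx in fx.
(* With d = M / (m + 1), exactly m + 1 layers reach the upper bound M of [f]. *)
have split_m (m : nat) : exists2 d, 0 < d <= M / m.+1%:R & forall x, Num.min (f x) (m.+1%:R * d) = f x.
  exists (M / m.+1%:R); first by rewrite lexx andbT divr_gt0.
  by move=> x; rewrite min_l// mulrC divfK// gt_eqF.
have minL d m : 0 < d -> L (fun x => Num.min (f x) (m%:R * d)) <= L f.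
  move=> d0; apply: L_le => // [|x]; last by rewrite ge_min lexx.
  by apply: min_cpt => //; rewrite mulr_ge0// ltW.
have minI d m : 0 < d -> (\int[mu]_x (Num.min (f x) (m%:R * d))%:E <= \int[mu]_x (f x)%:E)%E.
  move=> d0; apply: ge0_le_integral => //.
  - by move=> x _; rewrite lee_fin le_min f0 mulr_ge0// ltW.
  - by apply: mint; rewrite mulr_ge0// ltW.
  - by apply/measurable_EFinP; exact: continuous_measurable_rV.
  - by move=> x _; rewrite lee_fin ge_min lexx.
have small e : 0 < e -> exists m : nat, M / m.+1%:R * L chi <= e.
  move=> e0; exists (Num.truncn (M * L chi / e)).
  rewrite mulrAC ler_pdivrMr// [e * _]mulrC -ler_pdivrMr// ltW//; exact: truncnS_gt.
apply/eqP; rewrite eq_le; apply/andP; split; apply/lee_addgt0Pr => e /small[m me];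
  have [d /andP[d0 dM] fd] := split_m m; have d0' := ltW d0;
  have dchi : d * L chi <= e by rewrite (le_trans _ me)// ler_wpM2r.
- rewrite (_ : (\int[mu]_x (f x)%:E = \sum_(k < m.+1) \int[mu]_x (lay d k x)%:E)%E); last first.
    by rewrite sum_int//; apply: eq_integral => x _; rewrite fd.
  rewrite big_ord_recl/= addeC; apply: leeD; last by rewrite (le_trans (int_lay0 d d0))// lee_fin.
  apply: (@le_trans _ _ (\sum_(k < m) (L (lay d k))%:E)%E); first by apply: lee_sum => k _; exact: upper.
  by rewrite sumEFin lee_fin sum_L// minL.
- rewrite (_ : L f = \sum_(k < m.+1) L (lay d k)); last first.
    by rewrite sum_L//; congr L; apply/funext => x; rewrite fd.
  rewrite big_ord_recl/= addrC EFinD; apply: leeD; last first.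
    by rewrite lee_fin (le_trans (L_lay0 d d0)).
  rewrite -sumEFin; apply: (@le_trans _ _ (\sum_(k < m) \int[mu]_x (lay d k x)%:E)%E).
    by apply: lee_sum => k _; exact: lower.
  by rewrite sum_int// minI.
Qed.

(** Take a nearly optimal covering of [E]. The points of [W] where some partial sum exceeds 1 / (1 +
    t) form an open set containing [E], and the covering scaled by 1 + t covers it. *)
Let outer_open (E : set space) (e : R) : (ostar E < +oo)%E -> E `<=` W -> 0 < e ->
  exists O, [/\ open O, E `<=` O, O `<=` W & (ostar O <= ostar E + e%:E)%E].
Proof.
move=> Eoo EW e0; have fE : ostar E \is a fin_num by rewrite ge0_fin_numE.
set a := fine (ostar E); have a0 : 0 <= a by exact: fine_ge0.
(* The scaled cost is at most (1 + t)(a + t) = a + t (a + 1 + t), hence at most a + e, since t <= 1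
   and t (a + 2) <= e. *)
pose t := Num.min 1 (e / (a + 2)).
have t0 : 0 < t by rewrite lt_min ltr01 divr_gt0// ltr_wpDl.
have t1 : t <= 1 by rewrite ge_min lexx.
have ta : t * (a + 2) <= e by rewrite -ler_pdivlMr ?ltr_wpDl// ge_min lexx orbT.
have t1_gt0 : 0 < 1 + t by rewrite addr_gt0.
have [f [Cf f0 f1] fe] := ostar_adherent Eoo t0.
pose r := (1 + t)^-1.
pose O := \bigcup_m (W `&` [set x | r < \sum_(k < m) f k x]).
have OW : O `<=` W by move=> x [m _ []].
exists O; split => //.
- apply: bigcup_open => m _; apply: openI => //.
  have [[cs _] _] := L_sum m Cf.
  rewrite (_ : [set x | _] = (fun x => \sum_(k < m) f k x) @^-1` `]r, +oo[%classic).
    by apply: open_comp => [x _|]; [exact: cs|exact: interval_open].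
  by apply/seteqP; split => x /=; rewrite in_itv/= andbT.
- move=> x Ex; have Wx := EW x Ex; apply: contrapT => H.
  have : (1 <= r%:E)%E.
    apply: (le_trans (f1 x Ex Wx)); apply: lime_le.
      by apply: is_cvg_nneseries => k _ _; rewrite lee_fin.
    apply: nearW => m; rewrite sumEFin lee_fin big_mkord leNgt; apply/negP => Hm.
    by apply: H; exists m.
  by rewrite lee_fin /r invf_ge1// gerDl leNgt t0.
- have cov : covering O (fun k x => (1 + t) * f k x).
    split => [k|k x|x [m _ [_ /= rx]] _]; first exact: continuous_cptZ.
      by rewrite mulr_ge0// ltW.
    apply: (@le_trans _ _ (\sum_(0 <= k < m) ((1 + t) * f k x)%:E)%E).
      by rewrite sumEFin lee_fin -mulr_sumr big_mkord -ler_pdivrMl// mulr1 ltW.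
    by apply: nneseries_lim_ge => k _ _; rewrite lee_fin mulr_ge0// ltW.
  apply: (le_trans (ostar_le cov)).
  under eq_eseriesr do rewrite LZ// EFinM.
  rewrite nneseriesZl; last by move=> k _; rewrite lee_fin; exact: L0.
  apply: (@le_trans _ _ ((1 + t)%:E * (ostar E + t%:E))%E).
    by rewrite lee_pmul2l// lte_fin.
  rewrite -(fineK fE) -/a -!EFinD -EFinM lee_fin.
  rewrite (_ : (1 + t) * (a + t) = a + t * (a + 1 + t)); last by ring.
  by rewrite lerD2l (le_trans _ ta)// ler_wpM2l ?(ltW t0)//; lra.
Qed.

Let exhaustion (j : nat) : set space :=
  [set x | `|x| <= j%:R /\ forall y, `|x - y| < j.+1%:R^-1 -> W y].

Let exhaustion_compact j : compact (exhaustion j).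
Proof.
apply: bounded_closed_compact.
  exists j%:R; split; first exact: num_real.
  by move=> r jr x [xj _]; rewrite /= (le_trans xj)// ltW.
move=> x cx; split.
  apply/ler_addgt0Pr => e e0; have [z [[zj _] /= xz]] := cx _ (norm_nbhs x e0).
  by have := ler_normD z (x - z); rewrite addrC subrK; lra.
move=> y xy; have d0 : 0 < j.+1%:R^-1 - `|x - y| by rewrite subr_gt0.
have [z [[_ Hz] /= xz]] := cx _ (norm_nbhs x d0); apply: Hz.
by rewrite -(subrKA x) (le_lt_trans (ler_normD _ _))// (distrC z) -ltrBrDr.
Qed.

Let exhaustion_sub j : exhaustion j `<=` W.
Proof. by move=> x [_]; apply; rewrite subrr normr0 invr_gt0 ltr0n. Qed.

Let exhaustion_nd : nondecreasing_seq exhaustion.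
Proof.
move=> i j ij; apply/subsetPset => x [xi H]; split.
  by rewrite (le_trans xi)// ler_nat.
move=> y xy; apply: H; apply: (lt_le_trans xy).
by rewrite lef_pV2 ?posrE ?ltr0n// ler_nat ltnS.
Qed.

Let exhaustion_cover x : W x -> exists j, exhaustion j x.
Proof.
move=> Wx; have [e e0 eW] := compact_open_margin (@compact_set1 _ x) oW (fun y (xy : y = x) => ecast z (W z) (esym xy) Wx).
pose j := maxn (Num.truncn `|x|).+1 (Num.truncn e^-1); exists j; split.
  by rewrite (le_trans (ltW (truncnS_gt _)))// ler_nat leq_maxl.
move=> y xy; apply: (eW x) => //; apply: (lt_le_trans xy).
rewrite -[e]invrK lef_pV2 ?posrE ?invr_gt0 ?ltr0n//.
by rewrite (le_trans (ltW (truncnS_gt _)))// ler_nat ltnS leq_maxr.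
Qed.

(** Inner approximation from outer regularity: enclose the complement of [E] in the compact set K of
    the exhaustion in an open set G of nearly the same measure. What G leaves of K is compact, lies
    in [E] and misses at most e. *)
Let measure_compact_approx (E : set space) (e : R) j : measurable E -> E `<=` exhaustion j ->
  0 < e -> exists2 C, compact C /\ C `<=` E & (mu E <= mu C + e%:E)%E.
Proof.
move=> mE EK e0; set K := exhaustion j.
have mK : measurable K by apply: compact_measurable_rV; exact: exhaustion_compact.
have Koo : (mu K < +oo)%E by apply: compact_measure_lt_pinfty; [exact: exhaustion_compact|exact: exhaustion_sub].
have mKE : measurable (K `\` E) by exact: measurableD.
have KEoo : (mu (K `\` E) < +oo)%E.
  by apply: le_lt_trans Koo; apply: le_measure; rewrite ?inE//; exact: subDsetl.
have KEW : K `\` E `<=` W by move=> x [/exhaustion_sub].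
have [G [oG KEG GW Ge]] := outer_open KEoo KEW e0.
have mG : measurable G by exact: open_measurable_rV.
exists (K `\` G).
  split; last by move=> x [Kx Gx]; apply: contrapT => Ex; apply: Gx; exact: KEG.
  rewrite setDE; apply: compact_closedI; first exact: exhaustion_compact.
  exact: open_closedC.
have mC : measurable (K `\` G) by exact: measurableD.
have disj1 : mu K = (mu E + mu (K `\` E))%E.
  rewrite -measureU//; last by apply/seteqP; split => // x [Ex [_]].
  by congr (mu _); rewrite setUDr setDv setD0; apply/esym/setUidPr.
have le2 : (mu K <= mu (K `\` G) + mu G)%E.
  apply: le_trans (measureU2 _ mC mG).
  apply: le_measure; rewrite ?inE//; first exact: measurableU.
  by move=> x Kx; case: (pselect (G x)) => Gx; [right|left].
have fE : mu E \is a fin_num.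
  by rewrite ge0_fin_numE//; apply: le_lt_trans Koo; apply: le_measure; rewrite ?inE.
have fKE : mu (K `\` E) \is a fin_num by rewrite ge0_fin_numE.
have fC : mu (K `\` G) \is a fin_num.
  by rewrite ge0_fin_numE//; apply: le_lt_trans Koo; apply: le_measure; rewrite ?inE//; exact: subDsetl.
have : (mu E + mu (K `\` E) <= mu (K `\` G) + (mu (K `\` E) + e%:E))%E.
  by rewrite -disj1 (le_trans le2)// leeD2l.
rewrite addeCA addeC; rewrite -(fineK fE) -(fineK fKE) -(fineK fC) -!EFinD !lee_fin; lra.
Qed.

Theorem riesz_representation : exists m : {measure set space -> \bar R},
  [/\ radon_on W m, outer_regular_on W m &
      forall f, Cc f -> (\int[m]_(x in W) (f x)%:E = (L f)%:E)%E].
Proof.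
have mW : measurable W by exact: open_measurable_rV.
exists mu; split.
- split.
  (* The covering condition is void outside [W], so zero functions cover the complement. *)
  + apply/eqP; rewrite eq_le measure_ge0 andbT.
    apply: (le_trans (@ostar_le (~` W) (fun _ _ => 0) _)); last by rewrite L_zero eseries0.
    by split => //; move=> k; exact: continuous_cpt0.
  + by move=> K; exact: compact_measure_lt_pinfty.
  + move=> E mE EW; apply/eqP; rewrite eq_le; apply/andP; split; last first.
      apply: ge_ereal_sup => _ [K [cK KE] <-]; apply: le_measure; rewrite ?inE//.
      exact: compact_measurable_rV.
    (* [E] may have infinite measure. Its traces on the exhaustion have finite measure and increase
       to [E], so continuity from below reduces the claim to them. *)
    have mEj j : measurable (E `&` exhaustion j).
      by apply: measurableI => //; apply: compact_measurable_rV; exact: exhaustion_compact.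
    have UE : E = \bigcup_j (E `&` exhaustion j).
      apply/seteqP; split => [x Ex|x [j _ []]//].
      by have [j xj] := exhaustion_cover (EW x Ex); exists j.
    have ndE : nondecreasing_seq (fun j => E `&` exhaustion j).
      by move=> i j ij; apply/subsetPset; apply: setIS; apply/subsetPset; exact: exhaustion_nd.
    have mUE : measurable (\bigcup_j (E `&` exhaustion j)) by rewrite -UE.
    have := @nondecreasing_cvg_mu _ _ _ mu _ mEj mUE ndE; rewrite -UE => cvE.
    rewrite -(cvg_lim _ cvE)//; apply: lime_le; first by apply/cvg_ex; eexists; exact: cvE.
    apply: nearW => j /=; apply/lee_addgt0Pr => e e0.
    have [C [cC CE] Ce] := measure_compact_approx (mEj j) (@subIsetr _ _ _) e0.
    apply: (le_trans Ce); apply: leeD2r; apply: ereal_sup_ubound; exists C => //.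
    by split => // x /CE[].
- move=> E mE EW; apply/eqP; rewrite eq_le; apply/andP; split.
    apply: le_ereal_inf_tmp => _ [G [oG EG GW] <-]; apply: le_measure; rewrite ?inE//.
    exact: open_measurable_rV.
  have [Eoo|] := ltP (mu E) +oo%E; last by rewrite leye_eq => /eqP ->; rewrite leey.
  apply/lee_addgt0Pr => e e0; have [G [oG EG GW Ge]] := outer_open Eoo EW e0.
  by apply: le_trans Ge; apply: ereal_inf_lbound; exists G.
- move=> f Cf; have [cf [K [cK KW fK]]] := Cf.
  have Wz (g : space -> R) : Cc g -> (\int[mu]_(x in W) (g x)%:E = \int[mu]_x (g x)%:E)%E.
    move=> [cg [K' [_ K'W gK']]]; rewrite integral_mkcond; apply: eq_integral => x _.
    rewrite patchE; case: ifPn => //; rewrite notin_setE => Wx; rewrite gK'//.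
    by move=> /K'W.
  have Cp : Cc (fun x => Num.max (f x) 0).
    split; first exact: continuous_max0.
    by exists K; split => // x /fK ->; rewrite maxxx.
  have Cm : Cc (fun x => Num.max (- f x) 0).
    split; first by apply: continuous_max0 => x; exact: (cvgN (cf x)).
    by exists K; split => // x /fK ->; rewrite oppr0 maxxx.
  have fpm : f = fun x => Num.max (f x) 0 - Num.max (- f x) 0.
    by apply/funext => x; have [fx|fx] := leP (f x) 0; [rewrite max_l|rewrite max_r]; lra.
  have Ip := representation_ge0 Cp (fun x => _); have Im := representation_ge0 Cm (fun x => _).
  have p0 (g : space -> R) x : 0 <= Num.max (g x) 0 by rewrite le_max lexx orbT.
  have {}Ip := Ip (p0 f); have {}Im := Im (p0 (fun x => - f x)).
  rewrite Wz// integralE.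
  rewrite (_ : (\int[mu]_x _^\+ x = (L (fun x => Num.max (f x) 0))%:E)%E); last first.
    by rewrite -Ip; apply: eq_integral => x _; rewrite funeposE EFin_max.
  rewrite (_ : (\int[mu]_x _^\- x = (L (fun x => Num.max (- f x) 0))%:E)%E); last first.
    by rewrite -Im; apply: eq_integral => x _; rewrite funenegE EFin_max.
  by rewrite -EFinB -LB// -fpm.
Qed.

End outer_measure_of_functional.

(** * Euclidean balls *)

Section euclidean.
Context (R : realType) (n : nat).
Local Notation space := 'rV[R]_n.

Lemma enorm_ge0 (x : space) : 0 <= enorm x.
Proof. exact: sqrtr_ge0. Qed.

Lemma norm_le_enorm (x : space) : `|x| <= enorm x.
Proof.
rewrite [leLHS]mx_normrE; apply: bigmax_le => [|[i j] _]; first exact: enorm_ge0.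
rewrite (ord1 i) /= -sqrtr_sqr ler_wsqrtr// (bigD1 j)//= lerDl.
by apply: sumr_ge0 => k _; exact: sqr_ge0.
Qed.

Lemma enormZ (c : R) (x : space) : 0 <= c -> enorm (c *: x) = c * enorm x.
Proof.
move=> c0; rewrite /enorm -{2}(ger0_norm c0) -sqrtr_sqr -sqrtrM ?sqr_ge0// mulr_sumr.
by congr Num.sqrt; apply: eq_bigr => i _; rewrite mxE exprMn.
Qed.

Lemma enorm0 : enorm (0 : space) = 0.
Proof. by rewrite -(scale0r 0) enormZ// mul0r. Qed.

Lemma enorm_dist_continuous (z : space) : continuous (fun x : space => enorm (x - z)).
Proof.
have cs : continuous (fun x : space => \sum_(i < n) (x - z) 0 i ^+ 2).
  have ci i : continuous (fun x : space => (x - z) 0 i ^+ 2).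
    have c1 : continuous (fun x : space => (x - z) 0 i).
      have c2 : continuous (fun x : space => x 0 i) by move=> y; exact: coord_continuous.
      have c3 : continuous (fun _ : space => z 0 i) by move=> y; exact: cst_continuous.
      have -> : (fun x : space => (x - z) 0 i) = fun x : space => x 0 i - z 0 i.
        by apply/funext => x; rewrite !mxE.
      by move=> x; exact: (cvgB (c2 x) (c3 x)).
    by move=> x; exact: (cvgM (c1 x) (c1 x)).
  elim: (index_enum _) => [|i r ih].
    by under eq_fun do rewrite big_nil; move=> x; exact: cst_continuous.
  under eq_fun do rewrite big_cons; move=> x; exact: (cvgD (ci i x) (ih x)).
by move=> x; apply: (@continuous_comp _ _ _ _ Num.sqrt); [exact: cs|exact: sqrt_continuous].
Qed.

Lemma eball_open (z : space) r : open (eball z r).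
Proof.
rewrite (_ : eball z r = (fun x : space => enorm (x - z)) @^-1` `]-oo, r[%classic).
  by apply: open_comp => [x _|]; [exact: enorm_dist_continuous|exact: interval_open].
by apply/seteqP; split => x /=; rewrite in_itv.
Qed.

Definition ceball (z : space) (r : R) : set space := [set x | enorm (x - z) <= r].

Lemma ceball_compact (z : space) r : compact (ceball z r).
Proof.
apply: bounded_closed_compact.
  exists (r + `|z|); split; first exact: num_real.
  move=> M rM x xz; rewrite /= (le_trans _ (ltW rM))//.
  have := le_trans (norm_le_enorm (x - z)) xz.
  by have := ler_normD (x - z) z; rewrite subrK; lra.
rewrite (_ : ceball z r = (fun x : space => enorm (x - z)) @^-1` `]-oo, r]%classic).
  by apply: closed_comp => [x _|]; [exact: enorm_dist_continuous|exact: interval_closed].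
by apply/seteqP; split => x /=; rewrite in_itv.
Qed.

Lemma eball_center (z : space) r : 0 < r -> eball z r z.
Proof. by move=> r0; rewrite /eball/= subrr enorm0. Qed.

Lemma eball_sub_ball (z : space) r x : eball z r x -> `|z - x| < r.
Proof. by move=> xz; rewrite distrC (le_lt_trans (norm_le_enorm _)). Qed.

(** The segment from z to x stays within distance r of z, so it meets no boundary point; its part in
    [Omega] is then relatively open and closed, and connectedness keeps the whole segment in
    [Omega]. *)
Lemma ceball_sub_domain (Omega : set space) z r : open Omega -> Omega z ->
  (r%:E < dist_boundary Omega z)%E -> ceball z r `<=` Omega.
Proof.
move=> oO Oz rd x xz.
pose A := (fun t : R => z + t *: (x - z)) @` `[0, 1]%classic.
have cA : connected A.
  apply: connected_continuous_connected; first exact: segment_connected.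
  apply: continuous_subspaceT => t.
  have c1 : continuous (fun _ : R => z) by move=> y; exact: cst_continuous.
  have c2 : continuous (fun t : R => t *: (x - z)) by move=> y; exact: (@scalel_continuous _ _ (x - z)).
  exact: (cvgD (c1 t) (c2 t)).
have Ar y : A y -> enorm (z - y) <= r.
  move=> [t /=]; rewrite in_itv/= => /andP[t0 t1] <-.
  rewrite opprD addNKr -scalerN opprB enormZ//; apply: le_trans xz.
  have -> : enorm (z - x) = enorm (x - z).
    by rewrite /enorm; congr Num.sqrt; apply: eq_bigr => i _; rewrite !mxE -sqrrN opprB.
  by rewrite ler_piMl// enorm_ge0.
have noB y : A y -> closure Omega y -> Omega y.
  move=> Ay cOy; apply: contrapT => nOy; move: rd; apply/negP; rewrite -leNgt.
  apply: (@le_trans _ _ (enorm (z - y))%:E); last by rewrite lee_fin Ar.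
  apply: ereal_inf_lbound; exists y => //; split => //.
  by move=> /interior_subset.
have A0 : A z by exists 0; rewrite /= ?in_itv/= ?lexx ?ler01// scale0r addr0.
have A1 : A x by exists 1; rewrite /= ?in_itv/= ?lexx ?ler01// scale1r addrC subrK.
suff : A `&` Omega = A by move=> AO; move: A1; rewrite -AO => -[].
apply: cA; first by exists z.
  by exists Omega.
exists (closure Omega); first exact: closed_closure.
apply/seteqP; split => y [Ay Oy]; split => //; first exact: subset_closure.
exact: noB.
Qed.

End euclidean.

(** * Weak formulations on compact sets *)

Section weak_form_restriction.
Context (R : realType) (n : nat).
Local Notation space := 'rV[R]_n.
Local Notation spacetime := ('rV[R]_n * R)%type.
Variable g : space -> R -> R -> R.

Lemma continuous_mbounded (K : set spacetime) (psi : spacetime -> R) : compact K ->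
  continuous psi -> mbounded (K : set ('rV[R]_n * measurableTypeR R)) psi.
Proof.
move=> cK c; split.
  by apply: measurable_funS (continuous_measurable_prod c).
by have [B _ KB] := compact_bounded_fun cK (continuous_subspaceT c); exists B.
Qed.

Lemma laplacian_continuous (phi : spacetime -> R) : smooth phi -> continuous (laplacian phi).
Proof.
move=> sphi; rewrite /laplacian.
have ci i : continuous (fun p : spacetime => 'D_((delta_mx 0 i : space), (0 : R))
    ('D_((delta_mx 0 i : space), (0 : R)) phi) p).
  by have [c _] := sphi [:: ((delta_mx 0 i : space), (0 : R)); ((delta_mx 0 i : space), (0 : R))].
elim: (index_enum _) => [|i r ih].
  by under eq_fun do rewrite big_nil; move=> x; exact: cst_continuous.
by under eq_fun do rewrite big_cons; move=> x; exact: (cvgD (ci i x) (ih x)).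
Qed.

Lemma test_mbounded (K : set spacetime) (phi : spacetime -> R) : compact K -> smooth phi ->
  mbounded (K : set ('rV[R]_n * measurableTypeR R)) (fun p => - dt phi p - laplacian phi p) /\
  mbounded (K : set ('rV[R]_n * measurableTypeR R)) phi.
Proof.
move=> cK sphi; split; last by apply: continuous_mbounded => //; have [] := sphi [::].
have cdt : continuous (dt phi) by have [c _] := sphi [:: ((0 : space), (1 : R))].
apply: mboundedB; last by apply: continuous_mbounded => //; exact: laplacian_continuous.
by have := mboundedZ (-1) (continuous_mbounded cK cdt); under eq_fun do rewrite mulN1r.
Qed.

Lemma weak_subsol_pairing (K : set spacetime) (v f : spacetime -> R) : compact K ->
  (dxdt R n).-integrable K (EFin \o v) -> (dxdt R n).-integrable K (EFin \o f) ->
  (forall phi, smooth phi -> (forall p, 0 <= phi p) -> (forall p, ~ K p -> phi p = 0) ->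
    pairing (dxdt R n) K v (fun p => - dt phi p - laplacian phi p) +
    pairing (dxdt R n) K f phi <= 0) -> weak_subsol K v f.
Proof.
move=> cK iv jf H phi sphi phi0 phiK; have mK := compact_measurable_prod cK.
have [mdt mphi] := test_mbounded cK sphi.
apply: le_trans (H phi sphi phi0 phiK); rewrite /pairing -RintegralD//.
- by rewrite le_eqVlt; apply/orP; left; apply/eqP; apply: eq_Rintegral => p _; ring.
- exact: (pairing_integrable mK iv mdt).
- exact: (pairing_integrable mK jf mphi).
Qed.

(** [phi] and its derivatives vanish on the open complement of [K], so the extended-real integral
    over [D] is a finite integral over [K], where [w] and the nonlinear term are integrable. *)
Lemma weak_form_compact (D K : set spacetime) (w phi : spacetime -> R) :
  measurable (D : set ('rV[R]_n * measurableTypeR R)) -> compact K -> K `<=` D ->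
  weakly_admissible g D w -> smooth phi -> (forall p, ~ K p -> phi p = 0) ->
  weak_form g D w phi = (pairing (dxdt R n) K w (fun p => - dt phi p - laplacian phi p) +
    pairing (dxdt R n) K (fun p => g p.1 p.2 (w p)) phi)%:E.
Proof.
move=> mD cK KD [iw ig] sphi phiK; have mK := compact_measurable_prod cK.
have oK : open (~` K) by rewrite openC; exact: compact_closed_normed.
have z0 p d : ~ K p -> 'D_d phi p = 0 by move=> Kp; exact: (derive_zero_open d oK).
have z1 p d : ~ K p -> 'D_d ('D_d phi) p = 0.
  by move=> Kp; apply: (derive_zero_open d oK) => // q Kq; exact: z0.
have [mdt mphi] := test_mbounded cK sphi.
have iwK := iw K cK KD; have igK := ig K cK KD.
have i1 := pairing_integrable mK iwK mdt; have i2 := pairing_integrable mK igK mphi.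
rewrite /pairing -RintegralD//.
rewrite /Rintegral fineK; last first.
  by apply: integrable_fin_num => //; have := integrableD mK i1 i2; apply: eq_integrable.
rewrite /weak_form [LHS]integral_mkcond [RHS]integral_mkcond; congr (integral _ _ _); apply/funext => p.
rewrite !patchE; case: (boolP (p \in K)) => [|].
  by rewrite inE => Kp; rewrite mem_set; [congr EFin; ring|exact: KD].
rewrite notin_setE => Kp; case: ifPn => // _; congr EFin.
rewrite /dt z0// /laplacian big1; last by move=> i _; exact: z1.
by rewrite phiK// !mulr0 subrr addr0.
Qed.

Variables (D : set spacetime) (u : spacetime -> R).
Hypothesis mD : measurable (D : set ('rV[R]_n * measurableTypeR R)).
Hypothesis su : solution g D u.

Let solution_pairing (K : set spacetime) phi : compact K -> K `<=` D -> smooth phi ->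
  (forall p, ~ K p -> phi p = 0) ->
  pairing (dxdt R n) K u (fun p => - dt phi p - laplacian phi p) +
  pairing (dxdt R n) K (fun p => g p.1 p.2 (u p)) phi = 0.
Proof.
move=> cK KD sphi phiK; have [au wu] := su.
have := wu phi (conj sphi (ex_intro _ K (And3 cK KD phiK))).
by rewrite (weak_form_compact mD cK KD au sphi phiK) => -[].
Qed.

Lemma solution_weak_subsol (K : set spacetime) : compact K -> K `<=` D ->
  weak_subsol K u (fun p => g p.1 p.2 (u p)).
Proof.
move=> cK KD; have [[iu ig] _] := su.
apply: weak_subsol_pairing => //; [exact: iu|exact: ig|move=> phi sphi phi0 phiK].
by rewrite solution_pairing.
Qed.

(** Against a nonnegative test function the solution gives an equality and the supersolution an
    inequality. The nonlinear terms stay a difference, whose sign later follows from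
    monotonicity. *)
Lemma difference_weak_subsol (D' K : set spacetime) (w : spacetime -> R) :
  measurable (D' : set ('rV[R]_n * measurableTypeR R)) -> D' `<=` D ->
  supersolution g D' w -> compact K -> K `<=` D' ->
  weak_subsol K (fun p => u p - w p) (fun p => g p.1 p.2 (u p) - g p.1 p.2 (w p)).
Proof.
have aux (a b c d : R) : 0 <= a + b -> c + d = 0 -> c - a + (d - b) <= 0 by lra.
move=> mD' DD [aw sw] cK KD'; have [[iu igu] _] := su; have [iw igw] := aw.
have KD : K `<=` D by move=> p /KD'/DD.
have mK := compact_measurable_prod cK.
have Iu := iu K cK KD; have Igu := igu K cK KD; have Iw := iw K cK KD'; have Igw := igw K cK KD'.
have sub (f1 f2 : spacetime -> R) : (dxdt R n).-integrable K (EFin \o f1) ->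
    (dxdt R n).-integrable K (EFin \o f2) ->
    (dxdt R n).-integrable K (EFin \o (fun p => f1 p - f2 p)).
  by move=> i1 i2; have := integrableB mK i1 i2; apply: eq_integrable.
have pairB (f1 f2 : spacetime -> R) F : (dxdt R n).-integrable K (EFin \o f1) ->
    (dxdt R n).-integrable K (EFin \o f2) ->
    mbounded (K : set ('rV[R]_n * measurableTypeR R)) F ->
    pairing (dxdt R n) K (fun p => f1 p - f2 p) F = pairing (dxdt R n) K f1 F - pairing (dxdt R n) K f2 F.
  move=> i1 i2 mF; have j1 := pairing_integrable mK i1 mF; have j2 := pairing_integrable mK i2 mF.
  by rewrite /pairing -RintegralB//; apply: eq_Rintegral => p _; rewrite mulrBl.
apply: weak_subsol_pairing => //; [exact: sub|exact: sub|move=> phi sphi phi0 phiK].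
have [mdt mphi] := test_mbounded cK sphi.
rewrite !pairB//; have := solution_pairing cK KD sphi phiK.
have := sw phi; rewrite (weak_form_compact mD' cK KD' aw sphi phiK) lee_fin => H.
have {}H := H (conj sphi (ex_intro _ K (And3 cK KD' phiK))) phi0.
exact: (aux _ _ _ _ H).
Qed.

End weak_form_restriction.

(** * Inf-convolutions *)

Section inf_convolution.
Context (R : realType) (n : nat).
Local Notation space := 'rV[R]_n.
Variables (zeta : space -> R) (B lambda : R).
Hypothesis z0 : forall x, 0 <= zeta x.
Hypothesis zB : forall x, zeta x <= B.
Hypothesis lambda0 : 0 <= lambda.

Definition sqdist (x y : space) : R := \sum_(i < n) (x 0 i - y 0 i) ^+ 2.

Let paraboloid (y x : space) := Num.min B (zeta y + lambda * sqdist x y).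

Definition infconv (x : space) : R := inf [set paraboloid y x | y in [set: space]].

Let B0 : 0 <= B. Proof. exact: le_trans (z0 0) (zB 0). Qed.

Lemma sqdist_ge0 x y : 0 <= sqdist x y.
Proof. by apply: sumr_ge0 => i _; exact: sqr_ge0. Qed.

Let paraboloid_ge0 y x : 0 <= paraboloid y x.
Proof. by rewrite le_min B0 addr_ge0// mulr_ge0// sqdist_ge0. Qed.

Let has_inf_par x : has_inf [set paraboloid y x | y in [set: space]].
Proof. by split; [exists (paraboloid 0 x), 0|exists 0 => _ [y _ <-]]. Qed.

Let infconv_le x y : infconv x <= paraboloid y x.
Proof. by apply: ge_inf; [exact: (has_inf_par x).2|exists y]. Qed.

Lemma infconv_ge0 x : 0 <= infconv x.
Proof. by apply: lb_le_inf; [exact: (has_inf_par x).1|move=> _ [y _ <-]]. Qed.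

Lemma infconv_le_fun x : infconv x <= zeta x.
Proof.
apply: (le_trans (infconv_le x x)); rewrite ge_min; apply/orP; right.
rewrite /sqdist big1 ?mulr0 ?addr0// => i _; by rewrite subrr expr0n.
Qed.

Let sqdist_continuous y : continuous (fun x => sqdist x y).
Proof.
rewrite /sqdist; elim: (index_enum _) => [|i r ih].
  by under eq_fun do rewrite big_nil; move=> x; exact: cst_continuous.
under eq_fun do rewrite big_cons; move=> x; apply: (cvgD _ (ih x)).
have c1 : continuous (fun x : space => x 0 i - y 0 i).
  have c2 : continuous (fun x : space => x 0 i) by move=> z; exact: coord_continuous.
  have c3 : continuous (fun _ : space => y 0 i) by move=> z; exact: cst_continuous.
  by move=> z; exact: (cvgB (c2 z) (c3 z)).
exact: (cvgM (c1 x) (c1 x)).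
Qed.

Let paraboloid_continuous y : continuous (paraboloid y).
Proof.
have c1 : continuous (fun _ : space => zeta y) by move=> z; exact: cst_continuous.
have c2 : continuous (fun _ : space => lambda) by move=> z; exact: cst_continuous.
have c3 : continuous (fun x => zeta y + lambda * sqdist x y).
  by move=> x; exact: (cvgD (c1 x) (cvgM (c2 x) (@sqdist_continuous y x))).
have := continuous_min1 (c := B) c3; under eq_fun do rewrite minC; exact.
Qed.

(** An infimum of continuous functions is upper semicontinuous: its strict sublevel sets are unions
    of open sets. *)
Lemma infconv_measurable : measurable_fun setT infconv.
Proof.
apply: (measurability _ (RGenInftyO.measurableE R)) => _ [_ [c ->] <-].
rewrite setTI; apply: open_measurable_rV.
rewrite (_ : _ @^-1` _ = \bigcup_(y in [set: space]) (paraboloid y @^-1` `]-oo, c[%classic)).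
  apply: bigcup_open => y _.
  by apply: open_comp => [x _|]; [exact: paraboloid_continuous|exact: interval_open].
apply/seteqP; split => x /=; rewrite in_itv/=.
  move=> /(inf_lt (has_inf_par x).1)[_ [y _ <-] yc]; exists y => //.
by move=> [y _ /=]; rewrite in_itv/=; exact: le_lt_trans.
Qed.

(* An infimum of functions with second differences at most [2 lambda h^2]. *)
Lemma infconv_semiconcave i h x : secdiff infconv i h x <= 2 * lambda * h ^+ 2.
Proof.
rewrite /secdiff lerBlDr; apply/ler_addgt0Pr => e e0.
have e20 : 0 < e / 2 by rewrite divr_gt0.
(* A minimiser [y] at x up to e/2 is a competitor at both shifted points; the centre is counted
   twice, so the loss is e. *)
have [_ [y _ <-] ye] := inf_adherent e20 (has_inf_par x).
have H1 := infconv_le (x + h *: delta_mx 0 i) y.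
have H2 := infconv_le (x + (- h) *: delta_mx 0 i) y.
suff : paraboloid y (x + h *: delta_mx 0 i) + paraboloid y (x + (- h) *: delta_mx 0 i) <=
    2 * paraboloid y x + 2 * lambda * h ^+ 2.
  by move: ye; rewrite -/(infconv x); lra.
have E : sqdist (x + h *: delta_mx 0 i) y + sqdist (x + (- h) *: delta_mx 0 i) y =
    2 * sqdist x y + 2 * h ^+ 2.
  rewrite /sqdist -big_split/=.
  rewrite (eq_bigr (fun j => 2 * (x 0 j - y 0 j) ^+ 2 + 2 * h ^+ 2 * (j == i)%:R)); last first.
    by move=> j _; rewrite !mxE eqxx/=; case: (j == i) => /=; ring.
  have S1 : \sum_(j < n) (j == i)%:R = 1 :> R.
    by rewrite (bigD1 i)//= eqxx big1 ?addr0// => j /negbTE ->.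
  by rewrite big_split/= -!mulr_sumr S1 mulr1.
rewrite /paraboloid; set Q := sqdist x y in E *; set Q1 := sqdist _ y in E *; set Q2 := sqdist _ y in E *.
have h2 : 0 <= lambda * h ^+ 2 by rewrite mulr_ge0// sqr_ge0.
have EL : lambda * Q1 + lambda * Q2 = 2 * (lambda * Q) + 2 * (lambda * h ^+ 2).
  by rewrite -mulrDr E; ring.
have [m1 m2] : (forall a b : R, Num.min a b <= a) /\ (forall a b : R, Num.min a b <= b).
  by split=> a b; rewrite ge_min lexx ?orbT.
have b1 := m1 B (zeta y + lambda * Q1); have b2 := m1 B (zeta y + lambda * Q2).
have b3 := m2 B (zeta y + lambda * Q1); have b4 := m2 B (zeta y + lambda * Q2).
have [->|->] : Num.min B (zeta y + lambda * Q) = B \/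
    Num.min B (zeta y + lambda * Q) = zeta y + lambda * Q.
- by rewrite /Order.min; case: ifP; [left|right].
- by lra.
- by lra.
Qed.

(** Points within [d] of x change [zeta] by at most [e]; for farther ones some coordinate differs by
    at least [d], so their penalty is at least lambda d^2, hence at least the bound [B] of
    [zeta]. *)
Lemma infconv_approx (d e : R) : 0 < d -> 0 <= e ->
  (forall x y, `|x - y| < d -> `|zeta x - zeta y| <= e) -> B <= lambda * d ^+ 2 ->
  forall x, zeta x - e <= infconv x.
Proof.
move=> d0 e0 zde Bd x; apply: lb_le_inf; first exact: (has_inf_par x).1.
move=> _ [y _ <-]; rewrite /paraboloid le_min.
have -> /= : zeta x - e <= B by rewrite lerBlDr (le_trans (zB x))// lerDl.
have [/zde|xy] := ltP `|x - y| d.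
  rewrite ler_norml => /andP[_]; have := sqdist_ge0 x y; move/(mulr_ge0 lambda0); lra.
have [[i xyi]|H] := pselect (exists i, d <= `|(x - y) 0 i|); last first.
  have : `|x - y| < d; last by rewrite ltNge xy.
  apply: rV_norm_lt => // i.
  by rewrite ltNge; apply/negP => xyi; apply: H; exists i.
have : lambda * d ^+ 2 <= lambda * sqdist x y.
  apply: ler_wpM2l => //; rewrite /sqdist (bigD1 i)//=.
  apply: (@le_trans _ _ ((x 0 i - y 0 i) ^+ 2)); last first.
    by rewrite lerDl; apply: sumr_ge0 => j _; exact: sqr_ge0.
  rewrite -[leRHS]real_normK ?num_real//; move: xyi; rewrite !mxE => xyi.
  by rewrite lerXn2r// ?nnegrE// ltW.
by have := z0 y; have := zB x; move: Bd; lra.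
Qed.

End inf_convolution.

(** * One-sided limits at zero *)

Section cvg_at_zero.
Context (R : realType).

(** Cauchy's criterion: near 0, [F] stays within e of the limit of an approximant at distance
    e/2. *)
Lemma cvg_right_approx (F : R -> R) :
  (forall e : R, 0 < e -> exists2 G : R -> R, cvg (G t @[t --> 0^'+]) &
     \forall t \near 0^'+, `|F t - G t| <= e) -> cvg (F t @[t --> 0^'+]).
Proof.
move=> H; apply/cauchy_cvgP; apply: cauchy_exP => e e0.
have e20 : 0 < e / 2 by rewrite divr_gt0.
have [G /cvg_ex[l Gl] FG] := H _ e20; exists l.
have Gl' : \forall t \near (0:R)^'+, `|l - G t| < e / 2 by move/cvgrPdist_lt : Gl; apply.
suff : \forall t \near (0:R)^'+, ball l e (F t) by [].
near=> t.
rewrite /= -ball_normE /= -(subrKA (G t)) (le_lt_trans (ler_normD _ _))//.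
have h1 : `|l - G t| < e / 2 by near: t.
have h2 : `|F t - G t| <= e / 2 by near: t.
by rewrite (splitr e) ltr_leD// distrC.
Unshelve. all: by end_near. Qed.

(** F(t) - t C is nonincreasing and bounded above near 0, hence has a limit there, and so has the
    linear term. *)
Lemma cvg_right_monotone (F : R -> R) (t0 B C : R) : 0 < t0 ->
  (forall t, 0 < t < t0 -> F t <= B) -> 0 <= C ->
  (forall a b, 0 < a -> a <= b -> b < t0 -> F b <= F a + (b - a) * C) ->
  cvg (F t @[t --> 0^'+]).
Proof.
move=> t00 FB C0 FC; pose G t := F t - t * C.
have cG : cvg (G t @[t --> 0^'+]).
  apply: nonincreasing_at_right_is_cvgr.
    near=> r => a b; rewrite !in_itv/= => /andP[a0 _] /andP[_ br] ab.
    have rt : r < t0 by near: r; exact: nbhs_right_lt.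
    by have := FC a b a0 ab (lt_trans br rt); rewrite /G; lra.
  near=> r; have rt : r < t0 by near: r; exact: nbhs_right_lt.
  exists B => _ [t /= tr0 <-]; move: tr0; rewrite in_itv/= => /andP[t0' tr].
  have := FB t; rewrite t0' (lt_trans tr rt) => /(_ isT).
  by rewrite /G; have := mulr_ge0 (ltW t0') C0; lra.
have cC : cvg (t * C @[t --> (0:R)^'+]).
  apply/cvg_ex; exists (0 * C).
  apply: (cvgMr_tmp (f := fun t : R => t)); apply: cvg_at_right_filter; exact: cvg_id.
have -> : F = fun t => G t + t * C by apply/funext => t; rewrite /G subrK.
exact: is_cvgD cG cC.
Unshelve. all: by end_near. Qed.

End cvg_at_zero.

(** * Local bounds from strong barriers *)

Section rV_integrals.
Context (R : realType) (n : nat).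
Local Notation space := 'rV[R]_n.

Lemma compact_integrable_rV (K : set space) (f : space -> R) : compact K ->
  {within K, continuous f} -> (lebesgue_rV R n).-integrable K (EFin \o f).
Proof.
move=> cK cf; apply/(integrable_mkcond _ (compact_measurable_rV cK)).
have := bsupp_integrable (bsupp_patch cK cf); congr (_.-integrable _ _).
by apply/funext => y; rewrite /= !patchE; case: ifP.
Qed.

Lemma Rintegral_EFin d (X : measurableType d) (mu : {measure set X -> \bar R}) (D : set X)
    (f : X -> R) : measurable D -> mu.-integrable D (EFin \o f) ->
  (\int[mu]_(x in D) (f x)%:E)%E = (\int[mu]_(x in D) f x)%:E.
Proof. by move=> mD fi; rewrite fineK// (integrable_fin_num mD fi). Qed.

Lemma Rintegral_subset d (X : measurableType d) (mu : {measure set X -> \bar R})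
    (A B : set X) (f : X -> R) : measurable A -> measurable B ->
  mu.-integrable B (EFin \o f) -> (forall x, B x -> 0 <= f x) -> A `<=` B ->
  \int[mu]_(x in A) f x <= \int[mu]_(x in B) f x.
Proof.
move=> mA mB fi f0 AB; rewrite -lee_fin -!Rintegral_EFin//; last exact: integrableS fi.
by apply: ge0_subset_integral => //; have /integrableP[] := fi.
Qed.

End rV_integrals.

Section absorption.
Context (R : realType) (n : nat).
Local Notation space := 'rV[R]_n.
Local Notation spacetime := ('rV[R]_n * R)%type.
Variables (Omega : set space) (g : space -> R -> R -> R).
Hypothesis g_cont : {within Omega `*` `]0, +oo[%classic `*` [set: R],
  continuous (fun q : space * R * R => g q.1.1 q.1.2 q.2)}.

Lemma nonlinearity_continuous (K : set spacetime) (v : spacetime -> R) :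
  K `<=` Omega `*` `]0, +oo[%classic -> {within K, continuous v} ->
  {within K, continuous (fun p => g p.1 p.2 (v p))}.
Proof.
move=> KQ /within_continuous_distP cv; apply: dist_within_continuous => p Kp w w0.
have [e e0 ge] := within_continuous_distP g_cont (x := (p, v p)) (conj (KQ p Kp) I) w0.
have [e' e'0 ve] := cv p Kp e e0.
exists (Num.min e e') => [|q Kq]; first by rewrite lt_min e0.
rewrite lt_min => /andP[pq pq']; apply: (ge (q, v q)); first by split => //; exact: KQ.
by rewrite prod_normE/= gt_max pq ve.
Qed.

Hypothesis oO : open Omega.
Hypothesis g_ndec : forall x t, Omega x -> 0 < t -> forall r s, r <= s -> g x t r <= g x t s.
Variables (T : R) (u : spacetime -> R).
Hypothesis T0 : 0 < T.
Local Notation Q := (Omega `*` `]0, T[%classic : set spacetime).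
Hypothesis cu : {within Q, continuous u}.
Hypothesis u0 : forall p, Q p -> 0 < u p.
Hypothesis su : solution g Q u.

Lemma domain_measurable (U : set space) : open U ->
  measurable (U `*` `]0, T[%classic : set ('rV[R]_n * measurableTypeR R)).
Proof. by move=> oU; apply: measurableX => //; exact: open_measurable_rV. Qed.

Lemma slice_integrable (K : set space) t : compact K -> K `<=` Omega -> 0 < t < T ->
  (lebesgue_rV R n).-integrable K (fun y => (u (y, t))%:E).
Proof.
move=> cK KO tT; apply: (compact_integrable_rV (f := fun y => u (y, t)) cK).
apply: (@within_slice _ _ K `]0, T[%classic); last by rewrite /= in_itv.
by apply: continuous_subspaceW cu; apply: setSX.
Qed.

Lemma slice_gt0 (K : set space) t x : K `<=` Omega -> 0 < t < T -> K x -> 0 < u (x, t).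
Proof. by move=> KO tT /KO Ox; apply: u0; split => //=; rewrite in_itv. Qed.

Definition mass_bounded (K : set space) := exists t0 M : R,
  0 < t0 < T /\ forall t, 0 < t < t0 -> \int[lebesgue_rV R n]_(y in K) u (y, t) <= M.

(** Comparison on a ball of radius r runs from a time a, at which the mass is below A, to an
    arbitrary later b < T/2. Near the lateral boundary w exceeds u, as u is bounded on a compact
    cylinder over [a', b']. The width of that layer depends on a, but the final bound A + C |ball|
    does not. *)
Lemma local_bound (z : space) : Omega z -> strong_barrier g Omega T z ->
  ~ (forall eps, 0 < eps -> (\int[lebesgue_rV R n]_(x in eball z eps `&` Omega) (u (x, t))%:E)%E
           @[t --> 0^'+] --> +oo%E) ->
  exists rho : R, [/\ 0 < rho, ceball z rho `<=` Omega & mass_bounded (ceball z rho)].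
Proof.
move=> Oz [r0 [r00 r0d bar]] nS.
have [eps [A [eps0 epsA]]] : exists eps A : R, 0 < eps /\ forall t1, 0 < t1 -> exists2 t,
    0 < t < t1 & (\int[lebesgue_rV R n]_(x in eball z eps `&` Omega) (u (x, t))%:E < A%:E)%E.
  apply: contrapT => H; apply: nS => eps eps0; apply/cvgeyPge => A.
  apply: contrapT => HA; apply: H; exists eps, A; split => // t1 t10.
  apply: contrapT => Ht; apply: HA; near=> t; rewrite leNgt; apply/negP => tA.
  apply: Ht; exists t => //; apply/andP; split; near: t; [exact: nbhs_right_gt|exact: nbhs_right_lt].
pose r := Num.min (r0 / 2) (eps / 2).
have r_gt0 : 0 < r by rewrite lt_min !divr_gt0.
have rr0 : r < r0 by rewrite gt_min ltr_pdivrMr// ltr_pMr// ltr1n.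
have reps : r < eps by rewrite gt_min [X in _ || X]ltr_pdivrMr// ltr_pMr// ltr1n orbT.
have rO : ceball z r `<=` Omega.
  by apply: ceball_sub_domain => //; apply: lt_trans r0d; rewrite lte_fin.
have [w [w0 sw cw winf]] := bar r r_gt0 rr0.
have T20 : 0 < T / 2 by rewrite divr_gt0.
have T2T : T / 2 < T by rewrite ltr_pdivrMr// ltr_pMr// ltr1n.
have r2 : 0 < r / 2 by rewrite divr_gt0.
have r2r : r / 2 < r by rewrite ltr_pdivrMr// ltr_pMr// ltr1n.
have bO : eball z r `<=` Omega by move=> x /ltW; exact: rO.
(* Continuity of the barrier down to t = 0 makes [C] independent of the starting time a. *)
have [C C0 wC] : exists2 C : R, 0 < C &
    forall p, (ceball z (r / 2) `*` `[0, T / 2]%classic) p -> `|w p| <= C.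
  apply: compact_bounded_fun; first by apply: compact_setX; [exact: ceball_compact|exact: segment_compact].
  apply: continuous_subspaceW cw => -[x t] [/= xr]; rewrite !in_itv/= => /andP[t0 tT].
  by split => /=; [exact: le_lt_trans r2r|rewrite t0 (le_lt_trans tT)].
exists (r / 2); split => //; first by move=> x xr; apply: rO; exact: le_trans (ltW r2r).
exists (T / 2), (A + C * fine (lebesgue_rV R n (ceball z (r / 2)))); split; first by rewrite T20.
move=> b /andP[b0 bT]; have [a /andP[a0 ab] aA] := epsA b b0.
pose a' := a / 2; pose b' := (b + T) / 2.
have [a'0 a'a] : 0 < a' /\ a' < a by rewrite /a'; lra.
have [bb' b'T] : b < b' /\ b' < T by rewrite /b'; move: T2T; lra.
have JT : `[a', b']%classic `<=` `]0, T[%classic.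
  by move=> t; rewrite /= !in_itv/= => /andP[at' tb]; rewrite (lt_le_trans a'0)//= (le_lt_trans tb).
have [B B0 uB] : exists2 B : R, 0 < B &
    forall p, (ceball z r `*` `[a', b']%classic) p -> `|u p| <= B.
  apply: compact_bounded_fun; first by apply: compact_setX; [exact: ceball_compact|exact: segment_compact].
  by apply: continuous_subspaceW cu; apply: setSX.
have [d d0 wd] := winf _ (segment_compact (a := a') (b := b')) JT B.
pose d' := Num.min d (r / 2).
have d'0 : 0 < d' by rewrite lt_min d0 r2.
have d'd : d' <= d by rewrite ge_min lexx.
have d'r : d' <= r / 2 by rewrite ge_min lexx orbT.
(* Points of the ball off [K0] lie in the layer where w > B >= u. The radius of [K1] leaves a margin
   around [K0] and keeps a distance d'/2 from the sphere, where w blows up. *)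
pose K0 := ceball z (r - d'); pose K1 := ceball z (r - d' / 2).
have cK0 : compact K0 by exact: ceball_compact.
have cK1 : compact K1 by exact: ceball_compact.
have K1r : K1 `<=` eball z r by move=> x; rewrite /K1 /ceball /eball/=; lra.
have K1O : K1 `<=` Omega by move=> x /K1r; exact: bO.
have [eta eta0 K01] : exists2 eta : R, 0 < eta & forall x y, K0 x -> `|x - y| < eta -> K1 y.
  have [] := @compact_open_margin _ _ K0 (eball z (r - d' / 2)) cK0 (@eball_open _ _ _ _).
    by move=> x; rewrite /K0 /ceball /eball/=; lra.
  by move=> eta eta0 H; exists eta => // x y Kx xy; apply: ltW; exact: H xy.
pose K := K1 `*` `[a', b']%classic.
have cK : compact K by apply: compact_setX => //; exact: segment_compact.
have mK := compact_measurable_prod cK.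
pose D' := eball z r `*` `]0, T[%classic.
have KD' : K `<=` D' by exact: setSX.
have D'Q : D' `<=` Q by exact: setSX.
have KQ : K `<=` Q by move=> p /KD'/D'Q.
have cuK : {within K, continuous u} by exact: continuous_subspaceW cu.
have cwK : {within K, continuous w}.
  apply: continuous_subspaceW cw => p /KD'[p1 /=]; rewrite in_itv/= => /andP[p2 p3].
  by split => //=; rewrite ?in_itv/= p3 ltW.
have Q0 : Q `<=` Omega `*` `]0, +oo[%classic.
  by apply: setSX => [t|x]; rewrite /= ?in_itv/= ?andbT => // /andP[].
have KQ0 : K `<=` Omega `*` `]0, +oo[%classic by move=> p /KQ/Q0.
have withinB (f h : spacetime -> R) : {within K, continuous f} -> {within K, continuous h} ->
    {within K, continuous (fun p => f p - h p)}.
  by move=> cf ch x; exact: (cvgB (cf x) (ch x)).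
have Dcont := withinB _ _ cuK cwK.
have Dg := withinB _ _ (nonlinearity_continuous KQ0 cuK) (nonlinearity_continuous KQ0 cwK).
have [[iu igu] _] := su; have [[iw igw] _] := sw.
have iB (f h : spacetime -> R) : (dxdt R n).-integrable K (EFin \o f) ->
    (dxdt R n).-integrable K (EFin \o h) -> (dxdt R n).-integrable K (EFin \o (fun p => f p - h p)).
  by move=> fi hi; have := integrableB mK fi hi.
have fsign p : K p -> 0 < u p - w p -> 0 <= g p.1 p.2 (u p) - g p.1 p.2 (w p).
  move=> /KQ0[Op /=]; rewrite in_itv/= andbT => p2; rewrite subr_gt0 subr_ge0 => /ltW.
  exact: g_ndec.
have vsign p : K p -> ~ K0 p.1 -> u p - w p <= 0.
  case: p => x t [/= Kx Jt] nK0; rewrite subr_le0 ltW//.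
  apply: (@le_lt_trans _ _ B); first by rewrite (le_trans (ler_norm _))// uB//; split => //; exact: ltW (K1r _ Kx).
  apply: wd => //; apply/andP; split; last exact: K1r.
  by move/negP: nK0; rewrite -ltNge; move: d'd; lra.
have H := positive_part_decreasing cK0 cK1 eta0 K01 a'a (ltW ab) bb' Dcont
  (iB _ _ (iu _ cK KQ) (iw _ cK KD')) (iB _ _ (igu _ cK KQ) (igw _ cK KD'))
  (difference_weak_subsol (domain_measurable oO) su (domain_measurable (@eball_open _ _ _ _)) D'Q sw cK KD')
  Dg fsign vsign.
have Ja : `[a', b']%classic a by rewrite /= in_itv/=; move: a'a ab bb'; lra.
have Jb : `[a', b']%classic b by rewrite /= in_itv/=; move: a'a ab bb'; lra.
have imax t (L : set space) : `[a', b']%classic t -> compact L -> L `<=` K1 ->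
    (lebesgue_rV R n).-integrable L (fun y => (Num.max (u (y, t) - w (y, t)) 0)%:E).
  move=> Jt cL LK; apply: (compact_integrable_rV (f := fun y => Num.max (u (y, t) - w (y, t)) 0) cL).
  have cmax : continuous (fun x : R => Num.max x 0).
    by move=> x; apply: continuous_max; [exact: cvg_id|exact: cst_continuous].
  have cs := within_slice Dcont Jt.
  apply: (continuous_subspaceW LK) => y.
  exact: (@continuous_comp (subspace K1) R R (fun y => u (y, t) - w (y, t)) (fun x => Num.max x 0) y (cs y) (cmax _)).
have aT : 0 < a < T by rewrite a0; move: ab bT T2T; lra.
have bT' : 0 < b < T by rewrite b0; move: bT T2T; lra.
(* At time a, (u - w)_+ <= u because w > 0, and [K1] lies in the ball of radius eps on which the
   mass is below A. *)
have Ha : \int[lebesgue_rV R n]_(y in K1) Num.max (u (y, a) - w (y, a)) 0 <= A.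
  apply: (@le_trans _ _ (\int[lebesgue_rV R n]_(y in K1) u (y, a))).
    apply: le_Rintegral => //; [exact: compact_measurable_rV|exact: imax|exact: slice_integrable|].
    move=> y Ky; rewrite ge_max (ltW (slice_gt0 K1O aT Ky)) andbT lerBlDr lerDl ltW// w0//.
    by split; [exact: K1r|rewrite /= in_itv/= aT].
  rewrite -lee_fin -Rintegral_EFin//; [|exact: compact_measurable_rV|exact: slice_integrable].
  apply: le_trans (ltW aA); apply: ge0_subset_integral.
  - exact: compact_measurable_rV.
  - by apply: measurableI; apply: open_measurable_rV => //; exact: eball_open.
  - apply/measurable_EFinP; apply: within_continuous_measurable_rV.
      by apply: measurableI; apply: open_measurable_rV => //; exact: eball_open.
    by apply: (@within_slice _ _ _ `]0, T[%classic); [apply: continuous_subspaceW cu; apply: setSX|rewrite /= in_itv].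
  - by move=> y [_ Oy]; rewrite lee_fin ltW// u0//; split => //; rewrite /= in_itv.
  - move=> y Ky; split; last exact: K1O.
    by apply: lt_trans reps; exact: K1r.
have cr : compact (ceball z (r / 2)) by exact: ceball_compact.
have rK0 : ceball z (r / 2) `<=` K0 by move=> y; rewrite /K0 /ceball/=; move: d'r; lra.
have K0K1 : K0 `<=` K1 by move=> y; rewrite /K0 /K1 /ceball/=; move: d'0; lra.
have rK1 : ceball z (r / 2) `<=` K1 by move=> y /rK0; exact: K0K1.
have rO2 : ceball z (r / 2) `<=` Omega by move=> y /rK1; exact: K1O.
have mr := compact_measurable_rV cr.
have iC : (lebesgue_rV R n).-integrable (ceball z (r / 2)) (EFin \o (fun=> C)).
  by apply: compact_integrable_rV => // y; exact: cst_continuous.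
(* u <= (u - w)_+ + C on the ball of half radius, where w <= C. *)
apply: (@le_trans _ _ (\int[lebesgue_rV R n]_(y in ceball z (r / 2)) (Num.max (u (y, b) - w (y, b)) 0 + C))).
  apply: le_Rintegral => //; first exact: slice_integrable.
    by have := integrableD mr (imax b _ Jb cr rK1) iC.
  move=> y Ky; have := wC (y, b); rewrite ler_norml => /(_ _)/andP[].
    by split => //=; rewrite in_itv/= !ltW.
  by move=> _ wb; rewrite -lerBlDr le_max lerD2l lerN2 wb.
rewrite RintegralD//; last exact: imax.
rewrite Rintegral_cst// lerD2r (le_trans _ Ha)// (le_trans _ H)//.
apply: Rintegral_subset => //; [exact: compact_measurable_rV|exact: imax|].
by move=> y _; rewrite le_max lexx orbT.
Unshelve. all: by end_near. Qed.

End absorption.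

(** * The singular set and its complement *)

Section regular_set.
Context (R : realType) (n : nat).
Local Notation space := 'rV[R]_n.
Local Notation spacetime := ('rV[R]_n * R)%type.
Variables (Omega : set space) (g : space -> R -> R -> R) (T : R) (u : spacetime -> R).
Hypothesis g_cont : {within Omega `*` `]0, +oo[%classic `*` [set: R],
  continuous (fun q : space * R * R => g q.1.1 q.1.2 q.2)}.
Hypothesis oO : open Omega.
Hypothesis g_ndec : forall x t, Omega x -> 0 < t -> forall r s, r <= s -> g x t r <= g x t s.
Hypothesis g_sign : forall x t r, Omega x -> 0 < t -> 0 <= r * g x t r.
Hypothesis barrier : forall z, Omega z -> strong_barrier g Omega T z.
Hypothesis T0 : 0 < T.
Local Notation Q := (Omega `*` `]0, T[%classic : set spacetime).
Hypothesis cu : {within Q, continuous u}.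
Hypothesis u0 : forall p, Q p -> 0 < u p.
Hypothesis su : solution g Q u.

Definition singular_set : set space := [set z | Omega z /\ forall eps, 0 < eps ->
  (\int[lebesgue_rV R n]_(x in eball z eps `&` Omega) (u (x, t))%:E)%E
    @[t --> 0^'+] --> +oo%E].

Local Notation W := (Omega `\` singular_set).

Let WO : W `<=` Omega. Proof. by move=> x []. Qed.

Let regular_bound z : W z -> exists rho : R,
  [/\ 0 < rho, ceball z rho `<=` Omega & mass_bounded T u (ceball z rho)].
Proof.
move=> [Oz nS]; apply: (local_bound g_cont oO g_ndec T0 cu u0 su Oz (barrier Oz)).
by move=> H; apply: nS.
Qed.

(** A ball of bounded mass contains a small ball around each point of its interior, and on that ball
    the mass cannot tend to infinity. *)
Lemma regular_open : open W.
Proof.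
rewrite openE => z /regular_bound[rho [rho0 rO [t0 [M [/andP[t00 t0T] uM]]]]].
have : nbhs z (eball z rho).
  by apply: open_nbhs_nbhs; split; [exact: eball_open|exact: eball_center].
apply: filterS => y yr; split; first by apply: rO; exact: ltW.
move=> [_ H].
have : nbhs y (eball z rho) by apply: open_nbhs_nbhs; split => //; exact: eball_open.
move=> /nbhs_ballP[e /= e0 er].
have {er}er : eball y e `<=` ceball z rho.
  by move=> x /eball_sub_ball xy; apply: ltW; apply: er; rewrite -ball_normE.
have /cvgeyPge/(_ (M + 1)) ubig := H e e0.
have [t tP] : exists t, [/\ 0 < t, t < t0 & ((M + 1)%:E <=
    \int[lebesgue_rV R n]_(x in eball y e `&` Omega) (u (x, t))%:E)%E].
  apply: (@filter_ex _ (0^'+)); near=> t; split; near: t; [exact: nbhs_right_gt|exact: nbhs_right_lt|exact: ubig].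
have [t_0 tt0 Mt] := tP.
have tT : 0 < t < T by rewrite t_0 (lt_trans tt0).
have cr := @ceball_compact R n z rho; have mr := compact_measurable_rV cr.
have := uM t; rewrite t_0 tt0 => /(_ isT); rewrite leNgt => /negP; apply.
rewrite -lte_fin -Rintegral_EFin//; last exact: (slice_integrable cu).
apply: (@lt_le_trans _ _ (M + 1)%:E); first by rewrite lte_fin ltrDl.
apply: (le_trans Mt); apply: ge0_subset_integral => //.
- by apply: measurableI; apply: open_measurable_rV => //; exact: eball_open.
- by have /integrableP[] := slice_integrable cu cr rO tT.
- by move=> x xr; rewrite lee_fin; exact/ltW/(slice_gt0 u0 rO tT).
- by move=> x [/er].
Unshelve. all: by end_near. Qed.

Lemma singular_relatively_closed : relatively_closed Omega singular_set.
Proof.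
exists (~` W); first by rewrite closedC; exact: regular_open.
apply/seteqP; split => [x Sx|x [Ox]].
  by split => [|[_]//]; case: Sx.
by move=> nW; apply: contrapT => nS; apply: nW.
Qed.

(** Finitely many balls of bounded mass cover [K]; since u > 0, the mass of their union is at most
    the sum of their masses. *)
Lemma compact_mass_bounded (K : set space) : compact K -> K `<=` W -> mass_bounded T u K.
Proof.
move=> cK KW.
have /choice[rho rhoP] : forall z, exists rho : R, W z ->
    [/\ 0 < rho, ceball z rho `<=` Omega & mass_bounded T u (ceball z rho)].
  move=> z; have [/regular_bound[rho ?]|nW] := pselect (W z); first by exists rho.
  (* An arbitrary default radius, as the claim is void outside [W]. *)
  by exists 0.
have [D DK KD] : finite_subset_cover K (fun z => eball z (rho z)) K.
  move: (cK); rewrite compact_cover; apply; first by move=> z _; exact: eball_open.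
  by move=> z Kz; exists z => //; apply: eball_center; have [] := rhoP _ (KW _ Kz).
have : forall s : seq space, (forall z, z \in s -> W z) ->
    let U := \big[setU/set0]_(z <- s) ceball z (rho z) in
    [/\ compact U, U `<=` Omega & mass_bounded T u U].
  elim=> [_|z s ih sW] /=.
    rewrite big_nil; split => //; first exact: compact0.
    by exists (T / 2), 0; split => [|t _]; rewrite ?Rintegral_set0// divr_gt0//= ltr_pdivrMr// ltr_pMr// ltr1n.
  have /ih[cU UO [t0 [M [/andP[t00 t0T] UM]]]] : forall z, z \in s -> W z.
    by move=> y ys; apply: sW; rewrite inE ys orbT.
  have [rz zO [t0' [M' [/andP[t00' t0T'] UM']]]] : [/\ 0 < rho z, ceball z (rho z) `<=` Omega & mass_bounded T u (ceball z (rho z))].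
    by apply: rhoP; apply: sW; rewrite inE eqxx.
  have cz := @ceball_compact R n z (rho z).
  rewrite big_cons; split; [exact: compactU|by rewrite subUset|].
  set U := \big[_/_]_(_ <- _) _ in cU UO UM *.
  exists (Num.min t0 t0'), (M' + M); split; first by rewrite lt_min t00 t00' gt_min t0T.
  move=> t /andP[t_0]; rewrite lt_min => /andP[tt0 tt0'].
  have tT : 0 < t < T by rewrite t_0 (lt_trans tt0).
  apply: le_trans (lerD (UM' t _) (UM t _)); rewrite ?t_0//.
  have [mz mU] := (compact_measurable_rV cz, compact_measurable_rV cU).
  have cc : compact (ceball z (rho z) `|` U) by exact: compactU.
  have ccO : ceball z (rho z) `|` U `<=` Omega by rewrite subUset.
  have UE : ceball z (rho z) `|` U = ceball z (rho z) `|` (U `\` ceball z (rho z)).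
    by rewrite setUDr setDv setD0.
  rewrite UE Rintegral_setU//; last 3 first.
  - exact: measurableD.
  - by rewrite -UE; exact: (slice_integrable cu).
  - by apply/disj_setPS => x [? []].
  rewrite lerD2l; apply: Rintegral_subset => //; first exact: measurableD.
  - exact: (slice_integrable cu).
  by move=> x Ux; exact/ltW/(slice_gt0 u0 UO tT).
move=> /(_ (finmap.enum_fset D)) [z zD|cU UO [t0 [M [t00 UM]]]].
  by apply: KW; have := DK z zD; rewrite inE.
exists t0, M; split => // t tt0; apply: le_trans (UM t tt0).
have tT : 0 < t < T by move: tt0 t00 => /andP[-> h] /andP[_]; exact: lt_trans.
apply: Rintegral_subset; [exact: compact_measurable_rV|exact: compact_measurable_rV| | |].
- exact: (slice_integrable cu).
- by move=> x Ux; exact/ltW/(slice_gt0 u0 UO tT).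
- by move=> x /KD[z zD /ltW xz]; rewrite -bigcup_seq; exists z.
Qed.

End regular_set.

(** * The limit functional *)

Section limit_functional.
Context (R : realType) (n : nat).
Local Notation space := 'rV[R]_n.
Local Notation spacetime := ('rV[R]_n * R)%type.
Variables (Omega : set space) (g : space -> R -> R -> R) (T : R) (u : spacetime -> R).
Hypothesis g_cont : {within Omega `*` `]0, +oo[%classic `*` [set: R],
  continuous (fun q : space * R * R => g q.1.1 q.1.2 q.2)}.
Hypothesis oO : open Omega.
Hypothesis g_ndec : forall x t, Omega x -> 0 < t -> forall r s, r <= s -> g x t r <= g x t s.
Hypothesis g_sign : forall x t r, Omega x -> 0 < t -> 0 <= r * g x t r.
Hypothesis barrier : forall z, Omega z -> strong_barrier g Omega T z.
Hypothesis T0 : 0 < T.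
Local Notation Q := (Omega `*` `]0, T[%classic : set spacetime).
Hypothesis cu : {within Q, continuous u}.
Hypothesis u0 : forall p, Q p -> 0 < u p.
Hypothesis su : solution g Q u.

Local Notation W := (Omega `\` singular_set Omega u).
Let WO : W `<=` Omega. Proof. by move=> x []. Qed.
Let oW : open W. Proof. exact: (regular_open g_cont oO g_ndec barrier T0 cu u0 su). Qed.
Let mW : measurable W. Proof. exact: open_measurable_rV. Qed.

Definition slice_pairing (zeta : space -> R) (t : R) :=
  \int[lebesgue_rV R n]_(y in Omega `\` singular_set Omega u) (u (y, t) * zeta y).

Lemma weight_integrable (K : set space) (h : space -> R) (B t : R) : compact K -> K `<=` W ->
  measurable_fun setT h -> (forall y, `|h y| <= B) -> (forall y, ~ K y -> h y = 0) -> 0 < t < T ->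
  [/\ (lebesgue_rV R n).-integrable K (EFin \o (fun y => u (y, t) * h y)),
      (lebesgue_rV R n).-integrable W (EFin \o (fun y => u (y, t) * h y)) &
      slice_pairing h t = \int[lebesgue_rV R n]_(y in K) (u (y, t) * h y)].
Proof.
move=> cK KW mh hB hK tT; have mK := compact_measurable_rV cK.
have iK : (lebesgue_rV R n).-integrable K (EFin \o (fun y => u (y, t) * h y)).
  apply: (@integrableM_bounded _ _ _ _ _ (fun y => u (y, t)) h B) => //; last exact: measurable_funTS.
  by apply: (slice_integrable cu) => // x /KW/WO.
have E : (fun y => u (y, t) * h y) \_ W = (fun y => u (y, t) * h y) \_ K.
  apply/funext => y; rewrite !patchE; case: ifPn => [yW|yW].
    by case: ifPn => //; rewrite notin_setE => /hK ->; rewrite mulr0.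
  by rewrite ifF//; apply/negP => /set_mem/KW/mem_set; exact/negP.
split => //; last by rewrite /slice_pairing Rintegral_mkcond E -Rintegral_mkcond.
apply/(integrable_mkcond _ mW); move: iK => /(integrable_mkcond _ mK).
by rewrite !restrict_EFin E.
Qed.

Let support_bound zeta : continuous_cpt W zeta -> exists (K : set space) (B : R),
  [/\ compact K, K `<=` W, 0 < B, (forall y, `|zeta y| <= B) & forall y, ~ K y -> zeta y = 0].
Proof.
move=> [cz [K [cK KW zK]]].
have [B B0 zB] := compact_bounded_fun cK (continuous_subspaceT cz).
exists K, B; split => // y; have [/zB//|/zK ->] := pselect (K y); by rewrite normr0 ltW.
Qed.

Let mzeta zeta : continuous_cpt W zeta -> measurable_fun setT zeta.
Proof. by move=> [cz _]; exact: continuous_measurable_rV. Qed.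

Lemma slice_pairing_integrable zeta t : continuous_cpt W zeta -> 0 < t < T ->
  (lebesgue_rV R n).-integrable W (EFin \o (fun y => u (y, t) * zeta y)).
Proof.
move=> Cz tT; have [K [B [cK KW B0 zB zK]]] := support_bound Cz.
by have [] := weight_integrable cK KW (mzeta Cz) zB zK tT.
Qed.

Lemma slice_pairingD f h t : continuous_cpt W f -> continuous_cpt W h -> 0 < t < T ->
  slice_pairing (fun x => f x + h x) t = slice_pairing f t + slice_pairing h t.
Proof.
move=> Cf Ch tT; rewrite /slice_pairing -RintegralD//; [|exact: slice_pairing_integrable|exact: slice_pairing_integrable].
by apply: eq_Rintegral => y _; rewrite mulrDr.
Qed.

Lemma slice_pairingZ c f t : continuous_cpt W f -> 0 < t < T ->
  slice_pairing (fun x => c * f x) t = c * slice_pairing f t.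
Proof.
move=> Cf tT; rewrite /slice_pairing -RintegralZl//; last exact: slice_pairing_integrable.
by apply: eq_Rintegral => y _; rewrite mulrCA.
Qed.

Lemma slice_pairing_ge0 f t : (forall x, 0 <= f x) -> 0 < t < T -> 0 <= slice_pairing f t.
Proof.
move=> f0 tT; apply: Rintegral_ge0 => // x Wx; rewrite mulr_ge0// ltW//.
exact: (slice_gt0 u0 WO tT).
Qed.

Let near0 : \forall t \near (0:R)^'+, 0 < t < T.
Proof. by near=> t; apply/andP; split; near: t; [exact: nbhs_right_gt|exact: nbhs_right_lt].
Unshelve. all: by end_near. Qed.

(** Uniform continuity on a thickening of the support suffices: two close points either both lie in
    it or both miss the support. *)
Let cpt_unif_continuous zeta : continuous_cpt W zeta -> forall e : R, 0 < e ->
  exists2 d : R, 0 < d & forall x y, `|x - y| < d -> `|zeta x - zeta y| <= e.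
Proof.
move=> [cz [K [cK KW zK]]] e e0.
have [K1 [eta [cK1 _ eta0 KK1]]] := compact_thickening oW cK KW.
have [d d0 zd] := compact_unif_continuous cK1 (continuous_subspaceT cz) e0.
have K1x x : K x -> K1 x by move=> /KK1; apply; rewrite subrr normr0.
exists (Num.min d eta) => [|x y]; first by rewrite lt_min d0.
rewrite lt_min => /andP[xyd xye].
have [Kx|Kx] := pselect (K x).
  by apply/ltW/zd => //; [exact: K1x|exact: (KK1 x)].
have [Ky|Ky] := pselect (K y).
  by apply/ltW/zd => //; [apply: (KK1 y) => //; rewrite distrC|exact: K1x].
by rewrite !zK// subrr normr0 ltW.
Qed.

(* The inf-convolutions of [zeta] are semiconcave, so that their pairings with
   [u] are almost monotone in time, and they approximate [zeta] uniformly. *)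
Lemma slice_pairing_cvg_ge0 zeta : continuous_cpt W zeta -> (forall x, 0 <= zeta x) ->
  cvg (slice_pairing zeta t @[t --> 0^'+]).
Proof.
move=> Cz z0; have [K [B [cK KW B0 zB zK]]] := support_bound Cz.
have [K1 [eta [cK1 K1W eta0 KK1]]] := compact_thickening oW cK KW.
have [t0 [M [/andP[t00 t0T] uM]]] :=
  compact_mass_bounded g_cont oO g_ndec barrier T0 cu u0 su cK1 K1W.
have KK1' : K `<=` K1 by move=> x /KK1; apply; rewrite subrr normr0.
have [K1O KO] : K1 `<=` Omega /\ K `<=` Omega by split=> x; [move/K1W/WO|move/KW/WO].
(* A positive bound of the mass, so that e / M1 makes sense below: a uniform error e / M1 on the
   weight becomes an error e on the pairing with u. *)
pose M1 := Num.max M 1.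
have M10 : 0 < M1 by rewrite lt_max ltr01 orbT.
have tT t : 0 < t < t0 -> 0 < t < T by move=> /andP[-> /lt_trans]; exact.
have uM1 t : 0 < t < t0 -> \int[lebesgue_rV R n]_(y in K1) u (y, t) <= M1.
  by move=> /uM h; rewrite le_max h.
have mK := compact_measurable_rV cK; have mK1 := compact_measurable_rV cK1.
have iu t : 0 < t < t0 -> (lebesgue_rV R n).-integrable K (fun y => (u (y, t))%:E).
  by move=> /tT; exact: (slice_integrable cu).
have uK t : 0 < t < t0 -> \int[lebesgue_rV R n]_(y in K) u (y, t) <= M1.
  move=> tt0; apply: le_trans (uM1 t tt0); apply: Rintegral_subset => //.
    by apply: (slice_integrable cu) => //; exact: tT.
  by move=> x Kx; exact/ltW/(slice_gt0 u0 K1O (tT t tt0)).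
have scaled (h : space -> R) (c t : R) : 0 < t < t0 -> 0 <= c ->
    (lebesgue_rV R n).-integrable K (EFin \o (fun y => u (y, t) * h y)) ->
    (forall y, h y <= c) -> \int[lebesgue_rV R n]_(y in K) (u (y, t) * h y) <= c * M1.
  move=> tt0 c0 ih hc.
  apply: (@le_trans _ _ (\int[lebesgue_rV R n]_(y in K) (c * u (y, t)))).
    apply: le_Rintegral => //; first by have := integrableZl mK c (iu t tt0).
    by move=> y Ky; rewrite mulrC ler_wpM2r//; exact/ltW/(slice_gt0 u0 KO (tT t tt0)).
  by rewrite RintegralZl//; [rewrite ler_wpM2l// uK|exact: iu].
apply: cvg_right_approx => e e0.
have eM0 : 0 < e / M1 by rewrite divr_gt0.
have [d d0 zd] := cpt_unif_continuous Cz eM0.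
(* With this coefficient the penalty at distance d equals B, as [infconv_approx] requires. *)
pose la := B / d ^+ 2.
have la0 : 0 <= la by rewrite divr_ge0 ?ltW// exprn_gt0.
have zB' x : zeta x <= B by rewrite (le_trans (ler_norm _)).
pose zl := infconv zeta B la.
have zl0 x : 0 <= zl x by exact: infconv_ge0.
have zlz x : zl x <= zeta x by exact: infconv_le_fun.
have zlB x : `|zl x| <= B by rewrite ger0_norm// (le_trans (zlz x)).
have zlK x : ~ K x -> zl x = 0.
  by move=> Kx; apply/eqP; rewrite eq_le zl0 andbT -(zK x Kx).
have mzl : measurable_fun setT zl by exact: infconv_measurable.
have wl t tt0 := weight_integrable cK KW mzl zlB zlK (tT t tt0).
have wz t tt0 := weight_integrable cK KW (mzeta Cz) zB zK (tT t tt0).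
have close : \forall t \near (0:R)^'+, `|slice_pairing zeta t - slice_pairing zl t| <= e.
  near=> t.
  have tt0 : 0 < t < t0.
    by apply/andP; split; near: t; [exact: nbhs_right_gt|exact: nbhs_right_lt].
  have [iz _ ->] := wz t tt0; have [il _ ->] := wl t tt0.
  have id : (lebesgue_rV R n).-integrable K (EFin \o (fun y => u (y, t) * (zeta y - zl y))).
    have := integrableB mK iz il; congr (_.-integrable _ _); apply/funext => y /=.
    by rewrite -EFinB mulrBr.
  rewrite -RintegralB// ger0_norm; last first.
    apply: Rintegral_ge0 => // y Ky; rewrite -mulrBr mulr_ge0 ?subr_ge0//.
    exact/ltW/(slice_gt0 u0 KO (tT t tt0)).
  under eq_Rintegral do rewrite -mulrBr.
  apply: (le_trans (scaled _ (e / M1) t tt0 (ltW eM0) id _)); last first.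
    by rewrite -mulrA mulVf ?mulr1// gt_eqF.
  move=> y; rewrite lerBlDr addrC -lerBlDr; apply: (infconv_approx z0 zB' la0 d0 (ltW eM0) zd).
  by rewrite divfK// expf_neq0// gt_eqF.
exists (slice_pairing zl) => //.
apply: (@cvg_right_monotone _ _ t0 (B * M1) (n%:R * (2 * la * M1)) t00).
  - move=> t tt0; have [ik _ ->] := wl t tt0; apply: scaled => //; first exact: ltW.
    by move=> y; rewrite (le_trans (zlz y)).
  - by rewrite mulr_ge0 ?ler0n// mulr_ge0 ?(ltW M10)// mulr_ge0.
  move=> a b a0 ab bt0.
  have aP : 0 < a < t0 by rewrite a0 (le_lt_trans ab).
  have bP : 0 < b < t0 by rewrite bt0 (lt_le_trans a0).
  have [_ _ ->] := wl a aP; have [_ _ ->] := wl b bP.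
  pose a' := a / 2; pose b' := (b + t0) / 2.
  have [a'0 a'a] : 0 < a' /\ a' < a by rewrite /a'; lra.
  have [bb' b't] : b < b' /\ b' < t0 by rewrite /b'; lra.
  pose J := K1 `*` `[a', b']%classic.
  have cJ : compact J by apply: compact_setX => //; exact: segment_compact.
  have JQ : J `<=` Q.
    apply: setSX => // t; rewrite /= ?in_itv/= => /andP[at' tb].
    by rewrite ?in_itv/= (lt_le_trans a'0)//= (le_lt_trans tb)// (lt_trans b't).
  have JQ0 p : J p -> Omega p.1 /\ 0 < p.2.
    by move=> /JQ[Op /=]; rewrite in_itv/= => /andP[].
  have [[iuQ igQ] _] := su.
  have mQ := domain_measurable T oO.
  (* Dividing the sign condition by u > 0 leaves g(x,t,u) >= 0. *)
  have f0 p : J p -> 0 <= g p.1 p.2 (u p).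
    move=> Jp; have [Op p2] := JQ0 p Jp; have := g_sign (u p) Op p2.
    by rewrite pmulr_rge0// u0//; exact: JQ.
  have H := semiconcave_almost_decreasing cK cK1 eta0 KK1 a'a ab bb' (continuous_subspaceW JQ cu)
    (iuQ _ cJ JQ) (igQ _ cJ JQ) (solution_weak_subsol mQ su cJ JQ) mzl (ex_intro _ B zlB) zl0 zlK
    (mulr_ge0 (ler0n _ 2) la0) (infconv_semiconcave z0 zB' la0) (fun p Jp => ltW (u0 (JQ p Jp))) f0
    (M := M1).
  have mulE t : \int[lebesgue_rV R n]_(y in K) (u (y, t) * zl y) =
      \int[lebesgue_rV R n]_(y in K) (zl y * u (y, t)).
    by apply: eq_Rintegral => y _; rewrite mulrC.
  rewrite !mulE; apply: H => s /andP[as_ sb]; apply: uM1;  rewrite (lt_le_trans a0 as_) (le_lt_trans sb).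
Unshelve. all: by end_near. Qed.

Let slice_pairing_cvgD f h : continuous_cpt W f -> continuous_cpt W h -> forall a b : R,
  slice_pairing f t @[t --> 0^'+] --> a -> slice_pairing h t @[t --> 0^'+] --> b ->
  slice_pairing (fun x => f x + h x) t @[t --> 0^'+] --> a + b.
Proof.
move=> Cf Ch a b fa hb; apply: cvg_trans (cvgD fa hb); apply: near_eq_cvg.
by near=> t; rewrite /= slice_pairingD//; near: t; exact: near0.
Unshelve. all: by end_near. Qed.

Let slice_pairing_cvgZ c f : continuous_cpt W f -> forall a : R, slice_pairing f t @[t --> 0^'+] --> a ->
  slice_pairing (fun x => c * f x) t @[t --> 0^'+] --> c * a.
Proof.
move=> Cf a fa; apply: cvg_trans (cvgM (cvg_cst c) fa); apply: near_eq_cvg.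
by near=> t; rewrite /= slice_pairingZ//; near: t; exact: near0.
Unshelve. all: by end_near. Qed.

Lemma slice_pairing_cvg zeta : continuous_cpt W zeta -> cvg (slice_pairing zeta t @[t --> 0^'+]).
Proof.
move=> Cz; have [cz [K [cK KW zK]]] := Cz.
have Cp f : continuous_cpt W f -> continuous_cpt W (fun x => Num.max (f x) 0).
  move=> [cf [L [cL LW fL]]]; split; first exact: continuous_max0.
  by exists L; split => // x /fL ->; rewrite maxxx.
have C1 := Cp _ Cz; have C2 := Cp _ (continuous_cptZ (-1) Cz).
have pos (f : space -> R) x : 0 <= Num.max (f x) 0 by rewrite le_max lexx orbT.
have /cvg_ex[a ca] := slice_pairing_cvg_ge0 C1 (pos zeta).
have /cvg_ex[b cb] := slice_pairing_cvg_ge0 C2 (pos (fun x => -1 * zeta x)).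
apply/cvg_ex; exists (a + -1 * b).
have -> : zeta = fun x => Num.max (zeta x) 0 + -1 * Num.max (-1 * zeta x) 0.
  by apply/funext => x; rewrite !mulN1r; case: (leP (zeta x) 0) => ?; case: leP; lra.
by apply: slice_pairing_cvgD => //; [exact: continuous_cptZ|exact: slice_pairing_cvgZ].
Qed.

Lemma regular_trace : exists mu : {measure set space -> \bar R},
  [/\ radon_on W mu, outer_regular_on W mu & forall zeta, continuous_cpt W zeta ->
    (\int[lebesgue_rV R n]_(x in W) (u (x, t) * zeta x)%:E)%E @[t --> 0^'+] -->
    (\int[mu]_(x in W) (zeta x)%:E)%E].
Proof.
pose L zeta := lim (slice_pairing zeta t @[t --> 0^'+]).
have [mu [radon outer muL]] : exists mu : {measure set space -> \bar R},
  [/\ radon_on W mu, outer_regular_on W mu &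
      forall f, continuous_cpt W f -> (\int[mu]_(x in W) (f x)%:E = (L f)%:E)%E].
  apply: riesz_representation => //.
  - by move=> f h Cf Ch; apply: cvg_lim => //; apply: slice_pairing_cvgD => //; exact: slice_pairing_cvg.
  - by move=> c f Cf; apply: cvg_lim => //; apply: slice_pairing_cvgZ => //; exact: slice_pairing_cvg.
  - move=> f Cf f0; apply: limr_ge; first exact: slice_pairing_cvg.
    by near=> t; apply: slice_pairing_ge0 => //; near: t; exact: near0.
exists mu; split => // zeta Cz; rewrite muL//.
have : (slice_pairing zeta t)%:E @[t --> 0^'+] --> (L zeta)%:E.
  by apply: cvg_EFin; [near=> t|exact: slice_pairing_cvg].
apply: cvg_trans; apply: near_eq_cvg; near=> t.
rewrite Rintegral_EFin//; apply: slice_pairing_integrable => //; near: t; exact: near0.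
Unshelve. all: by end_near. Qed.

End limit_functional.

(** * The initial trace *)

Section hitting_measure.
Context d (X : measurableType d) (R : realType) (S : set X).
Local Open Scope ereal_scope.

Definition hitting (E : set X) : \bar R := if `[< E `&` S !=set0 >] then +oo else 0.

Let hitting0 : hitting set0 = 0.
Proof. by rewrite /hitting; case: asboolP => // -[x []]. Qed.

Let hitting_ge0 E : 0 <= hitting E.
Proof. by rewrite /hitting; case: ifP. Qed.

Let hitting_sigma_additive : semi_sigma_additive hitting.
Proof.
move=> F mF tF mUF; rewrite {2}/hitting; case: asboolP => [[x [[i _ Fix] Sx]]|H].
  apply: cvg_near_cst; near=> k; apply/eqP; rewrite big_mkord.
  (* Past the index i of a set meeting [S], every partial sum contains an infinite term. *)
  have ik : (i < k)%N by near: k; exists i.+1.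
  rewrite (bigD1 (Ordinal ik))//= {1}/hitting asboolT; last by exists x.
  by rewrite addye// gt_eqF// (lt_le_trans (ltNyr 0))// sume_ge0.
rewrite (_ : (fun _ => _) = cst 0); first exact: cvg_cst.
apply/funext => k /=; rewrite big1// => i _; rewrite /hitting asboolF// => -[x [Fix Sx]].
by apply: H; exists x; split => //; exists i.
Unshelve. all: by end_near. Qed.

HB.instance Definition _ := isMeasure.Build _ _ _ hitting hitting0 hitting_ge0 hitting_sigma_additive.

Lemma hitting_pinfty E : E `&` S !=set0 -> hitting E = +oo.
Proof. by move=> ES; rewrite /hitting asboolT. Qed.

Lemma hitting_eq0 E : ~ (E `&` S !=set0) -> hitting E = 0.
Proof. by move=> ES; rewrite /hitting asboolF. Qed.

End hitting_measure.

Unset Implicit Arguments.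

Theorem theoremA (R : realType) (N : nat) (Omega : set 'rV[R]_N) (T : R)
    (g : 'rV[R]_N -> R -> R -> R) (u : 'rV[R]_N * R -> R)
    (N_gt0 : (0 < N)%N)
    (Omega_dom : open_domain Omega)
    (T_gt0 : 0 < T)
    (g_cont : {within Omega `*` `]0, +oo[%classic `*` [set: R],
       continuous (fun q : 'rV[R]_N * R * R => g q.1.1 q.1.2 q.2)})
    (g_ndec : forall x t, Omega x -> 0 < t ->
       forall r s, r <= s -> g x t r <= g x t s)
    (g_sign : forall x t r, Omega x -> 0 < t -> 0 <= r * g x t r)
    (barrier : forall z, Omega z -> strong_barrier g Omega T z)
    (u_C1 : C1_on (Omega `*` `]0, T[%classic) u)
    (u_gt0 : forall p, (Omega `*` `]0, T[%classic) p -> 0 < u p)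
    (u_sol : solution g (Omega `*` `]0, T[%classic) u) :
  exists (S : set 'rV[R]_N) (mu nu : {measure set 'rV[R]_N -> \bar R}),
    [/\ initial_trace Omega u S mu,
        trace_measure Omega S mu nu &
        outer_regular_on Omega nu].
Proof.
have [oO _ _] := Omega_dom; have [cu _] := u_C1.
pose S := singular_set Omega u.
have [mu [radon outer muL]] :=
  regular_trace g_cont oO g_ndec g_sign barrier T_gt0 cu u_gt0 u_sol.
have SO : S `<=` Omega by move=> x [].
have mu_W : mu (~` (Omega `\` S)) = 0%E by case: radon.
have mW : measurable (Omega `\` S).
  exact: (open_measurable_rV (regular_open g_cont oO g_ndec barrier T_gt0 cu u_gt0 u_sol)).
pose nu : {measure set 'rV[R]_N -> \bar R} := measure_add mu (hitting R S).
have nuE E : measurable E -> nu E = (mu E + hitting R S E)%E by move=> mE; exact: measure_addE.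
have nu_hit E : measurable E -> E `&` S !=set0 -> nu E = +oo%E.
  move=> mE ES; rewrite nuE// hitting_pinfty// addey//.
  by rewrite gt_eqF// (lt_le_trans _ (measure_ge0 mu E)).
have nu_mu E : measurable E -> ~ (E `&` S !=set0) -> nu E = mu E.
  by move=> mE ES; rewrite nuE// hitting_eq0// adde0.
have W_nhit E : E `<=` Omega `\` S -> ~ (E `&` S !=set0).
  by move=> EW [x [/EW[_ Sx]]].
exists S, mu, nu; split.
- split => //; last by move=> x0 [].
  exact: (singular_relatively_closed g_cont oO g_ndec barrier T_gt0 cu u_gt0 u_sol).
- split; last by move=> E mE EW; rewrite nu_mu//; exact: W_nhit.
  + have mO : measurable (~` Omega) by apply: measurableC; exact: open_measurable_rV.
    rewrite /carried_by nu_mu//; last by move=> [x [Ox /SO]].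
    apply/eqP; rewrite eq_le measure_ge0 andbT -mu_W le_measure ?inE//; first exact: measurableC.
    by apply: subsetC => x [].
  + by move=> E mE _; exact: nu_hit.
- move=> E mE EO; apply/eqP; rewrite eq_le; apply/andP; split.
    apply: le_ereal_inf_tmp => _ [V [oV EV _] <-].
    by apply: le_measure; rewrite ?inE//; exact: open_measurable_rV.
  have [ES|ES] := pselect (E `&` S !=set0); first by rewrite nu_hit// leey.
  (* A set missing [S] lies in the open set of regular points. The competitors given by outer
     regularity of [mu] inside that set also miss [S], so [nu] and [mu] agree on them. *)
  have EW : E `<=` Omega `\` S.
    by move=> x Ex; split; [exact: EO|move=> Sx; apply: ES; exists x].
  rewrite nu_mu// outer//; apply: le_ereal_inf => _ [V [oV EV VW] <-].
  exists V; first by split => // x /VW[].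
  by rewrite nu_mu//; [exact: open_measurable_rV|exact: W_nhit].
Qed.
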